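(* Let $k\ge 3$ be an integer, let $d'>0$ be a fixed real number with $d'/k\le 2^{k-1}\ln 2-2$, and let $m=\lceil d'n/k\rceil$. Then the random colouring model is contiguous with respect to the planted model, i.e. $(\pi^{\mathrm{rc}}_{k,n,m})_{n\ge1}\triangleleft(\pi^{\mathrm{pl}}_{k,n,m})_{n\ge1}$: for every sequence $(\mathcal{E}_n)_{n\ge1}$ of events $\mathcal{E}_n\subset\Lambda_{k,n,m}$ with $\lim_{n\to\infty}\pi^{\mathrm{pl}}_{k,n,m}[\mathcal{E}_n]=0$ we have $\lim_{n\to\infty}\pi^{\mathrm{rc}}_{k,n,m}[\mathcal{E}_n]=0$.
   Context: $[n]=\{1,\dots,n\}$. A 2-colouring of a hypergraph $H$ on $[n]$ is a map $\sigma:[n]\to\{0,1\}$ such that no edge of $H$ is monochromatic under $\sigma$ (an edge $e$ is monochromatic if $|\sigma(e)|=1$, and bichromatic otherwise). $Z(H)$ is the number of 2-colourings of $H$. $\Lambda_{k,n,m}$ is the set of all pairs $(H,\sigma)$ where $H$ is a $k$-uniform hypergraph on $[n]$ with exactly $m$ (distinct) edges and $\sigma$ is a 2-colouring of $H$. The random colouring model $\pi^{\mathrm{rc}}_{k,n,m}$ is the distribution on $\Lambda_{k,n,m}$ obtained by first choosing $H$ uniformly at random among all $k$-uniform hypergraphs on $[n]$ with exactly $m$ edges, conditioned on $Z(H)>0$, and then choosing a 2-colouring $\sigma$ of $H$ uniformly at random; equivalently $\pi^{\mathrm{rc}}_{k,n,m}[H,\sigma]=\left[Z(H)\binom{\binom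 nk}{m}\mathbb{P}[H_k(n,m)\text{ is 2-colourable}]\right]^{-1}$, where $H_k(n,m)$ is the uniformly random $k$-uniform hypergraph on $[n]$ with exactly $m$ edges. For $\sigma:[n]\to\{0,1\}$ let $\mathcal{F}(\sigma)=\binom{|\sigma^{-1}(0)|}{k}+\binom{|\sigma^{-1}(1)|}{k}$. The planted model $\pi^{\mathrm{pl}}_{k,n,m}$ is the distribution on $\Lambda_{k,n,m}$ obtained by first choosing $\sigma:[n]\to\{0,1\}$ uniformly at random among all maps with $\mathcal{F}(\sigma)\le\binom nk-m$, and then choosing $H$ uniformly at random among all $k$-uniform hypergraphs on $[n]$ with exactly $m$ edges all of which are bichromatic under $\sigma$. Only $n$ large enough (so that both models are defined) is considered. *)

(* Defs.v *)
From HB Require Import structures.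
From mathcomp Require Import all_boot all_order all_algebra.
From mathcomp Require Import all_classical all_reals all_analysis.
Import Order.TTheory GRing.Theory Num.Theory.
Import numFieldNormedType.Exports.

Set Implicit Arguments.
Unset Strict Implicit.
Unset Printing Implicit Defensive.

Local Open Scope ring_scope.

Definition hypergraph (n : nat) := {set {set 'I_n}}.

(* The colours 0 and 1 are [false] and [true]. *)
Definition colouring (n : nat) := {ffun 'I_n -> bool}.

Definition hypergraphs (k n m : nat) : {set hypergraph n} :=
  [set H : hypergraph n | [forall e in H, #|e| == k] && (#|H| == m)].

Definition monochromatic n (sigma : colouring n) (e : {set 'I_n}) : bool :=
  #|sigma @: e| == 1%N.

Definition two_colouring n (H : hypergraph n) (sigma : colouring n) : bool :=
  [forall e in H, ~~ monochromatic sigma e].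

Definition two_colourings n (H : hypergraph n) : {set colouring n} :=
  [set sigma | two_colouring H sigma].

Definition Z n (H : hypergraph n) : nat := #|two_colourings H|.

Definition Lambda (k n m : nat) : {set hypergraph n * colouring n} :=
  [set p | (p.1 \in hypergraphs k n m) && two_colouring p.1 p.2].

Definition F (k n : nat) (sigma : colouring n) : nat :=
  ('C(#|sigma @^-1: pred1 false|, k) + 'C(#|sigma @^-1: pred1 true|, k))%N.

(* Probability mass function of the uniform distribution on [A]; it vanishes
   identically when [A] is empty, since [0^-1 = 0]. *)
Definition uniform_pmf (R : realType) (T : finType) (A : {set T}) (x : T) : R :=
  (x \in A)%:R / #|A|%:R.

(* [pi_rc] and [pi_pl] are the joint mass functions of the two-stage
   experiments: the mass of the first choice times the conditional mass of the
   second.  When a model is undefined (which, for the edge numbers [m] linear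
   in [n] considered here and [k >= 3], happens for finitely many [n] only) the
   mass function is identically 0. *)
Definition pi_rc (R : realType) (k n m : nat)
    (p : hypergraph n * colouring n) : R :=
  uniform_pmf R [set H in hypergraphs k n m | (0 < Z H)%N] p.1 *
  uniform_pmf R (two_colourings p.1) p.2.

(* [F k sigma + m <= 'C(n, k)] is [F k sigma <= 'C(n, k) - m] without the
   truncated subtraction of [nat]. *)
Definition pi_pl (R : realType) (k n m : nat)
    (p : hypergraph n * colouring n) : R :=
  uniform_pmf R [set sigma : colouring n | (F k sigma + m <= 'C(n, k))%N] p.2 *
  uniform_pmf R [set H in hypergraphs k n m | two_colouring H p.2] p.1.

Arguments pi_rc R k n m p : clear implicits.
Arguments pi_pl R k n m p : clear implicits.

Definition prob (R : realType) (T : finType) (mu : T -> R) (E : {set T}) : R :=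
  \sum_(x in E) mu x.

(* [mu] is contiguous with respect to [nu], where [mu n] and [nu n] are mass
   functions on [Omega n]. *)
Definition contiguous (R : realType) (T : nat -> finType)
    (Omega : forall n, {set T n}) (mu nu : forall n, T n -> R) : Prop :=
  forall E : forall n, {set T n},
    (forall n, E n \subset Omega n) ->
    ((fun n => prob (@nu n) (E n)) @ \oo --> (0 : R))%classic ->
    ((fun n => prob (@mu n) (E n)) @ \oo --> (0 : R))%classic.

(* For [d >= 0] the ceiling is nonnegative, so the absolute value only casts it
   from [int] to [nat]. *)
Definition edge_number (R : realType) (k : nat) (d : R) (n : nat) : nat :=
  `|Num.ceil (d * n%:R / k%:R)|%N.

(* Main.v *)
Require Import Defs.
From HB Require Import structures.
From mathcomp Require Import all_boot all_order all_algebra.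
From mathcomp Require Import all_classical all_reals all_analysis.
From mathcomp Require Import ring lra zify.
Import Order.TTheory GRing.Theory Num.Theory.
Import numFieldNormedType.Exports.

(* Let M be the number of 2-colourings of the random hypergraph with a given
   number of zeros, divided by its expectation.  It suffices that M is bounded
   away from 0 in probability: then the density of the random colouring model
   with respect to the planted model is bounded outside an event of small
   probability.

   Adding the edges one at a time, independently and uniformly, M becomes an
   exact martingale.  If u denotes the overlap of two independent random
   solutions, then the conditional variance of the relative increment of M is
   O(<u^2> + 1/n).  The second moment computation bounds not only E[M^2] but also
   E[M^2 <exp(c n u^2)>], and by Young's inequality
     c n u^2 <= M^2 exp(c n u^2) + 2 ln(1/M),
   so that E[<n u^2> / (1 + ln(1 + 1/M))] = O(1) along the process.  As the second
   order term in the expansion of ln(1 + ln(1 + 1/M)) is of exactly this size,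
   the expectation of this function of M stays bounded.  This replaces small
   subgraph conditioning.  Large relative drops of M, which the expansion does
   not cover, require that three vertices of the new edge be pairwise strongly
   correlated; a bound on the number of triangles in the graph of correlated
   pairs shows that drops have probability o(1/n). *)

(** A bounded second moment of M alone would keep M away from 0 only with some positive probability,
    whereas contiguity needs probability arbitrarily close to 1; this is why M is followed along the
    whole process. Fixing the number of zeros gives all colourings under consideration the same
    chance of surviving a random edge, which is what makes M an exact martingale. About [sqrt n]
    classes matter; they are recombined by averaging, since the bound for one class is too weak for
    a union bound. The process is stopped when M drops sharply or falls below a level [d]; the
    constants are chosen in the order [d], then the degree cut-off [theta] of the triangle count,
    then [n]. The upper bound on [d'] enters only through the rate function of the second moment.
    Edges are drawn as tuples with repetition; passing to distinct edges costs a constant factor for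
    nonnegative functions, which suffices because only upper bounds are transferred. *)

Set Implicit Arguments.
Unset Strict Implicit.
Unset Printing Implicit Defensive.

Local Open Scope ring_scope.

(** * Random words *)

Section Averages.
Variable R : realType.

Definition avg (T : finType) (f : T -> R) : R := (\sum_x f x) / #|T|%:R.

Lemma avg_ext (T : finType) (f g : T -> R) : (forall x, f x = g x) -> avg f = avg g.
Proof. by move=> fg; rewrite /avg; under eq_bigr do rewrite fg. Qed.

Lemma avg_le (T : finType) (f g : T -> R) :
  (forall x, f x <= g x) -> avg f <= avg g.
Proof. by move=> fg; rewrite /avg ler_wpM2r ?invr_ge0 ?ler0n// ler_sum. Qed.

Lemma avg_ge0 (T : finType) (f : T -> R) : (forall x, 0 <= f x) -> 0 <= avg f.
Proof. by move=> f0; rewrite /avg mulr_ge0 ?invr_ge0 ?ler0n// sumr_ge0. Qed.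

Lemma avg_cst (T : finType) (c : R) : (0 < #|T|)%N -> avg (fun _ : T => c) = c.
Proof.
by move=> T0; rewrite /avg sumr_const -[c *+ _]mulr_natr mulfK// pnatr_eq0 -lt0n.
Qed.

Lemma avgD (T : finType) (f g : T -> R) :
  avg (fun x => f x + g x) = avg f + avg g.
Proof. by rewrite /avg big_split mulrDl. Qed.

Lemma avgZ (T : finType) (c : R) (f : T -> R) :
  avg (fun x => c * f x) = c * avg f.
Proof. by rewrite /avg -mulr_sumr mulrA. Qed.

Lemma avg_sum (T I : finType) (P : pred I) (f : I -> T -> R) :
  avg (fun x => \sum_(i | P i) f i x) = \sum_(i | P i) avg (f i).
Proof. by rewrite /avg exchange_big mulr_suml. Qed.

(* Expectation over words of [t] independent uniform letters; the last letter
   drawn is the head of the word. *)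
Fixpoint expect (T : finType) (t : nat) (f : seq T -> R) : R :=
  if t is t'.+1 then expect t' (fun h => avg (fun x => f (x :: h))) else f [::].

Lemma expect_le (T : finType) t (f g : seq T -> R) :
  (forall h, size h = t -> f h <= g h) -> expect t f <= expect t g.
Proof.
elim: t f g => [|t IH] f g fg /=; first exact: fg.
by apply: IH => h ht; apply: avg_le => x; apply: fg => /=; rewrite ht.
Qed.

Lemma expect_ext (T : finType) t (f g : seq T -> R) :
  (forall h, size h = t -> f h = g h) -> expect t f = expect t g.
Proof. by move=> fg; apply/le_anti; rewrite !expect_le// => h /fg ->. Qed.

Lemma expectD (T : finType) t (f g : seq T -> R) :
  expect t (fun h => f h + g h) = expect t f + expect t g.
Proof.
elim: t f g => [//|t IH] f g /=; rewrite -IH.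
by apply: expect_ext => h _; exact: avgD.
Qed.

Lemma expectZ (T : finType) t (c : R) (f : seq T -> R) :
  expect t (fun h => c * f h) = c * expect t f.
Proof.
elim: t f => [//|t IH] f /=; rewrite -IH.
by apply: expect_ext => h _; exact: avgZ.
Qed.

Lemma expect_sum (T I : finType) t (P : pred I) (f : I -> seq T -> R) :
  expect t (fun h => \sum_(i | P i) f i h) = \sum_(i | P i) expect t (f i).
Proof.
elim: t f => [//|t IH] f /=; rewrite -IH.
by apply: expect_ext => h _; exact: avg_sum.
Qed.

Lemma expect_cst (T : finType) t (c : R) :
  (0 < #|T|)%N -> expect t (fun _ : seq T => c) = c.
Proof.
move=> T0; elim: t => [//|t IH] /=; rewrite -[RHS]IH.
by apply: expect_ext => h _; exact: avg_cst.
Qed.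

Lemma expect_all (T : finType) t (P : pred T) :
  expect t (fun h => (all P h)%:R) = avg (fun x => (P x)%:R) ^+ t.
Proof.
elim: t => [//|t IH] /=; rewrite exprS -IH -expectZ.
apply: expect_ext => h _; rewrite mulrC -avgZ; apply: avg_ext => x.
by rewrite -natrM mulnb andbC.
Qed.

End Averages.
Arguments avg_cst {R T} c _.
Arguments expect_cst {R T} t c _.

(** * A lower tail estimate for the number of solutions *)

Section Potential.
Variable R : realType.

(* Decreasing in [x], and so slowly growing at [0] that its expected increase
   along one step of the process is [O (1 / n)]; see [replica_young]. *)
Definition loglog (x : R) : R := ln (1 + ln (1 + x^-1)).

Lemma log_inv_gt0 (x : R) : 0 < x -> 0 < ln (1 + x^-1).
Proof. by move=> x0; rewrite ln_gt0// ltrDl invr_gt0. Qed.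

Lemma loglog_ge0 (x : R) : 0 < x -> 0 <= loglog x.
Proof. by move=> /log_inv_gt0 x0; rewrite ln_ge0// lerDl ltW. Qed.

Lemma loglog_anti (x y : R) : 0 < x -> x <= y -> loglog y <= loglog x.
Proof.
move=> x0 xy; have y0 : 0 < y by exact: lt_le_trans xy.
have := log_inv_gt0 x0; have := log_inv_gt0 y0 => ly lx.
rewrite /loglog ler_ln ?posrE ?addr_gt0// lerD2l.
by rewrite ler_ln ?posrE ?addr_gt0 ?invr_gt0// lerD2l lef_pV2.
Qed.

Lemma ln_le_sub1 (x : R) : 0 < x -> ln x <= x - 1.
Proof. by move=> x0; rewrite -[X in ln X](subrKC 1) le_ln1Dx// ltrBrDr addNr. Qed.

(** The outer logarithm lies below its tangent, which produces the denominator; the inner increment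
    is [ln (1 + x / (1 + x) * r) - ln (1 + r)]. The term linear in [r] will have mean 0. The factor
    4 bounds [(1 + r)^-1], hence the restriction to moderate drops. *)
Lemma loglog_step (x y : R) (r := y / x - 1) : 0 < x -> x / 4 <= y ->
  loglog y <= loglog x + (- (1 + x)^-1 * r + 4 * r ^+ 2) / (1 + ln (1 + x^-1)).
Proof.
move=> x0 xy; have y0 : 0 < y by apply: lt_le_trans xy; lra.
have lx := log_inv_gt0 x0; have ly := log_inv_gt0 y0.
set a := ln (1 + x^-1) in lx *; set b := ln (1 + y^-1) in ly *.
have yE : y = x * (1 + r) by rewrite /r subrKC mulrC divfK// gt_eqF.
have r4 : 4^-1 <= 1 + r by rewrite /r subrKC ler_pdivlMr// mulrC.
have ab : b - a <= - (1 + x)^-1 * r + 4 * r ^+ 2.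
  have -> : b - a = ln (1 + x / (1 + x) * r) + ln ((1 + r)^-1).
    rewrite /a /b -ln_div ?posrE ?addr_gt0 ?invr_gt0// -lnM ?posrE; last first.
    - by rewrite invr_gt0; lra.
    - have -> : 1 + x / (1 + x) * r = (1 + y) / (1 + x) by rewrite yE; field; lra.
      by rewrite divr_gt0// addr_gt0.
    congr ln; rewrite yE; field; rewrite !gt_eqF//; lra.
  have h1 : ln (1 + x / (1 + x) * r) <= x / (1 + x) * r.
    apply: le_ln1Dx; have -> : x / (1 + x) * r = (1 + y) / (1 + x) - 1.
      by rewrite yE; field; lra.
    by rewrite ltrBrDr addNr divr_gt0// addr_gt0.
  have h2 : ln ((1 + r)^-1) <= (1 + r)^-1 - 1.
    by apply: ln_le_sub1; rewrite invr_gt0; lra.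
  have h3 : (1 + r)^-1 - 1 = - r + r ^+ 2 * (1 + r)^-1 by field; lra.
  have h4 : (1 + r)^-1 <= 4 by rewrite -[4]invrK lef_pV2 ?posrE//; lra.
  have h5 : r ^+ 2 * (1 + r)^-1 <= 4 * r ^+ 2.
    by rewrite mulrC ler_wpM2r// sqr_ge0.
  have h6 : x / (1 + x) * r = r - (1 + x)^-1 * r by field; lra.
  lra.
rewrite /loglog -/a -/b -lerBlDl -ln_div ?posrE; [|lra|lra].
have a1 : 0 < 1 + a by lra.
apply: (le_trans (ln_le_sub1 _)); first by rewrite divr_gt0//; lra.
rewrite ler_pdivlMr// mulrBl mul1r divfK ?gt_eqF//; lra.
Qed.

Variables (E S : finType) (B : {set S}) (bi : S -> E -> bool) (q : R).
Hypotheses (E0 : (0 < #|E|)%N) (q_gt0 : 0 < q) (B0 : (0 < #|B|)%N).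
Hypothesis Hq : forall s, s \in B -> avg (fun e => (bi s e)%:R) = q.

Definition nsol (h : seq E) : R := \sum_(s in B) (all (bi s) h)%:R.

Definition ratio (h : seq E) : R := nsol h / (#|B|%:R * q ^+ size h).

Definition pair2 (s t : S) : R := avg (fun e => (bi s e && bi t e)%:R).

Definition pair_sum (h : seq E) (w : S -> S -> R) : R :=
  \sum_(s in B) \sum_(t in B) (all (bi s) h && all (bi t) h)%:R * w s t.

(* The average of [w] over two independent uniform solutions of [h]. *)
Definition replica (h : seq E) (w : S -> S -> R) : R :=
  pair_sum h w / nsol h ^+ 2.

Let den_gt0 (h : seq E) : 0 < #|B|%:R * q ^+ size h.
Proof. by rewrite mulr_gt0 ?exprn_gt0// ltr0n. Qed.

Lemma nsol_ge0 h : 0 <= nsol h.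
Proof. by apply: sumr_ge0 => s _; rewrite ler0n. Qed.

Lemma ratio_nil : ratio [::] = 1.
Proof.
by rewrite /ratio /nsol /= sumr_const expr0 mulr1 divff// pnatr_eq0 -lt0n.
Qed.

Lemma ratio_gt0 h : (0 < ratio h) = (0 < nsol h).
Proof. by rewrite /ratio pmulr_lgt0// invr_gt0. Qed.

Lemma avg_nsol h : avg (fun e => nsol (e :: h)) = q * nsol h.
Proof.
rewrite /nsol avg_sum mulr_sumr; apply: eq_bigr => s sB /=.
rewrite -(Hq sB) mulrC -avgZ; apply: avg_ext => e.
by rewrite -natrM mulnb andbC.
Qed.

Lemma avg_ratio h : avg (fun e => ratio (e :: h)) = ratio h.
Proof.
rewrite /ratio /=.
under avg_ext => e do rewrite mulrC.
rewrite avgZ avg_nsol exprS.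
have := den_gt0 h => d0; field.
by rewrite !gt_eqF ?exprn_gt0 ?ltr0n.
Qed.

Lemma nsol_sqr h : nsol h ^+ 2 = pair_sum h (fun _ _ => 1).
Proof.
rewrite expr2 /nsol big_distrlr /=; apply: eq_bigr => s _; apply: eq_bigr => t _.
by rewrite mulr1 -natrM mulnb.
Qed.

Lemma avg_nsol_sqr h :
  avg (fun e => nsol (e :: h) ^+ 2) = pair_sum h pair2.
Proof.
under avg_ext => e do rewrite nsol_sqr.
rewrite /pair_sum avg_sum; apply: eq_bigr => s _.
rewrite avg_sum; apply: eq_bigr => t _ /=.
rewrite /pair2 -avgZ; apply: avg_ext => e.
by rewrite mulr1 -natrM mulnb; congr (nat_of_bool _)%:R; rewrite andbACA andbC.
Qed.

Lemma pair_sumD h w1 w2 :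
  pair_sum h (fun s t => w1 s t + w2 s t) = pair_sum h w1 + pair_sum h w2.
Proof.
rewrite /pair_sum -big_split; apply: eq_bigr => s _; rewrite -big_split.
by apply: eq_bigr => t _; rewrite mulrDr.
Qed.

Lemma pair_sumZ h c w :
  pair_sum h (fun s t => c * w s t) = c * pair_sum h w.
Proof.
rewrite /pair_sum mulr_sumr; apply: eq_bigr => s _; rewrite mulr_sumr.
by apply: eq_bigr => t _; rewrite mulrCA.
Qed.

Lemma pair_sum_le h w1 w2 :
  (forall s t, s \in B -> t \in B -> w1 s t <= w2 s t) ->
  pair_sum h w1 <= pair_sum h w2.
Proof.
move=> w12; apply: ler_sum => s sB; apply: ler_sum => t tB.
by rewrite ler_wpM2l ?ler0n// w12.
Qed.

Lemma replicaD h w1 w2 :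
  replica h (fun s t => w1 s t + w2 s t) = replica h w1 + replica h w2.
Proof. by rewrite /replica pair_sumD mulrDl. Qed.

Lemma replicaZ h c w : replica h (fun s t => c * w s t) = c * replica h w.
Proof. by rewrite /replica pair_sumZ mulrA. Qed.

Lemma replica_le h w1 w2 :
  (forall s t, s \in B -> t \in B -> w1 s t <= w2 s t) ->
  replica h w1 <= replica h w2.
Proof. by move=> w12; rewrite ler_wpM2r ?invr_ge0 ?sqr_ge0 ?pair_sum_le. Qed.

Lemma replica1 h : 0 < nsol h -> replica h (fun _ _ => 1) = 1.
Proof. by move=> X0; rewrite /replica -nsol_sqr divff// expf_neq0 ?gt_eqF. Qed.

Lemma replica_cst h c : 0 < nsol h -> replica h (fun _ _ => c) = c.
Proof.
move=> X0; rewrite -[RHS]mulr1 -(replica1 X0) -replicaZ.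
by congr replica; apply/funext => s; apply/funext => t; rewrite mulr1.
Qed.

Lemma replica_sqr h w : 0 < nsol h ->
  replica h w ^+ 2 <= replica h (fun s t => w s t ^+ 2).
Proof.
move=> X0; set m := replica h w.
have : 0 <= replica h (fun s t => (w s t ^+ 2 + (- 2 * m) * w s t) + m ^+ 2).
  rewrite -(replica_cst 0 X0); apply: replica_le => s t _ _.
  have -> : w s t ^+ 2 + (- 2 * m) * w s t + m ^+ 2 = (w s t - m) ^+ 2 by ring.
  exact: sqr_ge0.
rewrite !replicaD replicaZ replica_cst// -/m; nra.
Qed.

Lemma avg_step_sqr h : 0 < nsol h ->
  avg (fun e => (ratio (e :: h) / ratio h - 1) ^+ 2) =
  replica h (fun s t => pair2 s t / q ^+ 2 - 1).
Proof.
move=> X0.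
have r0 : 0 < ratio h by rewrite ratio_gt0.
have X1 : nsol h != 0 by rewrite gt_eqF.
have q1 : q != 0 by rewrite gt_eqF.
transitivity (avg (fun e => ((q ^+ 2 * nsol h ^+ 2)^-1 * nsol (e :: h) ^+ 2 +
    (- 2 / ratio h) * ratio (e :: h)) + 1)).
  apply: avg_ext => e; rewrite /ratio /= (exprS q (size h)).
  have qt : q ^+ size h != 0 by rewrite expf_neq0.
  have b1 : #|B|%:R != 0 :> R by rewrite pnatr_eq0 -lt0n.
  by move: (nsol h) (nsol (e :: h)) (#|B|%:R) (q ^+ size h) X1 b1 qt => *; field; apply/and4P; split.
rewrite !avgD !avgZ avg_nsol_sqr avg_ratio avg_cst//.
rewrite (_ : replica h _ = replica h (fun s t => q ^- 2 * pair2 s t + -1)).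
  rewrite replicaD replicaZ replica_cst// /replica.
  by field; rewrite X1 q1 gt_eqF.
by congr replica; apply/funext => s; apply/funext => t; rewrite mulrC.
Qed.

(* Unlike [replica], the sum is normalised by the expected number of pairs; its
   expectation is a second moment, computed by [expect_weight]. *)
Definition weight (h : seq E) (w : S -> S -> R) : R :=
  pair_sum h w / (#|B|%:R * q ^+ size h) ^+ 2.

Lemma weightE h w : 0 < nsol h -> weight h w = ratio h ^+ 2 * replica h w.
Proof.
move=> X0; rewrite /weight /ratio /replica; field.
by rewrite !gt_eqF ?exprn_gt0 ?ltr0n.
Qed.

Lemma weight_ge0 h w : (forall s t, 0 <= w s t) -> 0 <= weight h w.
Proof.
move=> w0; rewrite mulr_ge0 ?invr_ge0 ?sqr_ge0//.
by apply: sumr_ge0 => s _; apply: sumr_ge0 => t _; rewrite mulr_ge0 ?ler0n.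
Qed.

Lemma expect_weight t w :
  expect t (fun h => weight h w) =
  #|B|%:R ^- 2 * \sum_(s in B) \sum_(u in B) w s u * (pair2 s u / q ^+ 2) ^+ t.
Proof.
transitivity ((#|B|%:R * q ^+ t) ^- 2 * expect t (fun h => pair_sum h w)).
  rewrite -expectZ; apply: expect_ext => h ht.
  by rewrite /weight ht mulrC.
rewrite /pair_sum expect_sum exprMn invfM -mulrA; congr (_ * _).
rewrite mulr_sumr; apply: eq_bigr => s _; rewrite expect_sum mulr_sumr.
apply: eq_bigr => u _.
rewrite (@expect_ext _ _ _ _ (fun h => w s u * (all (predI (bi s) (bi u)) h)%:R)).
  rewrite expectZ expect_all (_ : avg _ = pair2 s u); last by [].
  rewrite -exprM mulnC exprM mulrCA; congr (_ * _).
  by rewrite [in RHS]expr_div_n mulrC.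
by move=> h _; rewrite all_predI mulrC.
Qed.

(** * The stopped potential along the process *)

Section Descent.
Variables (w : S -> S -> R) (c C1 C2 N d theta : R) (m : nat).
Hypotheses (c_gt0 : 0 < c) (C1_ge0 : 0 <= C1) (N_gt0 : 0 < N).
Hypotheses (d_gt0 : 0 < d) (d_le1 : d <= 1) (theta_gt0 : 0 < theta).
Hypothesis w_ge0 : forall s t, 0 <= w s t.
Hypothesis pair2_le : forall s t, s \in B -> t \in B ->
  pair2 s t / q ^+ 2 - 1 <= C1 / N * (w s t + 1).
Hypothesis moment_le : forall t, (t <= m)%N ->
  #|B|%:R ^- 2 * \sum_(s in B) \sum_(u in B)
    expR (c * w s u) * (pair2 s u / q ^+ 2) ^+ t <= C2.
Hypothesis drop_le : forall h, 0 < nsol h ->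
  let b := 4 / N * replica h w in
  avg (fun e => (ratio (e :: h) < ratio h / 4)%R%:R) <= theta * b + theta^-1 * b ^+ 2.

Let loga (h : seq E) : R := ln (1 + (ratio h)^-1).

(** The stopping rule keeps [loglog_step] applicable at every step that counts, and keeps [ratio]
    above [d], so that a nonnegative [replica] is at most [weight / d ^+ 2]. *)
Fixpoint alive (h : seq E) : bool :=
  if h is e :: h' then
    [&& alive h', ratio h' / 4 <= ratio h & d <= ratio h] else true.

Lemma alive_ratio h : alive h -> d <= ratio h.
Proof. by case: h => [|e h] /=; [rewrite ratio_nil|case/and3P]. Qed.

Let F h : R := if alive h then loglog (ratio h) else loglog d.

Let ew (s t : S) : R := expR (c * w s t).

Let ew_ge0 s t : 0 <= ew s t. Proof. exact: expR_ge0. Qed.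

(** [A1] and [A2] collect the second order term after Young's inequality. [A3] is the cost
    [loglog d] times the drop probability, which is estimated with [z <= expR z] and
    [z ^+ 2 <= 2 * expR z]. *)
Let A1 : R := C1 / N * (2 / c + 1).
Let A2 : R := C1 / N / c.
Let A3 : R := loglog d * (theta * (4 / N / c / d ^+ 2) +
                theta^-1 * (32 / N ^+ 2 / c ^+ 2 / d ^+ 2)).

(* Young's inequality [z <= ratio^2 * e^z + 2 * ln (1 / ratio)]. When the ratio is
   small the overlaps may be large, but only logarithmically so, and this loss
   is compensated by the derivative of [loglog]. *)
Lemma replica_young h : 0 < nsol h ->
  c * replica h w <= weight h ew + 2 * loga h.
Proof.
move=> X0; have r0 : 0 < ratio h by rewrite ratio_gt0.
rewrite weightE// -replicaZ -(replica_cst (2 * loga h) X0) -replicaZ -replicaD.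
apply: replica_le => s t _ _.
have -> : c * w s t = ln (ratio h ^+ 2 * ew s t) + 2 * ln ((ratio h)^-1).
  rewrite lnM ?posrE ?exprn_gt0 ?expR_gt0// lnXn// lnV ?posrE// /ew expRK.
  by rewrite -mulr_natl; ring.
rewrite lerD//; first by apply/ltW/ln_sublinear; rewrite mulr_gt0 ?exprn_gt0 ?expR_gt0.
by rewrite ler_pM2l// ler_ln ?posrE ?addr_gt0 ?invr_gt0// lerDr.
Qed.

Lemma weight_alive h w' : alive h -> d ^+ 2 * replica h w' <= weight h w' \/ replica h w' < 0.
Proof.
move=> ah; have dr := alive_ratio ah.
have X0 : 0 < nsol h by rewrite -ratio_gt0; exact: lt_le_trans dr.
case: (ltP (replica h w') 0) => [|r0]; [by right|left].
by rewrite weightE// ler_wpM2r// lerXn2r// nnegrE ltW// (lt_le_trans d_gt0).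
Qed.

Lemma potential_step h : avg (fun e => F (e :: h)) <= F h + 4 * A1 + (4 * A2 + A3) * weight h ew.
Proof.
have W0 := weight_ge0 h ew_ge0.
have ld := loglog_ge0 d_gt0.
have pos1 : 0 <= A1 by rewrite mulr_ge0 ?divr_ge0 ?addr_ge0 ?divr_ge0// ltW.
have pos2 : 0 <= A2 by rewrite !divr_ge0// ltW.
have pos3 : 0 <= A3.
  by rewrite mulr_ge0// addr_ge0// mulr_ge0 ?invr_ge0 ?divr_ge0 ?invr_ge0 ?exprn_ge0// ltW.
rewrite {2}/F; case: ifPn => ah; last first.
  rewrite (@avg_ext _ _ _ (fun=> loglog d)) ?avg_cst//.
    by rewrite -addrA lerDl; nra.
  by move=> e; rewrite /F /= (negbTE ah).
have dr := alive_ratio ah.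
have r0 : 0 < ratio h by exact: lt_le_trans dr.
have X0 : 0 < nsol h by rewrite -ratio_gt0.
have a0 : 0 < loga h by exact: log_inv_gt0.
pose x e := ratio (e :: h) / ratio h - 1.
have pt e : F (e :: h) <= loglog d * (ratio (e :: h) < ratio h / 4)%R%:R +
   (loglog (ratio h) + (- (1 + ratio h)^-1 / (1 + loga h) * x e +
      4 / (1 + loga h) * x e ^+ 2)).
  have fold : (- (1 + ratio h)^-1 * x e + 4 * x e ^+ 2) / (1 + loga h) =
     - (1 + ratio h)^-1 / (1 + loga h) * x e + 4 / (1 + loga h) * x e ^+ 2.
    by field; rewrite !gt_eqF//; lra.
  rewrite -fold /F /= ah /=; case: (ltP (ratio (e :: h)) (ratio h / 4)) => rr /=.
    (* After a drop [x e] is negative, so all remaining terms are nonnegative and [loglog d] alone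
       pays for the step. *)
    rewrite mulr1 lerDl addr_ge0 ?loglog_ge0// divr_ge0 ?addr_ge0 ?(ltW a0)//.
      rewrite mulNr oppr_ge0 mulr_ge0_le0 ?invr_ge0 ?addr_ge0 ?ltW//.
      by rewrite /x subr_lt0 ltr_pdivrMr//; lra.
    by rewrite mulr_ge0 ?sqr_ge0.
  rewrite mulr0 add0r; apply: le_trans (loglog_step r0 rr).
  by case: ifPn => //; rewrite -ltNge => /ltW rd; rewrite loglog_anti// (lt_le_trans _ rr)// divr_gt0.
apply: (le_trans (avg_le pt)).
rewrite !avgD !avgZ avg_cst//.
have avgx : avg x = 0.
  rewrite /x avgD avg_cst//.
  under avg_ext do rewrite mulrC.
  by rewrite avgZ avg_ratio mulVf ?subrr// gt_eqF.
have avgx2 : avg (fun e => x e ^+ 2) <= C1 / N * (replica h w + 1).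
  rewrite avg_step_sqr//; apply: (le_trans (replica_le h pair2_le)).
  by rewrite replicaZ replicaD replica1.
rewrite avgx mulr0 add0r.
have -> : loglog (ratio h) + 4 * A1 + (4 * A2 + A3) * weight h ew =
  A3 * weight h ew + (loglog (ratio h) + (4 * A1 + 4 * A2 * weight h ew)) by ring.
apply: lerD.
  rewrite /A3 -mulrA ler_wpM2l//; apply: (le_trans (drop_le X0)).
  have rw1 : replica h w <= weight h ew / c / d ^+ 2.
    do 2 (rewrite ler_pdivlMr ?exprn_gt0//).
    have le1 : replica h w * c <= replica h ew.
      rewrite mulrC -replicaZ; apply: replica_le => s t _ _.
      by apply: le_trans (expR_ge1Dx _); rewrite lerDr.
    have le2 := ler_wpM2r (sqr_ge0 d) le1; rewrite mulrAC in le2.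
    apply: (le_trans le2); rewrite mulrC; case: (weight_alive ew ah) => // /ltW r1; have := sqr_ge0 d; nra.
  have rw2 : replica h w ^+ 2 <= 2 * weight h ew / c ^+ 2 / d ^+ 2.
    apply: (le_trans (replica_sqr _ X0)).
    do 2 (rewrite ler_pdivlMr ?exprn_gt0//).
    have le1 : replica h (fun s t => w s t ^+ 2) * c ^+ 2 <= 2 * replica h ew.
      rewrite mulrC -!replicaZ; apply: replica_le => s t _ _.
      have cw0 : 0 <= c * w s t by rewrite mulr_ge0// ltW.
      have := expR_ge1Dxn 1 cw0; rewrite (_ : 2`! = 2)%N// -exprMn /ew; lra.
    have le2 := ler_wpM2r (sqr_ge0 d) le1; rewrite mulrAC in le2.
    by apply: (le_trans le2); have := sqr_ge0 d; case: (weight_alive ew ah) => [|/ltW] r1; nra.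
  have -> : (theta * (4 / N / c / d ^+ 2) +
      theta^-1 * (32 / N ^+ 2 / c ^+ 2 / d ^+ 2)) * weight h ew =
      theta * (4 / N * (weight h ew / c / d ^+ 2)) +
      theta^-1 * ((4 / N) ^+ 2 * (2 * weight h ew / c ^+ 2 / d ^+ 2)).
    by field; rewrite !gt_eqF.
  rewrite [(4 / N * _) ^+ 2]exprMn lerD// ler_pM2l ?invr_gt0// ler_wpM2l//.
    by rewrite divr_ge0// ltW.
  exact: sqr_ge0.
rewrite lerD2l.
apply: (@le_trans _ _ (4 / (1 + loga h) * (C1 / N * (replica h w + 1)))).
  by rewrite ler_wpM2l// divr_ge0 ?addr_ge0 ?ltW.
have -> : 4 * A1 + 4 * A2 * weight h ew =
   4 * (C1 / N * (c^-1 * (weight h ew + 2) + 1)) by rewrite /A1 /A2; field; rewrite !gt_eqF.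
have cN : 0 <= C1 / N by rewrite divr_ge0// ltW.
have a1 : 0 < 1 + loga h by rewrite addr_gt0.
have -> : 4 / (1 + loga h) * (C1 / N * (replica h w + 1)) =
   4 * (C1 / N * ((replica h w + 1) / (1 + loga h))) by field; rewrite !gt_eqF.
rewrite ler_pM2l// ler_wpM2l// ler_pdivrMr//.
(* The logarithm on the right of Young's inequality is absorbed by the factor [1 + loga h], which
   stems from the slope of [loglog]. *)
have yy : replica h w <= c^-1 * (weight h ew + 2 * loga h).
  by rewrite ler_pdivlMl//; exact: replica_young.
have c0 : 0 < c^-1 by rewrite invr_gt0.
have := mulr_ge0 (ltW c0) W0; have := mulr_gt0 c0 a0 => h1 h2.
have := mulr_ge0 h2 (ltW a0); nra.
Qed.

(** Markov's inequality: a word ending with [ratio h < d] has been stopped, so its potential is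
    [loglog d]. *)
Lemma ratio_tail :
  loglog d * expect m (fun h => (ratio h < d)%R%:R) <=
  loglog 1 + m%:R * (4 * A1 + (4 * A2 + A3) * C2).
Proof.
have ld := loglog_ge0 d_gt0.
have FM : forall t, (t <= m)%N ->
    expect t F <= loglog 1 + t%:R * (4 * A1 + (4 * A2 + A3) * C2).
  elim=> [_|t IH tm] /=; first by rewrite /F /= ratio_nil mul0r addr0.
  apply: (le_trans (expect_le (fun h _ => potential_step h))).
  rewrite !expectD !expectZ expect_cst//.
  have := IH (ltnW tm); have := moment_le (ltnW tm); rewrite -expect_weight -/ew => h1 h2.
  have pos : 0 <= 4 * A2 + A3.
    rewrite addr_ge0 ?mulr_ge0 ?divr_ge0 ?addr_ge0 ?mulr_ge0 ?invr_ge0 ?divr_ge0 ?invr_ge0 ?exprn_ge0//;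
    exact: ltW.
  have := ler_wpM2l pos h1; rewrite -(natr1 t).
  move: h2; move: (4 * A2 + A3) (4 * A1) (expect t F) (expect t _) => u v z1 z2; lra.
apply: le_trans (FM m (leqnn m)); rewrite -expectZ; apply: expect_le => h _.
rewrite /F; case: ifPn => [/alive_ratio dr|_]; last first.
  by case: ltP => _; rewrite ?mulr1 ?mulr0.
by rewrite ltNge dr /= mulr0 loglog_ge0// (lt_le_trans d_gt0).
Qed.

End Descent.
End Potential.

(** * The second moment rate function *)

Section Numerics.
Variable R : realType.

Lemma expR_ge_partial (x : R) n : 0 <= x ->
  \sum_(i < n) x ^+ i / i`!%:R <= expR x.
Proof.
move=> x0; rewrite -(big_mkord xpredT (fun i => x ^+ i / i`!%:R)).
apply: nondecreasing_cvgn_le; last exact: is_cvg_series_exp_coeff.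
by apply: nondecreasing_series => i _ _; rewrite divr_ge0 ?exprn_ge0 ?ler0n.
Qed.

Lemma ln2_upper : ln 2 <= (1387 / 2000) :> R.
Proof.
rewrite -ler_expR lnK ?posrE//.
apply: (le_trans _ (@expR_ge_partial (1387 / 2000) 8 _)); last by lra.
rewrite !big_ord_recr big_ord0 /= !factE /=. lra.
Qed.

Lemma ln2_lower : (69 / 100) <= ln 2 :> R.
Proof.
rewrite -ler_expR lnK ?posrE// -[leRHS]invrK -[leLHS]invrK -expRN lef_pV2 ?posrE ?expR_gt0//.
(* The bound [1 + y <= expR y] is sharp enough only near 0, hence the 128th root. *)
have -> : - (69 / 100) = 128%:R * (- (69 / 100) / 128) :> R by lra.
rewrite expRM_natl.
have h : 1 - (69 / 100) / 128 <= expR (- (69 / 100) / 128) :> R by have := expR_ge1Dx (- (69 / 100) / 128 : R); lra.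
apply: (le_trans _ (lerXn2r 128 _ _ h)); rewrite ?nnegrE ?expR_ge0//; [|lra].
lra.
Qed.

End Numerics.

(** * Monotonicity and convexity of the rate function *)

Section Rate.
Variable R : realType.

Definition even_part (k : nat) (u : R) : R := ((1 + u) ^+ k + (1 - u) ^+ k) / 2.

(* With overlap [u], the probability that a random edge is bichromatic under
   both of two balanced colourings exceeds the product of the probabilities by
   a relative amount [excess k u]. *)
Definition excess (k : nat) (u : R) : R :=
  (even_part k u - 1) / (2 ^+ k.-1 - 1) ^+ 2.

Definition pow_sum (k : nat) (x : R) : R := (1 - x) ^+ k + x ^+ k.

Lemma convex_exprn (k : nat) (a b s t : R) :
  0 <= a -> a <= b -> 0 <= s -> 0 <= t -> s + t = 1 ->
  (s * a + t * b) ^+ k <= s * a ^+ k + t * b ^+ k.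
Proof.
move=> a0 ab s0 t0 st; have b0 : 0 <= b by exact: le_trans ab.
elim: k => [|k IH]; first by rewrite !expr0 !mulr1 st.
have abk : a ^+ k <= b ^+ k by rewrite lerXn2r.
rewrite !exprS; have c0 : 0 <= s * a + t * b by rewrite addr_ge0 ?mulr_ge0.
apply: (le_trans (ler_wpM2l c0 IH)).
have -> : t = 1 - s by lra.
have : 0 <= s * (1 - s) * ((b - a) * (b ^+ k - a ^+ k)).
  by rewrite !mulr_ge0 ?subr_ge0//; lra.
lra.
Qed.

Lemma convex_pow_sum (k : nat) (a b s t : R) :
  0 <= a -> a <= b -> b <= 1 -> 0 <= s -> 0 <= t -> s + t = 1 ->
  pow_sum k (s * a + t * b) <= s * pow_sum k a + t * pow_sum k b.
Proof.
move=> a0 ab b1 s0 t0 st; rewrite /pow_sum.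
have -> : 1 - (s * a + t * b) = t * (1 - b) + s * (1 - a) by have -> : t = 1 - s; lra.
have h1 := @convex_exprn k (1 - b) (1 - a) t s.
have h2 := @convex_exprn k a b s t.
have := h1 _ _ t0 s0; have := h2 a0 ab s0 t0 st.
move=> k2 /(_ _ _ _) k1.
have : (t * (1 - b) + s * (1 - a)) ^+ k <= t * (1 - b) ^+ k + s * (1 - a) ^+ k.
  by apply: k1; lra.
lra.
Qed.

(** The even part has only even powers, with nonnegative coefficients, so its excess over 1
    increases even after division by the square of the variable. The induction on [k] carries the
    odd part along because each part at [k + 1] involves both parts at [k]. *)
Lemma even_part_mono (k : nat) (u v : R) : 0 <= u -> u <= v ->
  let odd_part w := ((1 + w) ^+ k - (1 - w) ^+ k) / 2 in
  [/\ 0 <= even_part k u - 1, (even_part k u - 1) * v ^+ 2 <= (even_part k v - 1) * u ^+ 2,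
      even_part k u <= even_part k v, 0 <= odd_part u <= odd_part v & odd_part u * v <= odd_part v * u].
Proof.
move=> u0 uv; have v0 := le_trans u0 uv; rewrite /even_part /=.
elim: k => [|k [IH1 IH2 IH3 IH4 IH5]].
  by rewrite !expr0; split; rewrite ?subrr ?mul0r ?lexx//; lra.
pose E w : R := ((1 + w) ^+ k + (1 - w) ^+ k) / 2.
pose O w : R := ((1 + w) ^+ k - (1 - w) ^+ k) / 2.
have E1 w : ((1 + w) ^+ k.+1 + (1 - w) ^+ k.+1) / 2 = E w + w * O w.
  by rewrite /E /O !exprS; field.
have O1 w : ((1 + w) ^+ k.+1 - (1 - w) ^+ k.+1) / 2 = O w + w * E w.
  by rewrite /E /O !exprS; field.
rewrite !E1 !O1; move: IH1 IH2 IH3 IH4 IH5; rewrite -/(E u) -/(E v) -/(O u) -/(O v).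
move=> IH1 IH2 IH3 IH4 IH5.
case/andP: IH4 => Ou Ov.
have h : u * O u <= v * O v by rewrite ler_pM.
have Eu : 0 <= E u by lra.
have h' : u * E u <= v * E v by rewrite ler_pM.
have uO := mulr_ge0 u0 Ou; have uE := mulr_ge0 u0 Eu.
have uvO := ler_wpM2l (mulr_ge0 u0 v0) IH5.
have uvE := ler_wpM2l (mulr_ge0 u0 v0) IH3.
by split; [lra|lra|lra|apply/andP; split; lra|lra].
Qed.

Lemma even_part_pow_sum k (x : R) : (0 < k)%N ->
  even_part k (1 - 2 * x) = 2 ^+ k.-1 * pow_sum k x.
Proof.
case: k => // k _; rewrite /even_part /pow_sum /=.
have -> : 1 + (1 - 2 * x) = 2 * (1 - x) by ring.
have -> : 1 - (1 - 2 * x) = 2 * x by ring.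
by rewrite !exprMn exprS; field.
Qed.

Lemma excess_pow_sum k (x : R) : (0 < k)%N ->
  excess k (1 - 2 * x) = (2 ^+ k.-1 * pow_sum k x - 1) / (2 ^+ k.-1 - 1) ^+ 2.
Proof. by move=> k0; rewrite /excess even_part_pow_sum. Qed.

Lemma excess_ge0 k (u : R) : 0 <= u -> 0 <= excess k u.
Proof.
move=> u0; have [h _ _ _ _] := even_part_mono k u0 (lexx u).
by rewrite divr_ge0 ?sqr_ge0.
Qed.

Lemma excess_mono k (u v : R) : 0 <= u -> u <= v -> excess k u * v ^+ 2 <= excess k v * u ^+ 2.
Proof.
move=> u0 uv; have [_ h _ _ _] := even_part_mono k u0 uv.
by rewrite /excess mulrAC [leRHS]mulrAC ler_wpM2r// invr_ge0 sqr_ge0.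
Qed.

(* Chernoff's bound for the overlap [u = 1 - 2 * x] with tilt [j * ln 2 / 2]: on
   the exponential scale, the overlap [u] contributes negligibly to the second
   moment as soon as this quantity is below [ln 2] for some [j]. *)
Definition outer_rate (k : nat) (r : R) (j : nat) (x : R) : R :=
  r * excess k (1 - 2 * x) + j%:R * ln 2 * x + 2 ^- j.

(** In terms of [x = (1 - u) / 2] the excess is an increasing affine function of the convex
    [pow_sum], and the tilt is affine; so end points decide. *)
Lemma outer_rate_convex k r j (a b x l : R) : (0 < k)%N -> 0 <= r ->
  0 <= a -> a <= x -> x <= b -> b <= 1 ->
  outer_rate k r j a <= l -> outer_rate k r j b <= l -> outer_rate k r j x <= l.
Proof.
move=> k0 r0 a0 ax xb b1 la lb.
case: (eqVneq a b) => [ab|ab]; first by have -> : x = a by lra.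
have ba : 0 < b - a by rewrite subr_gt0 lt_neqAle ab (le_trans ax).
pose s := (b - x) / (b - a); pose t := (x - a) / (b - a).
have s0 : 0 <= s by apply: divr_ge0; lra.
have t0 : 0 <= t by apply: divr_ge0; lra.
have st : s + t = 1 by rewrite /s /t; field; lra.
have xE : x = s * a + t * b by rewrite /s /t; field; lra.
have ps := convex_pow_sum k a0 (le_trans ax xb) b1 s0 t0 st; rewrite -xE in ps.
have K0 : 0 <= 2 ^+ k.-1 :> R by rewrite exprn_ge0.
have I0 : 0 <= ((2 ^+ k.-1 - 1) ^+ 2)^-1 :> R by rewrite invr_ge0 sqr_ge0.
have ex : excess k (1 - 2 * x) <= s * excess k (1 - 2 * a) + t * excess k (1 - 2 * b).
  rewrite !excess_pow_sum//.
  have : (2 ^+ k.-1 * pow_sum k x - 1) / (2 ^+ k.-1 - 1) ^+ 2 <=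
      (2 ^+ k.-1 * (s * pow_sum k a + t * pow_sum k b) - (s + t)) / (2 ^+ k.-1 - 1) ^+ 2.
    by rewrite st ler_wpM2r// lerD2r ler_wpM2l.
  by move: (_^-1) I0 => I I0; lra.
have rex := ler_wpM2l r0 ex.
have sla := ler_wpM2l s0 la; have tlb := ler_wpM2l t0 lb.
have sl : s * l + t * l = l by rewrite -mulrDl st mul1r.
have sj : s * 2 ^- j + t * 2 ^- j = 2 ^- j by rewrite -mulrDl st mul1r.
rewrite /outer_rate in sla tlb *.
have -> : j%:R * ln 2 * x = s * (j%:R * ln 2 * a) + t * (j%:R * ln 2 * b) by rewrite xE; ring.
lra.
Qed.

(* Small overlaps are controlled by Gaussian tails, large ones by one of two
   tilts. *)
Definition rate_bound (k : nat) (r : R) : Prop :=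
  exists u0 kappa c : R, exists j1 j2 : nat,
  [/\ 0 < u0 < 1, 0 <= kappa < 2^-1, 0 < c,
   (forall u, 0 <= u -> u <= u0 -> r * excess k u <= kappa * u ^+ 2) &
   (forall x, 0 <= x -> x <= (1 - u0) / 2 ->
      exists2 j, (j == j1) || (j == j2) & outer_rate k r j x <= ln 2 - c)].

(** By convexity, tilt [j1] is checked at the ends of [[0, a]] and tilt [j2] at those of [[a, b]].
    Overlaps up to [1 - 2 * b] are compared with a Gaussian at the largest one only, because
    [excess k u / u ^+ 2] increases. *)
Lemma rate_criterion k r (a b : R) j1 j2 : (0 < k)%N -> 0 <= r ->
  0 <= a -> a <= b -> 0 < b -> b < 2^-1 ->
  r * excess k (1 - 2 * b) < (1 - 2 * b) ^+ 2 / 2 ->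
  outer_rate k r j1 0 < ln 2 -> outer_rate k r j1 a < ln 2 ->
  outer_rate k r j2 a < ln 2 -> outer_rate k r j2 b < ln 2 ->
  rate_bound k r.
Proof.
move=> k0 r0 a0 ab b0 b1 hc h1 h2 h3 h4.
set u0 : R := 1 - 2 * b; have u00 : 0 < u0 by rewrite /u0; lra.
pose c := Num.min (Num.min (ln 2 - outer_rate k r j1 0) (ln 2 - outer_rate k r j1 a))
  (Num.min (ln 2 - outer_rate k r j2 a) (ln 2 - outer_rate k r j2 b)).
have : c <= c by []; rewrite {2}/c !le_min => /andP[/andP[c1 c2] /andP[c3 c4]].
exists u0, (r * excess k u0 / u0 ^+ 2), c, j1, j2; split.
- by apply/andP; split=> //; rewrite /u0; lra.
- apply/andP; split.
    by apply: divr_ge0; [apply: mulr_ge0 => //; exact/excess_ge0/ltW|exact: sqr_ge0].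
  by rewrite ltr_pdivrMr ?exprn_gt0// [ltRHS]mulrC.
- by rewrite /c !lt_min !subr_gt0 h1 h2 h3 h4.
- move=> u u_0 uu; rewrite mulrAC ler_pdivlMr ?exprn_gt0//.
  by rewrite -[leLHS]mulrA -[leRHS]mulrA ler_wpM2l// excess_mono.
- move=> x x0; rewrite /u0 => xb.
  have xb' : x <= b by lra.
  case: (leP x a) => xa.
    exists j1; first by rewrite eqxx.
    by apply: (@outer_rate_convex k r j1 0 a) => //; lra.
  exists j2; first by rewrite eqxx orbT.
  by apply: (@outer_rate_convex k r j2 a b) => //; lra.
Qed.

(* [q0], [qa] and [qb] are rational upper bounds for [excess] at the overlaps
   [1], [1 - 2 * a] and [1 - 2 * b]. *)
Lemma rate_numeric k r (a b q0 qa qb : R) j1 j2 (T := 2 ^+ k.-1 * ln 2 - 2) :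
  (1 < k)%N -> 0 <= r -> r <= T -> 0 <= a -> a <= b -> 0 < b -> b < 2^-1 ->
  2 ^+ k.-1 - 1 <= q0 * (2 ^+ k.-1 - 1) ^+ 2 ->
  2 ^+ k.-1 * pow_sum k a - 1 <= qa * (2 ^+ k.-1 - 1) ^+ 2 ->
  2 ^+ k.-1 * pow_sum k b - 1 <= qb * (2 ^+ k.-1 - 1) ^+ 2 ->
  T * qb < (1 - 2 * b) ^+ 2 / 2 ->
  T * q0 + 2 ^- j1 < ln 2 -> T * qa + j1%:R * ln 2 * a + 2 ^- j1 < ln 2 ->
  T * qa + j2%:R * ln 2 * a + 2 ^- j2 < ln 2 ->
  T * qb + j2%:R * ln 2 * b + 2 ^- j2 < ln 2 ->
  rate_bound k r.
Proof.
move=> k1 r0 rT a0 ab b0 b1 hq0 hqa hqb hc h1 h2 h3 h4.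
have k0 : (0 < k)%N by exact: ltnW.
have K1 : 0 < (2 ^+ k.-1 - 1) ^+ 2 :> R.
  apply: exprn_gt0; rewrite subr_gt0 exprn_egt1 ?ltr1n//.
  by rewrite -lt0n ltn_predRL.
have key x q : x <= 2^-1 -> 2 ^+ k.-1 * pow_sum k x - 1 <= q * (2 ^+ k.-1 - 1) ^+ 2 ->
    r * excess k (1 - 2 * x) <= T * q.
  rewrite -ler_pdivrMr// -excess_pow_sum// => x1 hq.
  have ex0 : 0 <= excess k (1 - 2 * x) by apply: excess_ge0; lra.
  apply: (le_trans (ler_wpM2r ex0 rT)); exact: (ler_wpM2l (le_trans r0 rT)).
have e0 : r * excess k (1 - 2 * 0) <= T * q0.
  by apply: key; rewrite ?invr_ge0// /pow_sum subr0 expr1n expr0n gtn_eqF// addr0 mulr1.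
have eb := key _ _ (ltW b1) hqb; have ea := key _ _ (le_trans ab (ltW b1)) hqa.
apply: (@rate_criterion k r a b j1 j2) => //; rewrite /outer_rate; lra.
Qed.

End Rate.

(** * Uniformities 3 to 8, by explicit rationals *)

Section RateSmall.
Variable R : realType.
(** Here and in the next five lemmas the rationals are [a], [b], [q0], [qa], [qb]: [q0] is
    [1 / (2 ^ (k - 1) - 1)], while [qa] and [qb] are simple fractions at or just above the excess.
    For [k] equal to 3 or 4 a single tilt suffices, hence [a = b]. *)
Lemma rate_bound3 (r : R) : 0 <= r -> r <= 2 ^+ 2 * ln 2 - 2 -> rate_bound 3 r.
Proof.
move=> r0 rk; have L1 := ln2_lower R; have L2 := ln2_upper R.
apply: (@rate_numeric R 3 r (1 / 20) (1 / 20) (1 / 3) (27 / 100) (27 / 100) 2 2); first by [].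
all: rewrite /pow_sum; lra.
Qed.

Lemma rate_bound4 (r : R) : 0 <= r -> r <= 2 ^+ 3 * ln 2 - 2 -> rate_bound 4 r.
Proof.
move=> r0 rk; have L1 := ln2_lower R; have L2 := ln2_upper R.
apply: (@rate_numeric R 4 r (13 / 200) (13 / 200) (1 / 7) (105 / 1006) (105 / 1006) 3 3); first by [].
all: rewrite /pow_sum; lra.
Qed.

Lemma rate_bound5 (r : R) : 0 <= r -> r <= 2 ^+ 4 * ln 2 - 2 -> rate_bound 5 r.
Proof.
move=> r0 rk; have L1 := ln2_lower R; have L2 := ln2_upper R.
apply: (@rate_numeric R 5 r (2 / 25) (33 / 200) (1 / 15) (7 / 165) (15 / 614) 4 3); first by [].
all: rewrite /pow_sum; lra.
Qed.

Lemma rate_bound6 (r : R) : 0 <= r -> r <= 2 ^+ 5 * ln 2 - 2 -> rate_bound 6 r.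
Proof.
move=> r0 rk; have L1 := ln2_lower R; have L2 := ln2_upper R.
apply: (@rate_numeric R 6 r (7 / 100) (27 / 200) (1 / 31) (13 / 634) (11 / 852) 5 3); first by [].
all: rewrite /pow_sum; lra.
Qed.

Lemma rate_bound7 (r : R) : 0 <= r -> r <= 2 ^+ 6 * ln 2 - 2 -> rate_bound 7 r.
Proof.
move=> r0 rk; have L1 := ln2_lower R; have L2 := ln2_upper R.
apply: (@rate_numeric R 7 r (1 / 25) (21 / 200) (1 / 63) (11 / 927) (2 / 279) 6 4); first by [].
all: rewrite /pow_sum; lra.
Qed.

Lemma rate_bound8 (r : R) : 0 <= r -> r <= 2 ^+ 7 * ln 2 - 2 -> rate_bound 8 r.
Proof.
move=> r0 rk; have L1 := ln2_lower R; have L2 := ln2_upper R.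
apply: (@rate_numeric R 8 r (1 / 40) (17 / 200) (1 / 127) (4 / 623) (2 / 521) 7 5); first by [].
all: rewrite /pow_sum; lra.
Qed.

End RateSmall.

(** * Uniformity at least 9 *)

Section RateLarge.
Variable R : realType.

Lemma exprn_bonferroni n (a : R) : 0 <= a -> a <= 1 ->
  (1 - a) ^+ n <= 1 - n%:R * a + (n%:R * (n%:R - 1) / 2) * a ^+ 2.
Proof.
move=> a0 a1; elim: n => [|n IH]; first by rewrite expr0; lra.
rewrite exprS; apply: (le_trans (ler_wpM2l _ IH)); first by lra.
rewrite -(natr1 n); set x := n%:R.
have x1 : 0 <= x * (x - 1).
  rewrite /x; case: n {IH x} => [|n]; first by rewrite mul0r.
  by rewrite -(natr1 n) addrK mulr_ge0// addr_ge0.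
by have := mulr_ge0 x1 (exprn_ge0 3 a0); lra.
Qed.

(** Equality at [n = 9]: the origin of 9 / 32 in the bound on [2 ^- (k - 1)]. *)
Lemma leq_exp2_quadratic n : (9 <= n)%N -> (32 * (n * n.-1) <= 9 * 2 ^ n.-1)%N.
Proof.
elim: n => // n IH; rewrite leq_eqVlt => /orP[/eqP <-//|n9].
have := IH n9; case: n n9 {IH} => // n n9 /=; rewrite expnS; nia.
Qed.

(** Equality at [j = 5], which is [uphalf 9]: the origin of 5 / 16 in the bound on
    [2 ^- uphalf k]. *)
Lemma leq_exp2_linear j : (5 <= j)%N -> (32 * j <= 5 * 2 ^ j)%N.
Proof.
elim: j => // j IH; rewrite leq_eqVlt => /orP[/eqP <-//|j5].
have := IH j5; rewrite expnS; lia.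
Qed.

Lemma uphalf_bounds n : (n <= 2 * uphalf n <= n.+1)%N.
Proof. by rewrite mul2n; have := odd_double_half n; rewrite uphalf_half; lia. Qed.

(** In this and the following estimates the reals stand for [x = k], [D = 1 / (k * (k - 1))],
    [b = 1 / k], [L = ln 2] and [K = 2 ^ (k - 1)]; [A] and [B] for [r * excess] at the inner and
    outer end point, [I] for the [2 ^- j] of the tilt. *)
Lemma large_center (L b : R) : L <= 1387 / 2000 -> b <= 9^-1 ->
  L * (3 / 8 + 81^-1) < (1 - 2 * b) ^+ 2 / 2.
Proof.
move=> L2 b9; have h : (7 / 9) ^+ 2 <= (1 - 2 * b) ^+ 2.
  by rewrite lerXn2r// ?nnegrE; lra.
lra.
Qed.

(** At overlap 1 the shift by 2 in the bound on [r] decides: [(K * L - 2) / (K - 1)] is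
    [L - (2 - L) / (K - 1)], and since [2 - L > 1] this gain beats the [K^-1] of the tilt. *)
Lemma large_origin (r K L : R) : 256 <= K -> L <= 1387 / 2000 -> r <= K * L - 2 ->
  r * ((K - 1) / (K - 1) ^+ 2) + K^-1 < L.
Proof.
move=> K256 L2 rk; have -> : (K - 1) / (K - 1) ^+ 2 = (K - 1)^-1 by field; lra.
have h : r / (K - 1) <= (K * L - 2) / (K - 1) by rewrite ler_wpM2r ?invr_ge0//; lra.
apply: (le_lt_trans (lerD h (lexx _))); rewrite -subr_gt0.
have -> : L - ((K * L - 2) / (K - 1) + K^-1) = (K * (1 - L) + 1) / (K * (K - 1)).
  by field; apply/andP; split; lra.
have KL : 0 <= K * (1 - L) by rewrite mulr_ge0//; lra.
by rewrite divr_gt0 ?mulr_gt0//; lra.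
Qed.

(** With tilt [k - 1] the terms in [x * D] cancel; a gain of [5 / 4 - 161 / 200] times [L * D]
    remains against [9 / 32 * D]. *)
Lemma large_inner_left (x D L A I : R) : 0 < D -> 69 / 100 <= L ->
  A <= L * (1 - 5 / 4 * (x * D) + 161 / 200 * D) -> I <= 9 / 32 * D ->
  A + (x - 1) * L * (5 / 4 * D) + I < L.
Proof.
move=> D0 L1 hA hI; have LD : 69 / 100 * D <= L * D by rewrite ler_pM2r.
lra.
Qed.

Lemma large_outer_left (x D L A I j : R) : 9 <= x -> 0 < D -> 69 / 100 <= L ->
  2 * j <= x + 1 ->
  A <= L * (1 - 5 / 4 * (x * D) + 161 / 200 * D) -> I <= 5 / 16 * ((x - 1) * D) ->
  A + j * L * (5 / 4 * D) + I < L.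
Proof.
move=> x9 D0 L1 jx hA hI.
have LD : 0 <= L * D by rewrite mulr_ge0//; lra.
have h := ler_wpM2r LD jx.
have xD : 9 * D <= x * D by rewrite ler_pM2r.
have h2 : 69 / 100 * ((x - 9) * D) <= L * ((x - 9) * D).
  by rewrite ler_wpM2r// mulr_ge0//; lra.
have h3 : 69 / 100 * D <= L * D by rewrite ler_pM2r.
lra.
Qed.

Lemma large_outer_right (x L B I j b : R) : 2 * j <= x + 1 -> x * b = 1 ->
  0 <= b -> b <= 9^-1 -> 69 / 100 <= L -> L <= 1387 / 2000 ->
  B <= L * (3 / 8 + 81^-1) -> I <= 5 / 16 * b ->
  B + j * L * b + I < L.
Proof.
move=> jx xb b0 b9 L1 L2 hB hI.
have Lb : 0 <= L * b by rewrite mulr_ge0//; lra.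
have h := ler_wpM2r Lb jx.
have h2 : L * (x * b) = L by rewrite xb mulr1.
have h3 : L * b <= L * 9^-1 by rewrite ler_wpM2l//; lra.
lra.
Qed.

Lemma pow_sum_inner k (x := k%:R : R) (D := (x * (x - 1))^-1) : (9 <= k)%N ->
  pow_sum k (5 / 4 * D) <= 1 - 5 / 4 * (x * D) + 161 / 200 * D.
Proof.
move=> k9; have x9 : 9 <= x by rewrite /x ler_nat.
have xx : 72 <= x * (x - 1) by nra.
have D0 : 0 < D by rewrite invr_gt0; lra.
have D72 : D <= 72^-1 by rewrite /D lef_pV2 ?posrE//; lra.
have xxD : x * (x - 1) * D = 1 by rewrite /D mulfV//; lra.
set a := 5 / 4 * D; have a0 : 0 <= a by rewrite /a; lra.
have a1 : a <= 1 by rewrite /a; lra.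
rewrite /pow_sum; have h1 := exprn_bonferroni k a0 a1; rewrite -/x in h1.
have h2 : a ^+ k <= a * a by rewrite -expr2 ler_wiXn2l// (leq_trans _ k9).
(* The quadratic Bonferroni term contributes 25 / 32, and [a ^+ k] at most 25 / 1152 because
   [D <= 1 / 72]; together they stay below 161 / 200. *)
have h3 : x * (x - 1) / 2 * a ^+ 2 = 25 / 32 * D.
  by rewrite -[RHS]mulr1 -[X in _ = _ * X]xxD /a; field.
have h4 : a * a <= 25 / 1152 * D by rewrite /a; have := ler_wpM2l (ltW D0) D72; lra.
have h5 : x * a = 5 / 4 * (x * D) by rewrite /a; ring.
rewrite h3 h5 in h1; apply: (le_trans (lerD h1 (le_trans h2 h4))).
by lra.
Qed.

Lemma pow_sum_outer k : (9 <= k)%N -> pow_sum k (k%:R^-1 : R) <= 3 / 8 + 81^-1.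
Proof.
move=> k9; set x : R := k%:R; set b := x^-1.
have x9 : 9 <= x by rewrite /x ler_nat.
have b9 : b <= 9^-1 by rewrite /b lef_pV2 ?posrE//; lra.
have b0 : 0 < b by rewrite invr_gt0; lra.
have xb : x * b = 1 by rewrite /b mulfV//; lra.
have b1 : b <= 1 by lra.
rewrite /pow_sum; apply: lerD.
  (* [(1 - b) ^+ k] is at most 1 / e, and five terms of the exponential series give 1 / e <= 3 /
     8. *)
  have h : 1 - b <= expR (- b) by exact: expR_ge1Dx.
  apply: (le_trans (lerXn2r k _ _ h)); rewrite ?nnegrE ?expR_ge0 ?subr_ge0//.
  rewrite -expRM_natl mulrN -/x xb expRN -[leRHS]invrK lef_pV2 ?posrE ?expR_gt0//.
  apply: (le_trans _ (@expR_ge_partial _ 1 5 _)) => //.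
  by rewrite !big_ord_recr big_ord0 /= !factE /= !expr1n; clear; lra.
apply: (@le_trans _ _ (b ^+ 2)).
  by rewrite ler_wiXn2l ?(leq_trans _ k9)// ltW.
by rewrite expr2; nra.
Qed.

Lemma inv_mul_pred_bounds (x : R) (D := (x * (x - 1))^-1) : 9 <= x ->
  [/\ 72 <= x * (x - 1), 0 < D, D <= 72^-1, x^-1 = (x - 1) * D & x^-1 <= 9^-1].
Proof.
move=> x9; have xx : 72 <= x * (x - 1) by nra.
have x0 : 0 < x by exact: lt_le_trans x9.
have xx0 : 0 < x * (x - 1) by exact: lt_le_trans xx.
split=> //; first by rewrite invr_gt0.
- by rewrite lef_pV2 ?posrE.
- by rewrite /D invfM mulrCA divff ?mulr1// gt_eqF// subr_gt0 (lt_le_trans _ x9)// ltr1n.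
- by rewrite lef_pV2 ?posrE.
Qed.

(** Cleared of denominators, the right side minus the left one is
    [2 * K * p * (1 - L) + L * p + K * L - 2]: the shift by 2 outweighs the loss from replacing
    [(K - 1) ^+ 2] by [K ^+ 2]. *)
Lemma large_excess (K L p : R) : 256 <= K -> 69 / 100 <= L -> L <= 1387 / 2000 -> 0 <= p ->
  (K * L - 2) * ((K * p - 1) / (K - 1) ^+ 2) <= L * p.
Proof.
move=> K256 L1 L2 p0; rewrite mulrA ler_pdivrMr; last by rewrite exprn_gt0//; lra.
have h1 : 0 <= K * (p * (1 - L)) by rewrite !mulr_ge0//; lra.
have h2 : 0 <= L * p by rewrite mulr_ge0//; lra.
have K0 : 0 <= K - 256 by rewrite subr_ge0.
have L0 : 0 <= L - 69 / 100 by rewrite subr_ge0.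
have h3 := mulr_ge0 K0 L0.
lra.
Qed.

Lemma excess_le_pow_sum k (r y : R) : (0 < k)%N -> 256 <= 2 ^+ k.-1 :> R ->
  r <= 2 ^+ k.-1 * ln 2 - 2 -> 0 <= y -> y <= 2^-1 ->
  r * excess k (1 - 2 * y) <= ln 2 * pow_sum k y.
Proof.
move=> k0 K256 rk y0 y1.
have p0 : 0 <= pow_sum k y.
  by apply: addr_ge0; apply: exprn_ge0 => //; lra.
have e0 : 0 <= excess k (1 - 2 * y) by apply: excess_ge0; lra.
apply: (le_trans (ler_wpM2r e0 rk)); rewrite excess_pow_sum//.
exact: large_excess (ln2_lower R) (ln2_upper R) p0.
Qed.

(* The two tilts are [k - 1] on [0, 5 / (4 * k * (k - 1))] and [k / 2], rounded
   up, on the rest of [0, 1 / k]; convexity reduces everything to end points. *)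
Lemma rate_bound_large k (r : R) :
  (9 <= k)%N -> 0 <= r -> r <= 2 ^+ k.-1 * ln 2 - 2 -> rate_bound k r.
Proof.
move=> k9 r0 rk; have L1 := ln2_lower R; have L2 := ln2_upper R.
have k0 : (0 < k)%N by exact: leq_trans k9.
have x9 : 9 <= k%:R :> R by rewrite ler_nat.
have xk : k%:R - 1 = k.-1%:R :> R by rewrite -[in LHS](prednK k0) -(natr1 k.-1) addrK.
have [x72 D0 D72 bD b9] := inv_mul_pred_bounds x9.
have KX : 32 * (k%:R * (k%:R - 1)) <= 9 * 2 ^+ k.-1 :> R.
  by have := leq_exp2_quadratic k9; rewrite -(ler_nat R) !natrM natrX -xk.
have /andP[jk1 jk2] := uphalf_bounds k.
have jx1 : k%:R <= 2 * (uphalf k)%:R :> R by rewrite -natrM ler_nat.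
have jx2 : 2 * (uphalf k)%:R <= k%:R + 1 :> R by rewrite -natrM natr1 ler_nat.
have jX : 32 * (uphalf k)%:R <= 5 * 2 ^+ uphalf k :> R.
  by rewrite -natrX -!natrM ler_nat leq_exp2_linear// (@uphalf_leq 9).
have psa := pow_sum_inner k9; have psb := pow_sum_outer k9.
move: psa psb x9 xk x72 D0 D72 bD b9 KX jx1 jx2 jX.
move Ex : (k%:R : R) => x; move ED : ((x * (x - 1))^-1 : R) => D.
move Eb : (x^-1 : R) => b;
move=> psa psb x9 xk x72 D0 D72 bD b9 KX jx1 jx2 jX.
have K256 : 256 <= 2 ^+ k.-1 :> R by clear - x72 KX; lra.
have K0 : 0 < 2 ^+ k.-1 :> R by rewrite exprn_gt0.
have x0 : 0 < x by apply: lt_le_trans x9; rewrite ltr0n.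
have xx0 : 0 < x * (x - 1) by apply: lt_le_trans x72; rewrite ltr0n.
have KD : (2 ^+ k.-1)^-1 <= 9 / 32 * D.
  rewrite -ED -[9 / 32]invf_div -invfM lef_pV2 ?posrE//.
    by clear - KX; lra.
  by apply: mulr_gt0 => //; exact: divr_gt0.
have jJ : 2 ^- uphalf k <= 5 / 16 * b.
  rewrite -Eb -[5 / 16]invf_div -invfM lef_pV2 ?posrE ?exprn_gt0//.
    by clear - jX jx1; lra.
  by apply: mulr_gt0 => //; exact: divr_gt0.
have b0 : 0 < b by rewrite -Eb invr_gt0.
have xb : x * b = 1 by rewrite -Eb divff// gt_eqF.
have a0 : 0 <= 5 / 4 * D by rewrite mulr_ge0// ltW.
have a2 : 5 / 4 * D <= 2^-1 by clear - D72; lra.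
have ab : 5 / 4 * D <= b.
  by rewrite bD ler_pM2r//; clear - x9; lra.
have b2 : b < 2^-1 by apply: (le_lt_trans b9); rewrite ltf_pV2 ?posrE ?ltr_nat.
have L0 : 0 <= ln 2 :> R by exact: le_trans L1.
have fa := le_trans (excess_le_pow_sum k0 K256 rk a0 a2) (ler_wpM2l L0 psa).
have fb := le_trans (excess_le_pow_sum k0 K256 rk (ltW b0) (ltW b2)) (ler_wpM2l L0 psb).
apply: (@rate_criterion R k r (5 / 4 * D) b k.-1 (uphalf k)) => //.
- by apply: (le_lt_trans fb); exact: large_center.
- rewrite /outer_rate.
  rewrite excess_pow_sum// /pow_sum subr0 expr1n expr0n gtn_eqF// addr0 !mulr1 mulr0 addr0.
  exact: large_origin.
- by rewrite /outer_rate -xk; exact: large_inner_left.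
- by rewrite bD in jJ; rewrite /outer_rate; exact: (large_outer_left x9).
- by rewrite /outer_rate; exact: (large_outer_right jx2 xb (ltW b0) b9 L1 L2 fb jJ).
Qed.

Lemma rate_bound_all k (r : R) :
  (3 <= k)%N -> 0 <= r -> r <= 2 ^+ k.-1 * ln 2 - 2 -> rate_bound k r.
Proof.
case: k => [|[|[|[|[|[|[|[|[|k]]]]]]]]] // _.
- exact: rate_bound3.
- exact: rate_bound4.
- exact: rate_bound5.
- exact: rate_bound6.
- exact: rate_bound7.
- exact: rate_bound8.
- exact: rate_bound_large.
Qed.

End RateLarge.

(** * Overlaps of colourings with a given number of zeros *)

Section Binomials.

Lemma leq_bin_central h i : ('C(h.*2, i) <= 'C(h.*2, h))%N.
Proof.
have below d : forall i, (i + d = h)%N -> ('C(h.*2, i) <= 'C(h.*2, h))%N.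
  elim: d => [|d IH] {}i; first by rewrite addn0 => ->.
  move=> id; apply: leq_trans (IH i.+1 _); last by lia.
  have := mul_bin_left h.*2 i => e.
  by rewrite -(leq_pmul2l (ltn0Sn i)) e leq_mul2r; apply/orP; right; lia.
case: (leqP i h) => ih; first by apply: (below (h - i)%N); lia.
case: (leqP i h.*2) => ih2; last by rewrite bin_small.
by rewrite -bin_sub//; apply: (below (i - h)%N); lia.
Qed.

Lemma bin_central_rec h : (h.+1 * 'C(h.+1.*2, h.+1) = 2 * h.*2.+1 * 'C(h.*2, h))%N.
Proof.
have e1 : ('C(h.+1.*2, h.+1) = 2 * 'C(h.*2.+1, h.+1))%N.
  rewrite doubleS binS (_ : 'C(h.*2.+1, h) = 'C(h.*2.+1, h.+1)); first by lia.
  by rewrite -bin_sub; [congr 'C(_, _); lia|lia].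
by rewrite e1 mulnCA -mul_bin_diag /= mulnA.
Qed.

Lemma bin_central_sqr h : (h.*2.+1 * 'C(h.*2, h) ^ 2 <= 4 ^ h.*2)%N.
Proof.
elim: h => [//|h IH]; have := bin_central_rec h.
set c := 'C(_, _); set c' := 'C(_, _) in IH * => e.
rewrite -(leq_pmul2l (_ : 0 < h.+1 ^ 2)%N); last by rewrite expn_gt0.
rewrite (_ : h.+1 ^ 2 * (h.+1.*2.+1 * c ^ 2) = h.+1.*2.+1 * (h.+1 * c) ^ 2)%N; last by lia.
rewrite e doubleS !expnS; move: IH; rewrite !expnS !expn0.
move: (4 ^ h.*2)%N => X; rewrite -!muln2; nia.
Qed.

(** The squared form of ['C(N, i) <= 2 ^ N / sqrt N], an elementary replacement for a local limit
    theorem. *)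
Lemma bin_sqr N i : (N * 'C(N, i) ^ 2 <= 4 ^ N)%N.
Proof.
case: (boolP (odd N)) => oN; last first.
  have -> : N = (N./2).*2 by have := odd_double_half N; rewrite (negbTE oN).
  move: N./2 => h; apply: leq_trans (bin_central_sqr h).
  by rewrite leq_mul// leq_exp2r// leq_bin_central.
have -> : N = (N./2).*2.+1 by have := odd_double_half N; rewrite oN; lia.
move: N./2 => h.
have : ('C(h.*2.+1, i) <= 2 * 'C(h.*2, h))%N.
  case: i => [|i]; first by rewrite bin0 muln_gt0 bin_gt0; lia.
  by rewrite binS; have := leq_bin_central h i; have := leq_bin_central h i.+1; lia.
have := bin_central_sqr h.
set c' := 'C(h.*2, h); set c := 'C(_, _) => h1 h2.
have h3 : (c ^ 2 <= 4 * c' ^ 2)%N by rewrite -[4%N]/(2 ^ 2)%N -expnMn leq_exp2r.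
apply: (leq_trans (leq_mul (leqnn _) h3)).
by rewrite mulnCA (expnS 4) leq_mul2l.
Qed.

End Binomials.

(** * Magnetization and overlaps *)

Section Spins.
Variable R : realType.

Definition spin (b : bool) : R := if b then -1 else 1.

Lemma spinM a b : spin (a (+) b) = spin a * spin b.
Proof. by case: a; case: b; rewrite /spin /=; lra. Qed.

Lemma spin_sqr a : spin a * spin a = 1.
Proof. by case: a; rewrite /spin; lra. Qed.

Section Magnetization.
Variable n : nat.
Local Notation config := {ffun 'I_n -> bool}.

Definition mag (s : config) : R := \sum_v spin (s v).

Lemma mag_mgf (l : R) :
  \sum_(s : config) expR (l * mag s) = (expR l + expR (- l)) ^+ n.
Proof.
transitivity (\prod_(v < n) \sum_(b : bool) expR (l * spin b)).
  rewrite bigA_distr_bigA; apply: eq_bigr => s _.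
  by rewrite /mag mulr_sumr expR_sum.
rewrite (eq_bigr (fun=> expR l + expR (- l))) ?prodr_const ?card_ord// => v _.
by rewrite big_bool /spin addrC mulr1 mulrN1.
Qed.

Lemma card_config : #|{: config}|%:R = 2 ^+ n :> R.
Proof. by rewrite card_ffun card_bool card_ord natrX. Qed.

Lemma mag_abs (s : config) : `|mag s| <= n%:R.
Proof.
apply: (le_trans (ler_norm_sum _ _ _)).
rewrite (eq_bigr (fun=> 1)) ?sumr_const ?card_ord// => v _.
by rewrite /spin; case: (s v); rewrite ?normrN normr1.
Qed.

End Magnetization.

Lemma fact_double i : (2 ^ i * i`! <= (i.*2)`!)%N.
Proof.
elim: i => // i IH; rewrite doubleS !factS expnS.
have := leq_mul (leqnn (2 * i.+1)) IH; move: (i`!) (2 ^ i)%N ((i.*2)`!) => a b c.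
by rewrite -!muln2; nia.
Qed.

(** Termwise comparison of power series: odd powers cancel, and [2 ^ i * i!] is at most
    [(2 * i)!]. *)
Lemma expRD_expRN_le (x : R) : expR x + expR (- x) <= 2 * expR (x ^+ 2 / 2).
Proof.
have h m : series (exp_coeff x \+ exp_coeff (- x)) m <= 2 * expR (x ^+ 2 / 2).
  pose F i := (exp_coeff x \+ exp_coeff (- x)) i.
  have F0 i : 0 <= F i.
    rewrite /F /exp_coeff /= -mulrDl divr_ge0 ?ler0n// exprNn.
    rewrite -signr_odd; case: (boolP (odd i)) => oi; rewrite ?expr1 ?expr0.
      by rewrite mulN1r subrr.
    by rewrite mul1r addr_ge0// -[i]odd_double_half (negbTE oi) add0n -mul2n exprM exprn_ge0 ?sqr_ge0.
  change (\sum_(0 <= i < m) F i <= 2 * expR (x ^+ 2 / 2)).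
  have le2 : \sum_(0 <= i < m) F i <= \sum_(0 <= i < m.*2) F i.
    by rewrite [leRHS](@big_cat_nat _ _ _ m) ?lerDl ?sumr_ge0//= -addnn leq_addr.
  apply: (le_trans le2).
  have -> : \sum_(0 <= i < m.*2) F i = \sum_(i < m) 2 * (x ^+ i.*2 / (i.*2)`!%:R).
    elim: m {le2} => [|m IH]; first by rewrite big_nil big_ord0.
    rewrite doubleS !big_nat_recr//= IH big_ord_recr /= -addrA; congr (_ + _).
    have e1 : (- x) ^+ m.*2 = x ^+ m.*2 by rewrite -mul2n !exprM sqrrN.
    by rewrite /F /exp_coeff /= !exprS e1 mulNr; ring.
  rewrite -mulr_sumr ler_pM2l//.
  have x20 : 0 <= x ^+ 2 / 2 by rewrite divr_ge0 ?sqr_ge0.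
  apply: le_trans (expR_ge_partial m x20); apply: ler_sum => i _.
  rewrite expr_div_n -exprM mul2n -mulrA ler_wpM2l//.
    by rewrite -mul2n exprM exprn_ge0// sqr_ge0.
  rewrite -invfM lef_pV2 ?posrE ?mulr_gt0 ?exprn_gt0 ?ltr0n ?fact_gt0//.
  by rewrite -natrX -natrM ler_nat fact_double.
have cx := @is_cvg_series_exp_coeff R x.
have cy := @is_cvg_series_exp_coeff R (- x).
have -> : expR x + expR (- x) = limn (series (exp_coeff x \+ exp_coeff (- x))).
  by rewrite seriesD limD.
apply: limr_le; last by near=> m; exact: h.
by rewrite seriesD; exact: is_cvgD.
Unshelve. all: by end_near. Qed.

Lemma geometric_le (q : R) m : 0 <= q -> q < 1 -> \sum_(i < m) q ^+ i <= (1 - q)^-1.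
Proof.
move=> q0 q1; have := subrX1 q m.
move=> e; rewrite -[leRHS]mul1r ler_pdivlMr ?subr_gt0// mulrC.
have := exprn_ge0 m q0; lra.
Qed.

Lemma mag_tail n (l : nat) :
  \sum_(s : {ffun 'I_n -> bool}) (l%:R <= mag s ^+ 2 / n%:R)%R%:R <=
    2 ^+ n * (2 * expR (- (l%:R / 2))) :> R.
Proof.
case: n => [|n].
  case: l => [|l]; last first.
    rewrite big1 ?mulr_ge0 ?expR_ge0// => s _.
    by rewrite invr0 mulr0 lern0.
  apply: (@le_trans _ _ (\sum_(s : {ffun 'I_0 -> bool}) 1)).
    by apply: ler_sum => s _; rewrite lern1 leq_b1.
  by rewrite sumr_const -[_ *+ _]/(#|{: {ffun 'I_0 -> bool}}|%:R) card_config mul0r oppr0 expR0; lra.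
pose N : R := n.+1%:R; have N0 : 0 < N by rewrite ltr0n.
(* The optimal Chernoff tilt for [|mag s| >= sqrt (l * n)], with exponent [- l + l / 2]; the two
   signs give the factor 2. *)
pose t := Num.sqrt (l%:R / N); have t0 : 0 <= t by exact: sqrtr_ge0.
have t2 : t ^+ 2 * N = l%:R by rewrite sqr_sqrtr ?divr_ge0// divfK// gt_eqF.
have pt (s : {ffun 'I_n.+1 -> bool}) : (l%:R <= mag s ^+ 2 / n.+1%:R)%R%:R <=
    expR (- l%:R) * (expR (t * mag s) + expR (- t * mag s)).
  rewrite -/N; have [h|_] := leP l%:R (mag s ^+ 2 / N); last first.
    by rewrite mulr_ge0 ?addr_ge0 ?expR_ge0.
  rewrite mulrDr -!expRD.
  have h2 : l%:R ^+ 2 <= (t * mag s) ^+ 2.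
    rewrite exprMn expr2 -[in X in _ * X]t2 mulrCA ler_wpM2l ?sqr_ge0//.
    by rewrite -ler_pdivlMr.
  have [y1|y1] := leP l%:R (t * mag s).
    apply: (@le_trans _ _ (expR (- l%:R + t * mag s))); last by rewrite lerDl expR_ge0.
    by apply: le_trans (expR_ge1Dx _); rewrite /= mulr1n; lra.
  have [y2|y2] := leP l%:R (- t * mag s).
    apply: (@le_trans _ _ (expR (- l%:R + - t * mag s))); last by rewrite lerDr expR_ge0.
    by apply: le_trans (expR_ge1Dx _); rewrite /= mulr1n; lra.
  have d1 : 0 < l%:R - t * mag s by rewrite subr_gt0.
  have d2 : 0 < l%:R + t * mag s by move: y2; rewrite mulNr; lra.
  by have := mulr_gt0 d1 d2; lra.
apply: (le_trans (ler_sum _ (fun s _ => pt s))).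
rewrite -mulr_sumr big_split /= !mag_mgf opprK [expR (- t) + _]addrC.
have h : (expR t + expR (- t)) ^+ n.+1 <= 2 ^+ n.+1 * expR (l%:R / 2).
  have -> : l%:R / 2 = n.+1%:R * (t ^+ 2 / 2) by rewrite -t2 /N; field.
  by rewrite expRM_natl -exprMn lerXn2r ?nnegrE ?addr_ge0 ?mulr_ge0 ?expR_ge0// expRD_expRN_le.
have -> : - (l%:R / 2) = - l%:R + l%:R / 2 :> R by field.
rewrite expRD.
by have := ler_wpM2l (expR_ge0 (- l%:R)) h; lra.
Qed.

(* The range [kappa < 1/2] is optimal; the second moment needs nearly all of it
   when [k] is 4 or 5. *)
Lemma mag_gauss n (kappa : R) : 0 <= kappa -> kappa < 2^-1 ->
  \sum_(s : {ffun 'I_n -> bool}) expR (kappa * (mag s ^+ 2 / n%:R)) <=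
  2 ^+ n * (2 * expR kappa / (1 - expR (kappa - 2^-1))).
Proof.
move=> k0 k1.
have q0 := expR_ge0 (kappa - 2^-1).
have q1 : expR (kappa - 2^-1) < 1 by rewrite expR_lt1; lra.
(* Layers of unit height: the layer [l = truncn T] alone dominates, and the tails [expR (- l / 2)]
   make the sum geometric with ratio [expR (kappa - 1 / 2)]. *)
have pt (s : {ffun 'I_n -> bool}) : expR (kappa * (mag s ^+ 2 / n%:R)) <=
    \sum_(l < n.+1) expR (kappa * l.+1%:R) * (l%:R <= mag s ^+ 2 / n%:R)%R%:R.
  set T := mag s ^+ 2 / n%:R.
  have T0 : 0 <= T by rewrite divr_ge0 ?sqr_ge0.
  have Tn : T <= n%:R.
    rewrite /T; case: n s {T T0} => [|n] s; first by rewrite invr0 mulr0.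
    rewrite ler_pdivrMr ?ltr0n// -expr2 -(real_normK (num_real (mag s))).
    by rewrite lerXn2r ?nnegrE// mag_abs.
  have /andP[l1 l2] := truncn_itv T0.
  have ln : (Num.truncn T < n.+1)%N by rewrite ltnS -(ler_nat R) (le_trans l1).
  rewrite (bigD1 (Ordinal ln))//= l1 mulr1.
  apply: (@le_trans _ _ (expR (kappa * (Num.truncn T).+1%:R))).
    by rewrite ler_expR ler_wpM2l// ltW.
  by rewrite lerDl sumr_ge0// => i _; rewrite mulr_ge0 ?expR_ge0.
apply: (le_trans (ler_sum _ (fun s _ => pt s))).
rewrite exchange_big /=.
apply: (@le_trans _ _ (\sum_(l < n.+1) 2 ^+ n * (2 * expR kappa) * expR (kappa - 2^-1) ^+ l)).
  apply: ler_sum => l _; rewrite -mulr_sumr.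
  apply: (le_trans (ler_wpM2l (expR_ge0 _) (mag_tail n l))).
  have -> : expR (kappa * l.+1%:R) = expR kappa * expR (kappa * l%:R).
    by rewrite -expRD -natr1; congr expR; ring.
  rewrite -expRM_natl.
  have -> : l%:R * (kappa - 2^-1) = kappa * l%:R + - (l%:R / 2) by field.
  by rewrite expRD le_eqVlt; apply/orP; left; apply/eqP; ring.
rewrite -mulr_sumr [leRHS]mulrA ler_wpM2l ?mulr_ge0 ?expR_ge0 ?exprn_ge0//.
exact: geometric_le.
Qed.

Definition flip n (s D : {ffun 'I_n -> bool}) : {ffun 'I_n -> bool} :=
  [ffun v => s v (+) D v].

Lemma flipK n (s : {ffun 'I_n -> bool}) : involutive (flip s).
Proof. by move=> D; apply/ffunP => v; rewrite !ffunE addKb. Qed.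

Definition overlap n (s t : {ffun 'I_n -> bool}) : R := mag (flip s t) / n%:R.

Lemma overlap_sum n (s t : {ffun 'I_n -> bool}) :
  overlap s t = n%:R^-1 * \sum_v spin (s v) * spin (t v).
Proof.
by rewrite /overlap mulrC /mag; congr (_ * _); apply: eq_bigr => v _; rewrite ffunE spinM.
Qed.

Definition zeros n (s : {ffun 'I_n -> bool}) : {set 'I_n} := [set v | ~~ s v].

Definition colour_class n (A : nat) : {set {ffun 'I_n -> bool}} :=
  [set s | #|zeros s| == A].

Lemma mag_zeros n (s : {ffun 'I_n -> bool}) : mag s = 2 * #|zeros s|%:R - n%:R.
Proof.
have -> : #|zeros s|%:R = \sum_v (~~ s v)%:R :> R.
  rewrite -sum1_card natr_sum big_mkcond; apply: eq_bigr => v _.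
  by rewrite inE; case: (s v).
have -> : n%:R = \sum_(v < n) 1 :> R by rewrite sumr_const card_ord.
rewrite mulr_sumr -sumrB; apply: eq_bigr => v _.
by rewrite /spin; case: (s v) => /=; lra.
Qed.

(* If [s] and [flip s D] both have [A] zeros, then the numbers of zeros of [s]
   inside and outside [zeros D] are determined by [D] and [A]. *)
Lemma card_flip_class n A (D : {ffun 'I_n -> bool}) :
  let P := #|zeros D| in
  (#|[set s in colour_class n A | flip s D \in colour_class n A]| ^ 2 * (P * (n - P)) <= 4 ^ n)%N.
Proof.
set S := [set s in _ | _]; set Z := zeros D => /=.
have cZ : (#|Z| + #|~: Z| = n)%N by rewrite cardsC card_ord.
(* Outside [Z] the flip exchanges the colours, so equal numbers of zeros before and after force
   exactly half of [~: Z] to be zeros of [s]; the other zeros lie in [Z]. *)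
pose j := (#|~: Z|./2); pose i := (A - j)%N.
have key s : s \in S -> (#|zeros s :&: Z| == i) && (#|zeros s :&: ~: Z| == j).
  rewrite !inE => /andP[/eqP s1 /eqP s2].
  have e1 : (#|zeros s :&: Z| + #|zeros s :&: ~: Z| = A)%N by rewrite -finset.setDE cardsID.
  have e2 : (#|zeros s :&: Z| + #|~: Z :\: zeros s| = A)%N.
    rewrite -[in RHS]s2 -(cardsID Z (zeros (flip s D))); congr (_ + _)%N.
      by apply: eq_card => v; rewrite !inE ffunE; case: (s v); case: (D v).
    by apply: eq_card => v; rewrite !inE ffunE; case: (s v); case: (D v).
  have e3 : (#|zeros s :&: ~: Z| + #|~: Z :\: zeros s| = #|~: Z|)%N.
    by rewrite finset.setIC cardsID.
  have e4 : #|zeros s :&: ~: Z| = j by rewrite /j; lia.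
  by rewrite e4 eqxx andbT; apply/eqP; rewrite /i; lia.
have le1 : (#|S| <= 'C(#|Z|, i) * 'C(#|~: Z|, j))%N.
  pose f (s : {ffun 'I_n -> bool}) := (zeros s :&: Z, zeros s :&: ~: Z).
  have finj : injective f.
    move=> s t [e1 e2]; apply/ffunP => v.
    have := congr1 (fun X : {set _} => v \in X) e1; have := congr1 (fun X : {set _} => v \in X) e2.
    by rewrite !inE; case: (D v); case: (s v); case: (t v).
  rewrite -(card_imset _ finj) -!cards_draws -cardsX subset_leq_card//.
  apply/fintype.subsetP => p /imsetP[s sS ->]; have /andP[s1 s2] := key s sS.
  by rewrite finset.in_setX !inE /f /= !finset.subsetIr s1 s2.
have -> : (n - #|Z| = #|~: Z|)%N by lia.
apply: (@leq_trans (('C(#|Z|, i) * 'C(#|~: Z|, j)) ^ 2 * (#|Z| * #|~: Z|))).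
  by rewrite leq_mul2r leq_exp2r// le1 orbT.
rewrite -[in leqRHS]cZ expnD.
apply: leq_trans (leq_mul (bin_sqr #|Z| i) (bin_sqr #|~: Z| j)).
by rewrite expnMn; lia.
Qed.

(** Away from overlap 1 in absolute value, [zeros D] and its complement both have linear size, so
    their two binomial bounds multiply to order [1 / n]. This matches the square of the density, of
    order [1 / sqrt n], of a large colour class. *)
Lemma card_flip_class_le n A (D : {ffun 'I_n -> bool}) (u0 : R) : (0 < n)%N -> 0 <= u0 -> u0 < 1 ->
  `|mag D| / n%:R <= u0 ->
  #|[set s in colour_class n A | flip s D \in colour_class n A]|%:R <=
  2 / (1 - u0) * (2 ^+ n / n%:R) :> R.
Proof.
move=> n0 u00 u01 hD; set N := #|_|.
have nR : 0 < n%:R :> R by rewrite ltr0n.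
have u1 : 0 < 1 - u0 by lra.
rewrite -(ler_pM2l (mulr_gt0 nR (divr_gt0 u1 (ltr0n R 2)))).
have -> : n%:R * ((1 - u0) / 2) * (2 / (1 - u0) * (2 ^+ n / n%:R)) = 2 ^+ n.
  by field; rewrite !gt_eqF.
rewrite -(@ler_pXn2r _ 2) ?nnegrE ?mulr_ge0 ?exprn_ge0 ?(ltW u1) ?invr_ge0//.
have := card_flip_class A D; rewrite -/N /= -(ler_nat R) !natrM !natrX.
rewrite -exprM mulnC exprM (_ : 2 ^+ 2 = 4%:R); last by rewrite -natrX.
apply: le_trans.
have zn : (#|zeros D| <= n)%N by rewrite -[leqRHS]card_ord max_card.
rewrite natrB//; set P := #|zeros D|%:R.
have mE : mag D = 2 * P - n%:R by exact: mag_zeros.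
have hm : mag D ^+ 2 <= (u0 * n%:R) ^+ 2.
  rewrite -(real_normK (num_real (mag D))) lerXn2r ?nnegrE ?mulr_ge0//.
  by rewrite -ler_pdivrMr.
have h2 : P * (n%:R - P) = (n%:R ^+ 2 - mag D ^+ 2) / 4 by rewrite mE; field.
have -> : (n%:R * ((1 - u0) / 2) * N%:R) ^+ 2 = N%:R ^+ 2 * (n%:R ^+ 2 * (1 - u0) ^+ 2 / 4) :> R by field.
rewrite ler_wpM2l ?sqr_ge0// h2 ler_wpM2r//.
apply: (@le_trans _ _ (n%:R ^+ 2 * (1 - u0 ^+ 2))).
  by rewrite ler_wpM2l ?sqr_ge0//; nra.
by move: hm; rewrite exprMn; lra.
Qed.

Lemma flip_sum n A (f : {ffun 'I_n -> bool} -> R) :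
  \sum_(s in colour_class n A) \sum_(t in colour_class n A) f (flip s t) =
  \sum_D #|[set s in colour_class n A | flip s D \in colour_class n A]|%:R * f D.
Proof.
transitivity (\sum_(s in colour_class n A) \sum_D (flip s D \in colour_class n A)%:R * f D).
  apply: eq_bigr => s _; rewrite (reindex_inj (inv_inj (flipK s))) /=.
  rewrite big_mkcond; apply: eq_bigr => D _.
  by rewrite flipK; case: ifP => _; rewrite ?mul1r ?mul0r.
rewrite exchange_big; apply: eq_bigr => D _; rewrite -mulr_suml; congr (_ * _).
rewrite -sum1_card natr_sum (eq_bigl (fun s => (s \in colour_class n A) && (flip s D \in colour_class n A))).
  rewrite big_mkcondr; apply: eq_bigr => s _.
  by case: ifP.
by move=> s; rewrite inE.
Qed.

(* The overlap of a pair of members of a colour class behaves, up to a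
   constant factor, as the overlap of two unconstrained colourings: for central
   overlaps by [card_flip_class_le], elsewhere because the exponential gain beats the
   factor [n] lost by dropping the constraint. *)
Lemma overlap_moment k (r : R) : 0 <= r -> rate_bound k r ->
  exists c C : R, [/\ 0 < c, 0 < C & forall n A, (0 < n)%N ->
    (4 : R) ^+ n <= 64 * n%:R * #|colour_class n A|%:R ^+ 2 ->
    \sum_(s in colour_class n A) \sum_(t in colour_class n A)
      expR (n%:R * (r * excess k `|overlap s t| + c * overlap s t ^+ 2)) <=
    C * #|colour_class n A|%:R ^+ 2].
Proof.
move=> r0 [u0 [kappa [c0 [j1 [j2 [/andP[u00 u01] /andP[k0 k1] c00 hc ho]]]]]].
(* Half of the slack in either regime is kept; the other half pays for the additional term
   [c * u ^+ 2]. *)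
pose c := Num.min ((2^-1 - kappa) / 2) (c0 / 2).
have cc : 0 < c by rewrite lt_min; apply/andP; split; lra.
have [c1 c2] : c <= (2^-1 - kappa) / 2 /\ c <= c0 / 2.
  by apply/andP; rewrite -le_min.
pose kc := kappa + c.
have kc1 : kc < 2^-1 by rewrite /kc; lra.
have kc0 : 0 <= kc by rewrite /kc; lra.
pose G := 2 * expR kc / (1 - expR (kc - 2^-1)).
have G0 : 0 <= G.
  by rewrite divr_ge0 ?mulr_ge0 ?expR_ge0// subr_ge0 expR_le1; lra.
have u1 : 0 < 1 - u0 by lra.
have w0 : 0 <= 2 / (1 - u0) by rewrite divr_ge0// ltW.
have wG : 0 <= 2 / (1 - u0) * G by exact: mulr_ge0.
have c8 : 0 <= 8 / c0 by rewrite divr_ge0// ltW.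
pose C := 64 * (2 / (1 - u0) * G + 8 / c0 + 1).
have C0 : 0 < C by move: wG c8; rewrite /C; lra.
exists c, C; split=> //.
move=> n A n0 hn; have nR : 0 < n%:R :> R by rewrite ltr0n.
pose u (D : {ffun 'I_n -> bool}) := mag D / n%:R.
pose f D := expR (n%:R * (r * excess k `|u D| + c * u D ^+ 2)).
rewrite (flip_sum A f).
pose NN D : R := #|[set s in colour_class n A | flip s D \in colour_class n A]|%:R.
have NN2 D : NN D <= 2 ^+ n.
  by rewrite /NN -(card_config n) ler_nat max_card.
have absu D : `|u D| = `|mag D| / n%:R by rewrite normrM normfV normr_nat.
have u_le1 D : `|u D| <= 1 by rewrite absu ler_pdivrMr// mul1r mag_abs.
pose O j D : R := expR (n%:R * (ln 2 - c0 / 2 - j%:R * ln 2 / 2 * (1 - `|u D|) - 2 ^- j)).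
have pt D : NN D * f D <= 2 / (1 - u0) * (2 ^+ n / n%:R) * expR (kc * (mag D ^+ 2 / n%:R)) +
    2 ^+ n * (O j1 D + O j2 D).
  have O0 j : 0 <= O j D by exact: expR_ge0.
  have f0 : 0 <= f D by exact: expR_ge0.
  have B0 : 0 <= 2 / (1 - u0) * (2 ^+ n / n%:R).
    by rewrite mulr_ge0// divr_ge0 ?exprn_ge0.
  have [hu|hu] := leP `|u D| u0.
    apply: (@le_trans _ _ (2 / (1 - u0) * (2 ^+ n / n%:R) * expR (kc * (mag D ^+ 2 / n%:R)))).
      apply: ler_pM => //; first by apply: card_flip_class_le => //; rewrite ?(ltW u00)// -absu.
      rewrite ler_expR.
      have -> : kc * (mag D ^+ 2 / n%:R) = n%:R * (kappa * `|u D| ^+ 2 + c * u D ^+ 2).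
        by rewrite (real_normK (num_real _)) /kc /u; field; rewrite gt_eqF.
      by rewrite ler_pM2l// lerD2r hc.
    by rewrite lerDl mulr_ge0 ?exprn_ge0// addr_ge0.
  apply: (@le_trans _ _ (2 ^+ n * (O j1 D + O j2 D))); last first.
    by rewrite lerDr mulr_ge0// expR_ge0.
  apply: ler_pM => //.
  pose x := (1 - `|u D|) / 2.
  have [||j jj hj] := ho x; [by rewrite /x; have := u_le1 D; lra|by rewrite /x; lra|].
  have fO : f D <= O j D.
    rewrite ler_expR ler_pM2l//; move: hj; rewrite /outer_rate.
    have -> : 1 - 2 * x = `|u D| by rewrite /x; field.
    have : c * u D ^+ 2 <= c * 1.
      by rewrite ler_pM2l// -(real_normK (num_real _)) expr_le1.
    have -> : j%:R * ln 2 * x = j%:R * ln 2 / 2 * (1 - `|u D|) by rewrite /x; field.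
    lra.
  by case/orP: jj fO => /eqP -> h; have := O0 j1; have := O0 j2; lra.
apply: (le_trans (ler_sum _ (fun D _ => pt D))).
rewrite big_split /= -!mulr_sumr big_split /=.
have sO j : \sum_D O j D <= 2 ^+ n * (2 * expR (- (n%:R * (c0 / 2)))).
  pose l : R := j%:R * ln 2 / 2.
  have l0 : 0 <= l by rewrite /l !mulr_ge0// ln_ge0// ler1n.
  pose b := expR (n%:R * (ln 2 - c0 / 2 - l - 2 ^- j)).
  have OE D : O j D <= b * (expR (l * mag D) + expR (- l * mag D)).
    have -> : O j D = b * expR (l * `|mag D|).
      by rewrite /O /b -expRD absu -/l; congr expR; move: (2 ^- j) => z; field; rewrite gt_eqF.
    rewrite ler_pM2l ?expR_gt0//; case: (ger0P (mag D)) => _.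
      by rewrite lerDl expR_ge0.
    by rewrite mulrN -mulNr lerDr expR_ge0.
  apply: (le_trans (ler_sum _ (fun D _ => OE D))).
  rewrite -mulr_sumr big_split /= !mag_mgf opprK [expR (- l) + _]addrC -mulr2n.
  (* As [l = j * ln 2 / 2], [expR (- l)] is [2 ^- j] times [expR l]; then
     [1 + 2 ^- j <= expR (2 ^- j)] produces the last term of [outer_rate]. *)
  have h : (expR l + expR (- l)) <= expR (l + 2 ^- j).
    have -> : expR l + expR (- l) = expR l * (1 + 2 ^- j).
      rewrite mulrDr mulr1; congr (_ + _).
      have -> : - l = l - j%:R * ln 2 by rewrite /l; field.
      by rewrite expRD expRN expRM_natl lnK ?posrE.
    by rewrite expRD ler_pM2l ?expR_gt0// expR_ge1Dx.
  have hX : (expR l + expR (- l)) ^+ n <= expR (n%:R * (l + 2 ^- j)).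
    by rewrite expRM_natl lerXn2r// ?nnegrE ?addr_ge0 ?expR_ge0.
  apply: (@le_trans _ _ (b * (2 * expR (n%:R * (l + 2 ^- j))))).
    by rewrite ler_pM2l ?expR_gt0// -[X in X <= _]mulr_natl ler_pM2l.
  rewrite mulrCA /b -expRD.
  have -> : n%:R * (ln 2 - c0 / 2 - l - 2 ^- j) + n%:R * (l + 2 ^- j) =
    n%:R * ln 2 + - (n%:R * (c0 / 2)) by ring.
  by rewrite expRD [expR (n%:R * ln 2)]expRM_natl lnK ?posrE// mulrCA.
have sG := mag_gauss n kc0 kc1; rewrite -/G in sG.
have e4 : 2 ^+ n * 2 ^+ n = 4 ^+ n :> R by rewrite -exprMn; congr (_ ^+ _); ring.
have ne : n%:R * expR (- (n%:R * (c0 / 2))) <= 2 / c0.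
  have := expR_ge1Dx (n%:R * (c0 / 2)) => e1.
  rewrite expRN ler_pdivrMr ?expR_gt0// mulrAC ler_pdivlMr//; lra.
apply: (@le_trans _ _ (4 ^+ n / n%:R * (2 / (1 - u0) * G + 8 / c0 + 1))); last first.
  rewrite /C [leRHS]mulrAC ler_wpM2r//.
    by rewrite !addr_ge0.
  by rewrite ler_pdivrMr//; lra.
apply: (@le_trans _ _ (2 / (1 - u0) * (2 ^+ n / n%:R) * (2 ^+ n * G) +
   2 ^+ n * (2 ^+ n * (2 * expR (- (n%:R * (c0 / 2)))) + 2 ^+ n * (2 * expR (- (n%:R * (c0 / 2))))))).
  apply: lerD; last by rewrite ler_wpM2l ?exprn_ge0// lerD.
  by rewrite ler_wpM2l// mulr_ge0// divr_ge0 ?exprn_ge0.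
have -> : 2 / (1 - u0) * (2 ^+ n / n%:R) * (2 ^+ n * G) = 4 ^+ n / n%:R * (2 / (1 - u0) * G).
  by rewrite -e4; field; rewrite gt_eqF//; lra.
have -> : 2 ^+ n * (2 ^+ n * (2 * expR (- (n%:R * (c0 / 2)))) +
   2 ^+ n * (2 * expR (- (n%:R * (c0 / 2))))) =
   4 ^+ n / n%:R * (4 * (n%:R * expR (- (n%:R * (c0 / 2))))).
  by rewrite -e4; field; rewrite gt_eqF.
rewrite -mulrDr ler_wpM2l ?divr_ge0 ?exprn_ge0//.
by rewrite -addrA lerD2l; lra.
Qed.

End Spins.

(** * Monochromatic random edges *)

Section TupleEdges.
Variable R : realType.
Variables n k : nat.
Local Notation config := {ffun 'I_n -> bool}.
(* Edges are modelled by [k]-tuples of vertices, repetitions allowed: this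
   makes the number of monochromatic edges an exact sum of powers. *)
Local Notation tedge := {ffun 'I_k -> 'I_n}.

Definition mono (s : config) (e : tedge) : bool :=
  [forall i, forall j, s (e i) == s (e j)].

Definition bichro (s : config) (e : tedge) : bool := ~~ mono s e.

Lemma forall_indicator_prod (P : pred 'I_n) (e : tedge) :
  ([forall i, P (e i)])%:R = \prod_i (P (e i))%:R :> R.
Proof.
case: forallP => [h|h]; first by rewrite big1// => i _; rewrite h.
have /existsP[i hi] : [exists i, ~~ P (e i)].
  by apply/existsP; apply: contrapT => h2; apply: h => i; apply: contraT => hi; case: h2; exists i.
by rewrite (bigD1 i)//= (negbTE hi) mul0r.
Qed.

Lemma card_tedge : #|{: tedge}|%:R = n%:R ^+ k :> R.
Proof. by rewrite card_ffun !card_ord natrX. Qed.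

Lemma avg_forall (P : pred 'I_n) :
  avg (fun e : tedge => ([forall i, P (e i)])%:R) = avg (fun v => (P v)%:R) ^+ k :> R.
Proof.
rewrite /avg card_tedge card_ord expr_div_n; congr (_ / _).
under eq_bigr do rewrite forall_indicator_prod.
by rewrite -(bigA_distr_bigA (fun (_ : 'I_k) v => (P v)%:R)) prodr_const card_ord.
Qed.

Hypothesis k_gt0 : (0 < k)%N.

Lemma mono_sum (s : config) e :
  (mono s e)%:R = \sum_b ([forall i, s (e i) == b])%:R :> R.
Proof.
pose i0 := Ordinal k_gt0.
have E b : [forall i, s (e i) == b] = mono s e && (s (e i0) == b).
  apply/forallP/andP => [h|[/forallP h /eqP <-] i]; last by have /forallP := h i; apply.
  split; last exact: h.
  by apply/forallP => i; apply/forallP => j; rewrite (eqP (h i)) (eqP (h j)).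
under eq_bigr do rewrite E.
by rewrite big_bool; case: (s (e i0)); rewrite /= ?andbT ?andbF ?addr0 ?add0r.
Qed.

Lemma mono_pair_sum (s t : config) e : (mono s e && mono t e)%:R =
  \sum_b \sum_c ([forall i, (s (e i) == b) && (t (e i) == c)])%:R :> R.
Proof.
rewrite -mulnb natrM !mono_sum big_distrlr /=.
apply: eq_bigr => b _; apply: eq_bigr => c _; rewrite -natrM mulnb.
congr (nat_of_bool _)%:R; apply/andP/forallP => [[/forallP h1 /forallP h2] i|h].
  by rewrite h1 h2.
by split; apply/forallP => i; have /andP[] := h i.
Qed.

Lemma eq_spin (a b : bool) : (a == b)%:R = (1 + spin R b * spin R a) / 2 :> R.
Proof. by case: a; case: b; rewrite /spin /=; lra. Qed.

Lemma avg_mono (s : config) : (0 < n)%N ->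
  avg (fun e => (mono s e)%:R) =
  ((1 + mag R s / n%:R) / 2) ^+ k + ((1 - mag R s / n%:R) / 2) ^+ k.
Proof.
move=> n0; have n1 : n%:R != 0 :> R by rewrite pnatr_eq0 -lt0n.
under avg_ext do rewrite mono_sum.
rewrite avg_sum big_bool /= !(avg_forall (fun v => s v == _)) addrC.
have h b : avg (fun v => (s v == b)%:R) = (1 + spin R b * (mag R s / n%:R)) / 2.
  under avg_ext do rewrite eq_spin mulrC.
  rewrite avgZ avgD avg_cst ?card_ord// avgZ /avg card_ord -/(mag R s); ring.
by rewrite !h /spin mul1r mulN1r.
Qed.

Lemma avg_cell (s t : config) b c : (0 < n)%N ->
  avg (fun v => ((s v == b) && (t v == c))%:R) =
  (1 + spin R b * (mag R s / n%:R) + spin R c * (mag R t / n%:R) +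
   spin R b * spin R c * overlap R s t) / 4.
Proof.
move=> n0; have n1 : n%:R != 0 :> R by rewrite pnatr_eq0 -lt0n.
rewrite (@avg_ext _ _ _ (fun v => 4^-1 * (1 + spin R b * spin R (s v) +
    spin R c * spin R (t v) + spin R b * spin R c * (spin R (s v) * spin R (t v))))); last first.
  by move=> v; rewrite -mulnb natrM !eq_spin; field.
rewrite avgZ !avgD avg_cst ?card_ord// !avgZ.
rewrite overlap_sum /avg card_ord -/(mag R s) -/(mag R t); ring.
Qed.

Lemma avg_mono2 (s t : config) : (0 < n)%N ->
  let ms := mag R s / n%:R in let mt := mag R t / n%:R in let u := overlap R s t in
  avg (fun e => (mono s e && mono t e)%:R) =
  ((1 + ms + mt + u) / 4) ^+ k + ((1 + ms - mt - u) / 4) ^+ k +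
  (((1 - ms + mt - u) / 4) ^+ k + ((1 - ms - mt + u) / 4) ^+ k).
Proof.
move=> n0 ms mt u.
under avg_ext do rewrite mono_pair_sum.
rewrite avg_sum.
under eq_bigr => b _ do rewrite avg_sum.
under eq_bigr => b _ do under eq_bigr => c _ do
  rewrite (avg_forall (fun v => (s v == b) && (t v == c))) avg_cell//.
rewrite !big_bool /= /spin addrC [X in X + _]addrC [X in _ + X]addrC.
by congr (_ ^+ _ + _ ^+ _ + (_ ^+ _ + _ ^+ _)); rewrite -/ms -/mt -/u; ring.
Qed.

Lemma avg_bichro (s : config) : (0 < n)%N ->
  avg (fun e => (bichro s e)%:R) = 1 - avg (fun e => (mono s e)%:R) :> R.
Proof.
move=> n0; have t0 : (0 < #|{: tedge}|)%N by rewrite card_ffun !card_ord expn_gt0 n0.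
rewrite -[X in X - _](@avg_cst R tedge) // -mulN1r -avgZ -avgD; apply: avg_ext => e.
by rewrite /bichro; case: (mono s e); rewrite /= ?mulr1 ?mulr0 ?subrr ?addr0.
Qed.

Lemma avg_bichro2 (s t : config) : (0 < n)%N ->
  avg (fun e => (bichro s e && bichro t e)%:R) =
  1 - avg (fun e => (mono s e)%:R) - avg (fun e => (mono t e)%:R) +
  avg (fun e => (mono s e && mono t e)%:R) :> R.
Proof.
move=> n0; have t0 : (0 < #|{: tedge}|)%N by rewrite card_ffun !card_ord expn_gt0 n0.
rewrite -[X in X - _ - _](@avg_cst R tedge) // -[X in _ + X - _ + _]mulN1r -[X in _ + X + _]mulN1r.
rewrite -!avgZ -!avgD; apply: avg_ext => e.
by rewrite /bichro; case: (mono s e); case: (mono t e); rewrite /=; ring.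
Qed.

End TupleEdges.

(** * Pair probabilities near balanced colourings *)

Section PairBounds.
Variable R : realType.

(** The sum is even in [b], so the correction is quadratic. For [b] of the order of the imbalance,
    [1 / sqrt n], it is of order [1 / n] per edge and harmless over linearly many edges. *)
Lemma sym_pow_bound k (w b : R) : 0 <= w - b -> 0 <= w + b -> w - b <= 1 -> w + b <= 1 ->
  2 * w ^+ k <= (w + b) ^+ k + (w - b) ^+ k <= 2 * w ^+ k + k%:R ^+ 2 * b ^+ 2.
Proof.
move=> h1 h2 h3 h4.
have w0 : 0 <= w by lra.
have w1 : w <= 1 by lra.
have diff i : 0 <= b * ((w + b) ^+ i - (w - b) ^+ i) <= 2 * i%:R * b ^+ 2.
  elim: i => [|i /andP[IH1 IH2]]; first by rewrite !expr0 subrr; lra.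
  have a0 : 0 <= (w + b) ^+ i + (w - b) ^+ i by rewrite addr_ge0// exprn_ge0.
  have a2 : (w + b) ^+ i + (w - b) ^+ i <= 2.
    have := exprn_ile1 i h2 h4; have := exprn_ile1 i h1 h3; lra.
  have -> : b * ((w + b) ^+ i.+1 - (w - b) ^+ i.+1) =
     w * (b * ((w + b) ^+ i - (w - b) ^+ i)) + b ^+ 2 * ((w + b) ^+ i + (w - b) ^+ i).
    by rewrite !exprS; ring.
  have b2 := sqr_ge0 b.
  rewrite -(natr1 i); apply/andP; split.
    by apply: addr_ge0; exact: mulr_ge0.
  have e1 := ler_wpM2r IH1 w1; have e2 := ler_wpM2l b2 a2; lra.
elim: k => [|k /andP[IH1 IH2]]; first by rewrite !expr0; lra.
have -> : (w + b) ^+ k.+1 + (w - b) ^+ k.+1 =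
   w * ((w + b) ^+ k + (w - b) ^+ k) + b * ((w + b) ^+ k - (w - b) ^+ k).
  by rewrite !exprS; ring.
have /andP[d1 d2] := diff k.
have e1 := ler_wpM2l w0 IH1; have e2 := ler_wpM2l w0 IH2.
have b2 : 0 <= k%:R ^+ 2 * b ^+ 2 by rewrite mulr_ge0 ?sqr_ge0.
have e3 := ler_wpM2r b2 w1; have b3 := sqr_ge0 b.
rewrite exprS -(natr1 k); apply/andP; split; lra.
Qed.

Lemma even_partN k (u : R) : even_part k (- u) = even_part k u.
Proof. by rewrite /even_part opprK addrC. Qed.

Lemma excess_norm k (u : R) : excess k `|u| = excess k u.
Proof. by case: (ger0P u) => // _; rewrite /excess even_partN. Qed.

Lemma excess1 k : (1 < k)%N -> excess k 1 = (2 ^+ k.-1 - 1)^-1 :> R.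
Proof.
move=> k1; have -> : (1 : R) = 1 - 2 * 0 by rewrite mulr0 subr0.
have K1 : 1 < 2 ^+ k.-1 :> R by rewrite exprn_egt1 ?ltr1n// -lt0n ltn_predRL.
rewrite excess_pow_sum ?(ltnW k1)// /pow_sum !(mulr0, subr0) expr1n expr0n.
rewrite gtn_eqF ?(ltnW k1)// addr0 mulr1; field; lra.
Qed.

Lemma exp2_pred_ge4 k : (3 <= k)%N -> 4 <= 2 ^+ k.-1 :> R.
Proof.
move=> k3; rewrite (_ : 4 = 2 ^+ 2); last by rewrite -natrX.
by rewrite ler_eXn2l ?ltr1n// ltn_predRL.
Qed.

Lemma excess_le_sqr k (u : R) : (3 <= k)%N -> `|u| <= 1 -> excess k u <= u ^+ 2.
Proof.
move=> k3 u1; rewrite -excess_norm.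
have := excess_mono k (normr_ge0 u) u1; rewrite expr1n mulr1 => h; apply: (le_trans h).
have K4 := exp2_pred_ge4 k3.
rewrite excess1 ?(ltnW k3)// (real_normK (num_real _)) ler_piMl ?sqr_ge0//.
by rewrite invf_le1; lra.
Qed.

Definition mono_density (k : nat) (m : R) : R := ((1 + m) / 2) ^+ k + ((1 - m) / 2) ^+ k.

Lemma mono_density_bounds k (m x : R) : (3 <= k)%N -> `|m| <= 1 -> m ^+ 2 <= 4 * x ->
  (2 ^+ k.-1)^-1 <= mono_density k m <= (2 ^+ k.-1)^-1 + k%:R ^+ 2 * x.
Proof.
move=> k3; rewrite ler_norml => /andP[m1 m2] mx.
have := @sym_pow_bound k 2^-1 (m / 2); rewrite /mono_density.
have -> : (1 + m) / 2 = 2^-1 + m / 2 by field.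
have -> : (1 - m) / 2 = 2^-1 - m / 2 by field.
have -> : 2 * 2^-1 ^+ k = (2 ^+ k.-1)^-1 :> R.
  rewrite -[in LHS](ltn_predK k3) exprS exprVn; field.
  by rewrite expf_neq0.
move=> /(_ _ _ _ _)/andP[]; [lra|lra|lra|lra|].
move=> h1 h2; rewrite h1 (le_trans h2)// lerD2l ler_wpM2l ?sqr_ge0//.
by rewrite expr_div_n; lra.
Qed.

(** For [m = 0] the left side is exactly [excess k u]. The error is three times [k ^ 2 * x], once
    from [S] and twice from [q0 ^+ 2 - q ^+ 2], divided by [q ^+ 2 >= 1 / 4]; hence 12. *)
Lemma pair_excess k (m u x : R) (p := mono_density k m)
  (S := ((1 + m + m + u) / 4) ^+ k + ((1 + m - m - u) / 4) ^+ k +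
        (((1 - m + m - u) / 4) ^+ k + ((1 - m - m + u) / 4) ^+ k)) :
  (3 <= k)%N -> `|m| <= 1 -> m ^+ 2 <= 4 * x -> k%:R ^+ 2 * x <= 4^-1 ->
  `|u| <= 1 -> 0 <= 1 + m + m + u -> 0 <= 1 - m - m + u ->
  1 + m + m + u <= 4 -> 1 - m - m + u <= 4 ->
  (1 - p - p + S) / (1 - p) ^+ 2 - 1 <= excess k u + 12 * (k%:R ^+ 2 * x).
Proof.
move=> k3 m1 mx kx u1 c1 c2 c3 c4.
have /andP[p1 p2] := mono_density_bounds k3 m1 mx; rewrite -/p in p1 p2.
have K4 := exp2_pred_ge4 k3; set K := 2 ^+ k.-1 in K4 p1 p2.
have K0 : 0 < K by lra.
pose X := k%:R ^+ 2 * x; rewrite -/X in p2 kx *.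
pose p0 := K^-1; rewrite -/p0 in p1 p2.
have p00 : 0 < p0 by rewrite invr_gt0.
have p04 : p0 <= 4^-1 by rewrite lef_pV2 ?posrE.
pose q := 1 - p; pose q0 := 1 - p0.
have q12 : 2^-1 <= q by rewrite /q; lra.
have u01 : excess k u <= 1.
  apply: (le_trans (excess_le_sqr k3 u1)).
  by rewrite -(real_normK (num_real _)) expr_le1.
have u00 : 0 <= excess k u by rewrite -excess_norm excess_ge0.
have SX : S - p0 ^+ 2 <= excess k u * q0 ^+ 2 + X.
  have -> : excess k u * q0 ^+ 2 = p0 ^+ 2 * (even_part k u - 1).
    rewrite /excess -/K /q0 /p0; field; apply/andP; split; lra.
  have := @sym_pow_bound k ((1 + u) / 4) (m / 2).
  have -> : (1 + u) / 4 + m / 2 = (1 + m + m + u) / 4 by field.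
  have -> : (1 + u) / 4 - m / 2 = (1 - m - m + u) / 4 by field.
  move=> /(_ _ _ _ _)/andP[]; [lra|lra|lra|lra|].
  move=> _ h.
  have mX : k%:R ^+ 2 * (m / 2) ^+ 2 <= X.
    by rewrite /X ler_wpM2l ?sqr_ge0// expr_div_n; lra.
  have e4 : 2 * ((1 + u) / 4) ^+ k + 2 * ((1 - u) / 4) ^+ k = p0 ^+ 2 * even_part k u.
    rewrite /even_part /p0 !expr_div_n (_ : (4 : R) ^+ k = 4 * K ^+ 2).
      by field; lra.
    rewrite -[in LHS](ltn_predK k3) exprS /K -exprM mulnC exprM.
    by rewrite (_ : 2 ^+ 2 = 4 :> R)// -natrX.
  have -> : S = ((1 + m + m + u) / 4) ^+ k + ((1 - m - m + u) / 4) ^+ k + 2 * ((1 - u) / 4) ^+ k.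
    have aux (a b c : R) : a + b + (b + c) = a + c + 2 * b by ring.
    have e5 : 1 + m - m - u = 1 - u by ring.
    have e6 : 1 - m + m - u = 1 - u by ring.
    by rewrite /S e5 e6; exact: aux.
  move: h mX e4; clear; set a := _ ^+ k + _; set b := _ ^+ k; set c := _ ^+ k.
  by move: a b c X (p0 ^+ 2) (even_part k u) (_ * (m / 2) ^+ 2) => *; lra.
have q2 : 0 < q ^+ 2 by rewrite exprn_gt0//; lra.
have -> : (1 - p - p + S) / (1 - p) ^+ 2 - 1 = (S - p ^+ 2) / q ^+ 2.
  by rewrite -/q (_ : p = 1 - q) ?/q; [field; rewrite gt_eqF//; lra|ring].
rewrite ler_pdivrMr//.
have pp : p0 ^+ 2 <= p ^+ 2 by rewrite lerXn2r// nnegrE; lra.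
have qq : q0 ^+ 2 - q ^+ 2 <= 2 * X by rewrite /q0 /q in q12 *; nra.
have qq4 : 4^-1 <= q ^+ 2 by nra.
have e1 := ler_wpM2l u00 qq.
have X0 : 0 <= X by lra.
have e2 := ler_wpM2r X0 u01; have e3 := ler_wpM2l X0 qq4.
lra.
Qed.

End PairBounds.

(** * Triangles of correlated vertices and large drops *)

Section Triangles.
Variable R : realType.

(** Distinct coordinates of a uniform tuple are independent; [P] counts the ways to fill the other
    coordinates. *)
Lemma avg_three k n (i0 i1 i2 : 'I_k) (F : 'I_n -> 'I_n -> 'I_n -> R) :
  i1 != i0 -> i2 != i0 -> i2 != i1 -> (0 < n)%N ->
  avg (fun e : {ffun 'I_k -> 'I_n} => F (e i0) (e i1) (e i2)) =
  avg (fun x => avg (fun y => avg (F x y))).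
Proof.
move=> i10 i20 i21 n0.
have nR : 0 < n%:R :> R by rewrite ltr0n.
pose P : R := \prod_(i | [&& i != i0, i != i1 & i != i2]) n%:R.
have P0 : 0 < P by rewrite prodr_gt0.
have split3 (G : 'I_k -> R) : \prod_i G i =
    G i0 * (G i1 * (G i2 * \prod_(i | [&& i != i0, i != i1 & i != i2]) G i)).
  rewrite (bigD1 i0)//= (bigD1 i1)//= (bigD1 i2)/=; last by rewrite i20 i21.
  by congr (_ * (_ * (_ * _))); apply: eq_bigl => i; rewrite -andbA.
have nk : n%:R ^+ k = n%:R * (n%:R * (n%:R * P)).
  by rewrite -(split3 (fun=> n%:R)) prodr_const card_ord.
have cnt x y z : \sum_(e : {ffun 'I_k -> 'I_n}) ((e i0 == x) && ((e i1 == y) && (e i2 == z)))%:R = P.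
  pose G i v : R := (if i == i0 then v == x else if i == i1 then v == y else
                if i == i2 then v == z else true)%:R.
  transitivity (\prod_i \sum_v G i v).
    rewrite bigA_distr_bigA; apply: eq_bigr => e _; rewrite split3 /G !eqxx.
    rewrite (negbTE i10) (negbTE i20) (negbTE i21) -mulnb natrM -mulnb natrM.
    rewrite big1 ?mulr1// => i /and3P[h0 h1 h2].
    by rewrite (negbTE h0) (negbTE h1) (negbTE h2).
  have one (w : 'I_n) : \sum_v ((v == w)%:R : R) = 1.
    by rewrite (bigD1 w)//= eqxx big1 ?addr0// => v /negbTE ->.
  rewrite split3 /G !eqxx (negbTE i10) (negbTE i20) (negbTE i21) !one !mul1r.
  apply: eq_bigr => i /and3P[h0 h1 h2].
  rewrite (negbTE h0) (negbTE h1) (negbTE h2).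
  by rewrite sumr_const card_ord.
rewrite /avg card_tedge card_ord.
have -> : \sum_(e : {ffun 'I_k -> 'I_n}) F (e i0) (e i1) (e i2) =
   \sum_x \sum_y \sum_z F x y z * P.
  transitivity (\sum_(e : {ffun 'I_k -> 'I_n}) \sum_x \sum_y \sum_z
     F x y z * ((e i0 == x) && ((e i1 == y) && (e i2 == z)))%:R).
    apply: eq_bigr => e _; rewrite (bigD1 (e i0))//= (bigD1 (e i1))//= (bigD1 (e i2))//=.
    rewrite !eqxx mulr1 !big1 ?addr0// => [x|y|z]; rewrite eq_sym => /negbTE h.
    - by rewrite big1// => y _; rewrite big1// => z _; rewrite h mulr0.
    - by rewrite big1// => z _; rewrite h mulr0.
    - by rewrite h mulr0.
  rewrite exchange_big; apply: eq_bigr => x _; rewrite exchange_big; apply: eq_bigr => y _.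
  by rewrite exchange_big; apply: eq_bigr => z _; rewrite -mulr_sumr cnt.
rewrite nk.
under eq_bigr do under eq_bigr do rewrite -mulr_suml.
under eq_bigr do rewrite -mulr_suml.
rewrite -mulr_suml.
under [in RHS]eq_bigr do rewrite -mulr_suml.
rewrite -!mulr_suml; field.
by rewrite !gt_eqF.
Qed.

(* Split according to whether the first vertex has degree above [theta * n]. *)
Lemma triangle_density n (B : rel 'I_n) (theta : R)
  (b := avg (fun x => avg (fun y => (B x y)%:R)) : R) : (0 < n)%N -> 0 < theta ->
  avg (fun x => avg (fun y => avg (fun z => (B x y && (B x z && B y z))%:R))) <=
  theta * b + theta^-1 * b ^+ 2.
Proof.
move=> n0 th0; pose d x : R := avg (fun y => (B x y)%:R).
have c0 : (0 < #|'I_n|)%N by rewrite card_ord.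
have d0 x : 0 <= d x by apply: avg_ge0 => y; rewrite ler0n.
have pt x : avg (fun y => avg (fun z => (B x y && (B x z && B y z))%:R)) <=
    theta * d x + theta^-1 * b * d x.
  have [dx|dx] := leP (d x) theta.
    apply: (@le_trans _ _ (d x * d x)).
      rewrite {1}/d mulrC -avgZ; apply: avg_le => y; rewrite mulrC /d -avgZ; apply: avg_le => z.
      by rewrite -natrM mulnb ler_nat; case: (B x y); case: (B x z) => //=; case: (B y z).
    have b0 : 0 <= b by apply: avg_ge0.
    apply: (@le_trans _ _ (theta * d x)); first by rewrite ler_wpM2r.
    rewrite lerDl; apply: mulr_ge0 => //; apply: mulr_ge0 => //.
    by rewrite invr_ge0 ltW.
  apply: (@le_trans _ _ b).
    apply: avg_le => y; apply: avg_le => z.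
    by rewrite ler_nat; case: (B x y); case: (B x z) => //=; case: (B y z).
  have b0 : 0 <= b by apply: avg_ge0.
  apply: (@le_trans _ _ (theta^-1 * b * d x)).
    by rewrite mulrAC -[leLHS]mul1r ler_wpM2r// ler_pdivlMl// mulr1 ltW.
  by rewrite lerDr; apply: mulr_ge0 => //; rewrite ltW.
apply: (le_trans (avg_le pt)).
rewrite avgD !avgZ (_ : avg (fun x => d x) = b)//.
by rewrite -[_ * b * b]mulrA.
Qed.

Section Drop.
Variables n k : nat.
Local Notation config := {ffun 'I_n -> bool}.
Local Notation tedge := {ffun 'I_k -> 'I_n}.
Variables (B : {set config}) (q : R) (h : seq tedge).
Hypotheses (k3 : (3 <= k)%N) (n0 : (0 < n)%N).
Hypotheses (q_gt0 : 0 < q) (q_le1 : q <= 1) (B0 : (0 < #|B|)%N).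
Hypothesis X0 : 0 < nsol R B (@bichro n k) h.

Let sol (s : config) : R := (all (bichro s) h)%:R.
Let corr (x y : 'I_n) : R :=
  (\sum_(s in B) sol s * (spin R (s x) * spin R (s y))) / nsol R B (@bichro n k) h.
Let close : rel 'I_n := fun x y => 2^-1 <= corr x y.

(** Squaring an average over solutions introduces a second replica; the sums over [x] and over [y]
    then each produce one factor [overlap]. *)
Lemma avg_corr_sqr :
  avg (fun x => avg (fun y => corr x y ^+ 2)) =
  replica B (@bichro n k) h (fun s t => overlap R s t ^+ 2).
Proof.
have n1 : n%:R != 0 :> R by rewrite pnatr_eq0 -lt0n.
have XX : nsol R B (@bichro n k) h != 0 by rewrite gt_eqF.
rewrite /replica /pair_sum /avg !card_ord.
transitivity ((\sum_x \sum_y \sum_(s in B) \sum_(t in B) sol s * sol t *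
   (spin R (s x) * spin R (t x) * (spin R (s y) * spin R (t y)))) /
   (n%:R ^+ 2 * nsol R B (@bichro n k) h ^+ 2)).
  rewrite -mulr_suml -mulrA -invfM -expr2 !mulr_suml; apply: eq_bigr => x _.
  rewrite mulr_suml [RHS]mulr_suml; apply: eq_bigr => y _.
  rewrite /corr expr_div_n -mulrA -invfM [_ ^+ 2 * n%:R ^+ 2]mulrC; congr (_ / _).
  rewrite expr2 big_distrlr; apply: eq_bigr => s _; apply: eq_bigr => t _.
  by rewrite /=; ring.
rewrite invfM mulrA; congr (_ / _).
rewrite mulr_suml.
under eq_bigr do rewrite exchange_big /=.
rewrite -mulr_suml exchange_big /= mulr_suml; apply: eq_bigr => s _.
under eq_bigr do rewrite exchange_big /=.
rewrite exchange_big /= mulr_suml; apply: eq_bigr => t _.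
rewrite overlap_sum /sol -natrM mulnb.
under eq_bigr do rewrite -mulr_sumr -mulr_sumr.
rewrite -mulr_sumr -mulr_suml; field.
by [].
Qed.

Lemma close_density : avg (fun x => avg (fun y => (close x y)%:R)) <=
  4 * replica B (@bichro n k) h (fun s t => overlap R s t ^+ 2).
Proof.
rewrite -avg_corr_sqr -avgZ; apply: avg_le => x; rewrite -avgZ; apply: avg_le => y.
rewrite /close; have [hc|_] /= := leP 2^-1 (corr x y); last by rewrite mulr_ge0// sqr_ge0.
have : 2^-1 ^+ 2 <= corr x y ^+ 2 by rewrite lerXn2r// nnegrE; lra.
lra.
Qed.

(* A drop forces all pairs of vertices of the new edge to be strongly
   correlated; since [k >= 3] the edge then contains a triangle of [close]. *)
Lemma drop_close (e : tedge) i j :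
  ratio B (@bichro n k) q (e :: h) < ratio B (@bichro n k) q h / 4 -> close (e i) (e j).
Proof.
have d0 : 0 < #|B|%:R * q ^+ size h by rewrite mulr_gt0 ?exprn_gt0// ltr0n.
have d1 : 0 < #|B|%:R * q ^+ (size h).+1 by rewrite mulr_gt0 ?exprn_gt0// ltr0n.
rewrite /ratio /= ltr_pdivrMr// => hr.
have {}hr : nsol R B (@bichro n k) (e :: h) < nsol R B (@bichro n k) h / 4.
  apply: (lt_le_trans hr).
  set X := nsol R B _ h; set b : R := #|B|%:R.
  have b0 : b != 0 by rewrite pnatr_eq0 -lt0n.
  have -> : X / (b * q ^+ size h) / 4 * (b * q ^+ (size h).+1) = q * (X / 4).
    by rewrite exprS; field; rewrite b0 expf_neq0// gt_eqF.
  by rewrite ler_piMl// divr_ge0// ltW.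
rewrite /close /corr ler_pdivlMr//.
(* The spin product is 1 if [e] is monochromatic and at least -1 otherwise. Fewer than a quarter of
   the solutions survive [e], so the correlation is at least [1 - 2 / 4], the threshold in
   [close]. *)
have : \sum_(s in B) sol s * (1 - 2 * (bichro s e)%:R) <=
    \sum_(s in B) sol s * (spin R (s (e i)) * spin R (s (e j))).
  apply: ler_sum => s _; rewrite ler_wpM2l ?ler0n//.
  rewrite /bichro; case: (boolP (mono s e)) => [/forallP /(_ i)/forallP /(_ j) /eqP ->|_] /=.
    by rewrite spin_sqr; lra.
  by rewrite /spin; case: (s (e i)); case: (s (e j)); lra.
apply: le_trans.
rewrite (eq_bigr (fun s => sol s + - 2 * (all (bichro s) (e :: h))%:R)); last first.
  by move=> s _; rewrite /sol /= -mulnb natrM; ring.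
by rewrite big_split /= -mulr_sumr; move: hr; rewrite /nsol /sol /=; lra.
Qed.

Lemma avg_drop_le (theta : R)
  (b := 4 / n%:R * replica B (@bichro n k) h (fun s t => n%:R * overlap R s t ^+ 2)) :
  0 < theta ->
  avg (fun e => (ratio B (@bichro n k) q (e :: h) < ratio B (@bichro n k) q h / 4)%R%:R) <=
  theta * b + theta^-1 * b ^+ 2.
Proof.
move=> th0.
have nR : 0 < n%:R :> R by rewrite ltr0n.
have bE : b = 4 * replica B (@bichro n k) h (fun s t => overlap R s t ^+ 2).
  by rewrite /b replicaZ mulrA divfK// gt_eqF.
have k0 : (0 < k)%N by exact: leq_trans k3.
have k1 : (1 < k)%N by exact: leq_trans k3.
pose i0 := Ordinal k0; pose i1 := Ordinal k1; pose i2 := Ordinal k3.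
pose T x y z : R := (close x y && (close x z && close y z))%:R.
apply: (@le_trans _ _ (avg (fun e : tedge => T (e i0) (e i1) (e i2)))).
  apply: avg_le => e; case: (boolP (_ < _)) => [he|_]; last by rewrite ler0n.
  by rewrite /T !(drop_close _ _ he).
rewrite (@avg_three k n i0 i1 i2)//.
pose b' : R := avg (fun x => avg (fun y => (close x y)%:R)).
apply: (@le_trans _ _ (theta * b' + theta^-1 * b' ^+ 2)).
  exact: triangle_density.
have b'0 : 0 <= b' by apply: avg_ge0 => x; apply: avg_ge0.
have bb : b' <= b by rewrite bE; exact: close_density.
apply: lerD; first by rewrite ler_pM2l.
apply: ler_wpM2l; first by rewrite invr_ge0 ltW.
by apply: lerXn2r => //; rewrite nnegrE//; exact: le_trans bb.
Qed.

End Drop.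
End Triangles.

(** * Lower tail of the number of colourings *)

Section ClassTail.
Variable R : realType.

Definition class_mag (n A : nat) : R := (2 * A%:R - n%:R) / n%:R.

Definition class_rate (k n A : nat) : R := 1 - mono_density k (class_mag n A).

Lemma overlap_le1 n (s t : {ffun 'I_n -> bool}) : `|overlap R s t| <= 1.
Proof.
case: n s t => [|n] s t; first by rewrite /overlap invr0 mulr0 normr0.
by rewrite /overlap normrM normfV normr_nat ler_pdivrMr ?ltr0n// mul1r mag_abs.
Qed.

Lemma mag_class n A (s : {ffun 'I_n -> bool}) :
  s \in colour_class n A -> mag R s / n%:R = class_mag n A.
Proof. by rewrite inE => /eqP sA; rewrite mag_zeros sA. Qed.

Section Fixed.
Variables n k A : nat.
Hypotheses (k3 : (3 <= k)%N) (n0 : (0 < n)%N).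
Hypothesis window : (2 * A%:R - n%:R) ^+ 2 <= 4 * n%:R :> R.
Hypothesis n_large : k%:R ^+ 2 / n%:R <= 4^-1 :> R.
Local Notation B := (colour_class n A).
Hypothesis B0 : (0 < #|B|)%N.

Let nR : 0 < n%:R :> R. Proof. by rewrite ltr0n. Qed.

Lemma class_mag_le1 : `|class_mag n A| <= 1.
Proof.
have /card_gt0P[s sB] := B0.
by rewrite -(mag_class sB) normrM normfV normr_nat ler_pdivrMr// mul1r mag_abs.
Qed.

Lemma class_mag_sqr : class_mag n A ^+ 2 <= 4 * n%:R^-1.
Proof.
rewrite /class_mag expr_div_n ler_pdivrMr ?exprn_gt0// expr2 -mulrA mulKf ?gt_eqF//.
Qed.

Lemma class_rate_bounds : 2^-1 <= class_rate k n A /\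
  1 - (2 ^+ k.-1)^-1 - k%:R ^+ 2 / n%:R <= class_rate k n A <= 1 - (2 ^+ k.-1)^-1.
Proof.
have /andP[p1 p2] := mono_density_bounds k3 class_mag_le1 class_mag_sqr.
have K4 := exp2_pred_ge4 R k3.
have p04 : (2 ^+ k.-1)^-1 <= 4^-1 :> R by rewrite lef_pV2 ?posrE ?exprn_gt0.
pose p0 : R := (2 ^+ k.-1)^-1; rewrite -/p0 in p1 p2 p04 *.
pose X : R := k%:R ^+ 2 / n%:R; rewrite -/X in p2 *.
have X4 : X <= 4^-1 by exact: n_large.
by rewrite /class_rate; split; [lra|apply/andP; split; lra].
Qed.

Lemma avg_bichro_class s : s \in B ->
  avg (fun e => (@bichro n k s e)%:R) = class_rate k n A.
Proof.
have k0 : (0 < k)%N by exact: leq_trans k3.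
by move=> sB; rewrite avg_bichro// avg_mono// (mag_class sB).
Qed.

Lemma pair2_class s t : s \in B -> t \in B ->
  pair2 R (@bichro n k) s t / class_rate k n A ^+ 2 - 1 <=
  excess k (overlap R s t) + 12 * (k%:R ^+ 2 / n%:R).
Proof.
have k0 : (0 < k)%N by exact: leq_trans k3.
move=> sB tB; rewrite /pair2 avg_bichro2// !avg_mono// avg_mono2//.
rewrite (mag_class sB) (mag_class tB).
have cell b c : 0 <= 1 + spin R b * class_mag n A + spin R c * class_mag n A +
    spin R b * spin R c * overlap R s t <= 4.
  have := avg_cell R s t b c n0; rewrite (mag_class sB) (mag_class tB) => e.
  have h1 : 0 <= avg (fun v => ((s v == b) && (t v == c))%:R) :> R.
    by apply: avg_ge0.
  have h2 : avg (fun v => ((s v == b) && (t v == c))%:R) <= 1 :> R.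
    rewrite -[leRHS](@avg_cst R 'I_n 1) ?card_ord//; apply: avg_le => v.
    by rewrite lern1 leq_b1.
  by rewrite e in h1 h2; apply/andP; split; lra.
have /andP[a1 a2] := cell false false; have /andP[a3 a4] := cell true true.
rewrite /spin in a1 a2 a3 a4.
apply: pair_excess => //.
- exact: class_mag_le1.
- exact: class_mag_sqr.
- exact: overlap_le1.
- lra.
- lra.
- lra.
- lra.
Qed.

End Fixed.

(** In [ratio_tail], divided by [loglog d], the terms of the expansion are beaten by making
    [loglog d] large, the drop term linear in [theta] by a small [theta], the one with [theta^-1] by
    a large [n]; each receives [eps / 3]. *)
Lemma class_ratio_tail k (r : R) : (3 <= k)%N -> 0 <= r -> rate_bound k r ->
  forall eps : R, 0 < eps -> exists d : R, 0 < d /\ exists N : nat,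
  forall n A m : nat, (N <= n)%N ->
    (2 * A%:R - n%:R) ^+ 2 <= 4 * n%:R :> R ->
    (4 : R) ^+ n <= 64 * n%:R * #|colour_class n A|%:R ^+ 2 ->
    m%:R <= r * n%:R + 1 ->
    expect m (fun h =>
      (ratio (colour_class n A) (@bichro n k) (class_rate k n A) h < d)%R%:R) <= eps.
Proof.
move=> k3 r0 rb eps eps0; have [c [C [c0 C0 hov]]] := overlap_moment r0 rb.
pose K2 : R := k%:R ^+ 2.
have K21 : 1 <= K2 by rewrite /K2 expr_ge1// ler1n; exact: leq_trans k3.
pose C1 := 12 * K2.
(* The 1 covers the [+ 1] in the bound on [m], as the excess is at most 1; [(r + 1) * C1] covers the
   relative error [12 * k ^ 2 / n] over all edges. *)
pose C2 := expR (1 + (r + 1) * C1) * C.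
have C10 : 0 < C1 by rewrite /C1; lra.
have C20 : 0 < C2 by rewrite mulr_gt0 ?expR_gt0.
pose DD := loglog 1 + (r + 1) * (4 * (C1 * (2 / c + 1)) + 4 * (C1 / c) * C2).
have r1 : 0 < r + 1 by lra.
have DD0 : 0 < DD.
  have h1 : 0 < C1 * (2 / c + 1) by rewrite mulr_gt0// addr_gt0// divr_gt0.
  have h2 : 0 < 4 * (C1 / c) * C2 by rewrite mulr_gt0// mulr_gt0// divr_gt0.
  by rewrite /DD ltr_wpDl ?loglog_ge0// mulr_gt0// addr_gt0// mulr_gt0.
pose M := 3 * DD / eps.
have M0 : 0 < M by rewrite divr_gt0// mulr_gt0.
(* Inverts [loglog] up to the added ones, so that [loglog d >= M]. *)
pose d := expR (- expR M).
have d0 : 0 < d by exact: expR_gt0.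
have d1 : d <= 1 by rewrite expR_le1 oppr_le0 expR_ge0.
have Md : M <= loglog d.
  rewrite /loglog /d expRN invrK -{1}(expRK M) ler_ln ?posrE ?expR_gt0//; last first.
    by rewrite addr_gt0// ln_gt0// ltrDl expR_gt0.
  rewrite -{1}(expRK (expR M)) ler_wpDl// ler_ln ?posrE ?addr_gt0 ?expR_gt0//.
  by rewrite lerDr.
pose a1 := 4 / c / d ^+ 2; pose a2 := 32 / c ^+ 2 / d ^+ 2.
have a10 : 0 < a1 by rewrite !divr_gt0 ?exprn_gt0.
have a20 : 0 < a2 by rewrite !divr_gt0 ?exprn_gt0.
pose th := eps / (3 * ((r + 1) * C2 * a1)).
have th0 : 0 < th by rewrite divr_gt0// mulr_gt0// mulr_gt0// mulr_gt0.
pose n1 := 3 * ((r + 1) * C2 * a2) / th / eps.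
exists d; split=> //; exists (Num.truncn (4 * K2 + `|n1|)).+1 => n A m nN win hB hm.
have nbig : 4 * K2 + `|n1| < n%:R.
  by apply: lt_le_trans (truncnS_gt _) _; rewrite ler_nat.
have nK : 4 * K2 < n%:R by apply: le_lt_trans nbig; rewrite lerDl.
have nn1 : n1 <= n%:R.
  by apply: le_trans (ler_norm _) _; apply/ltW/(le_lt_trans _ nbig); rewrite lerDr; lra.
have nR : 0 < n%:R :> R by lra.
have n0 : (0 < n)%N by rewrite -(ltr0n R).
have n_ge1 : 1 <= n%:R :> R by rewrite ler1n.
have n_large : k%:R ^+ 2 / n%:R <= 4^-1 :> R by rewrite -/K2 ler_pdivrMr//; lra.
set B := colour_class n A in hB *.
have B0 : (0 < #|B|)%N.
  rewrite lt0n; apply/eqP => b0; move: hB; rewrite b0 expr0n mulr0 leNgt.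
  by rewrite exprn_gt0.
have BR : 0 < #|B|%:R :> R by rewrite ltr0n.
have [q12 /andP[_ q1]] := class_rate_bounds k3 n0 win n_large B0.
have q0 : 0 < class_rate k n A by lra.
have q_le1 : class_rate k n A <= 1.
  by apply: (le_trans q1); rewrite lerBlDr lerDl invr_ge0 exprn_ge0.
have E0 : (0 < #|{: {ffun 'I_k -> 'I_n}}|)%N by rewrite card_ffun !card_ord expn_gt0 n0.
pose w (s t : {ffun 'I_n -> bool}) : R := n%:R * overlap R s t ^+ 2.
have w0 s t : 0 <= w s t by rewrite mulr_ge0 ?sqr_ge0.
have mn : m%:R / n%:R <= r + 1 by rewrite ler_pdivrMr//; nra.
have pairs s t : s \in B -> t \in B ->
    pair2 R (@bichro n k) s t / class_rate k n A ^+ 2 - 1 <= C1 / n%:R * (w s t + 1).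
  move=> sB tB; apply: (le_trans (pair2_class k3 n0 win n_large B0 sB tB)).
  have := excess_le_sqr k3 (overlap_le1 s t) => h.
  have -> : C1 / n%:R * (w s t + 1) = C1 * overlap R s t ^+ 2 + C1 / n%:R.
    by rewrite /w; field; rewrite gt_eqF.
  rewrite mulrA; apply: lerD => //; apply: (le_trans h).
  by rewrite ler_peMl ?sqr_ge0// /C1; lra.
have moments t : (t <= m)%N ->
    #|B|%:R ^- 2 * \sum_(s in B) \sum_(u in B) expR (c * w s u) *
      (pair2 R (@bichro n k) s u / class_rate k n A ^+ 2) ^+ t <= C2.
  move=> tm; rewrite mulrC ler_pdivrMr ?exprn_gt0//.
  rewrite /C2 -mulrA; apply: le_trans (ler_wpM2l (expR_ge0 _) (hov n A n0 hB)).
  rewrite mulr_sumr; apply: ler_sum => s sB; rewrite mulr_sumr; apply: ler_sum => u uB.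
  have pe := pair2_class k3 n0 win n_large B0 sB uB.
  have p0 : 0 <= pair2 R (@bichro n k) s u / class_rate k n A ^+ 2.
    by rewrite divr_ge0 ?sqr_ge0// avg_ge0.
  set ex := excess k (overlap R s u) in pe.
  have ex0 : 0 <= ex by rewrite /ex -excess_norm excess_ge0.
  have ex1 : ex <= 1.
    apply: (le_trans (excess_le_sqr k3 (overlap_le1 s u))).
    by rewrite -(real_normK (num_real _)) expr_le1// overlap_le1.
  have pE : pair2 R (@bichro n k) s u / class_rate k n A ^+ 2 <= expR (ex + 12 * (k%:R ^+ 2 / n%:R)).
    by apply: le_trans (expR_ge1Dx _); lra.
  apply: (@le_trans _ _ (expR (c * w s u) * expR (t%:R * (ex + 12 * (k%:R ^+ 2 / n%:R))))).
    rewrite ler_pM2l ?expR_gt0// expRM_natl lerXn2r// nnegrE ?expR_ge0//.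
  rewrite -!expRD ler_expR excess_norm -/ex.
  have tR : t%:R <= r * n%:R + 1 by apply: le_trans hm; rewrite ler_nat.
  have e1 : t%:R * ex <= r * n%:R * ex + 1.
    by apply: (le_trans (ler_wpM2r ex0 tR)); lra.
  have e2 : t%:R * (12 * (k%:R ^+ 2 / n%:R)) <= (r + 1) * C1.
    have -> : t%:R * (12 * (k%:R ^+ 2 / n%:R)) = t%:R / n%:R * C1 by rewrite /C1 /K2; ring.
    rewrite ler_wpM2r ?(ltW C10)//; apply: le_trans mn.
    by rewrite ler_wpM2r ?invr_ge0 ?(ltW nR)// ler_nat.
  by rewrite /w; lra.
have drops h : 0 < nsol R B (@bichro n k) h ->
    avg (fun e => (ratio B (@bichro n k) (class_rate k n A) (e :: h) <
                   ratio B (@bichro n k) (class_rate k n A) h / 4)%R%:R) <=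
    th * (4 / n%:R * replica B (@bichro n k) h w) +
    th^-1 * (4 / n%:R * replica B (@bichro n k) h w) ^+ 2.
  by move=> X0; exact: avg_drop_le.
have := ratio_tail E0 q0 B0 (fun s sB => avg_bichro_class k3 n0 sB) c0 (ltW C10) nR d0 d1 th0
   w0 pairs moments drops.
set E := expect m _ => hE.
have phi0 : 0 < loglog d by exact: lt_le_trans Md.
rewrite -(ler_pM2l phi0); apply: (le_trans hE).
set x := m%:R / n%:R in mn.
have x0 : 0 <= x by rewrite /x divr_ge0.
have -> : m%:R * (4 * (C1 / n%:R * (2 / c + 1)) + (4 * (C1 / n%:R / c) + loglog d *
   (th * (4 / n%:R / c / d ^+ 2) + th^-1 * (32 / n%:R ^+ 2 / c ^+ 2 / d ^+ 2))) * C2) =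
   x * (4 * (C1 * (2 / c + 1)) + 4 * (C1 / c) * C2) +
   loglog d * (x * (C2 * a1 * th + C2 * a2 / th / n%:R)).
  by rewrite /x /a1 /a2; field; rewrite !gt_eqF.
rewrite addrA; set Y := 4 * (C1 * _) + _.
have Y0 : 0 <= Y.
  have y1 : 0 <= 2 / c + 1 by rewrite addr_ge0// divr_ge0// ltW.
  have y2 : 0 <= C1 / c by rewrite divr_ge0// ltW.
  have y3 := mulr_ge0 (ltW C10) y1; have y4 := mulr_ge0 y2 (ltW C20).
  by rewrite /Y -(mulrA 4) addr_ge0// mulr_ge0.
have s1 : loglog 1 + x * Y <= loglog d * (eps / 3).
  apply: (@le_trans _ _ DD); first by rewrite /DD lerD2l ler_wpM2r.
  apply: (@le_trans _ _ (M * (eps / 3))).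
    by rewrite /M; have -> : 3 * DD / eps * (eps / 3) = DD by field; rewrite gt_eqF.
  by rewrite ler_wpM2r// divr_ge0// ltW.
have s2 : x * (C2 * a1 * th + C2 * a2 / th / n%:R) <= eps / 3 + eps / 3.
  have W0 : 0 <= C2 * a1 * th + C2 * a2 / th / n%:R.
    have z1 : 0 < C2 * a1 * th by apply: mulr_gt0 => //; exact: mulr_gt0.
    have z2 : 0 < C2 * a2 / th / n%:R by apply: divr_gt0 => //; apply: divr_gt0 => //; exact: mulr_gt0.
    exact: ltW (addr_gt0 z1 z2).
  apply: (le_trans (ler_wpM2r W0 mn)); rewrite mulrDr; apply: lerD.
    by rewrite /th le_eqVlt; apply/orP; left; apply/eqP; field; rewrite !gt_eqF.
  have -> : (r + 1) * (C2 * a2 / th / n%:R) = (n1 * (eps / 3)) / n%:R.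
    by rewrite /n1; field; rewrite !gt_eqF.
  by rewrite ler_pdivrMr// mulrC ler_wpM2l// divr_ge0// ltW.
have s3 := ler_wpM2l (ltW phi0) s2.
by apply: (le_trans (lerD s1 s3)); rewrite -mulrDr (_ : eps / 3 + (eps / 3 + eps / 3) = eps)//; field.
Qed.

End ClassTail.

(** * All colour classes together *)

Section AllTail.
Variable R : realType.

Lemma card_ord_interval N (S : {set 'I_N}) (l : R) :
  (forall a b, a \in S -> b \in S -> b%:R - a%:R <= l) -> 0 <= l -> #|S|%:R <= l + 1.
Proof.
move=> hS l0; have [->|[x xS]] := set_0Vmem S; first by rewrite cards0; lra.
pose a := [arg min_(i < x in S) (i : nat)]; pose b := [arg max_(i > x in S) (i : nat)].
have [aS amin] : a \in S /\ forall j, j \in S -> (a <= j)%N.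
  by rewrite /a; case: arg_minnP.
have [bS bmax] : b \in S /\ forall j, j \in S -> (j <= b)%N.
  by rewrite /b; case: arg_maxnP.
have ab : (a <= b)%N by exact: amin.
have card : (#|S| <= (b - a).+1)%N.
  rewrite cardE -(size_map val) -(size_iota a (b - a).+1); apply: uniq_leq_size.
    by rewrite map_inj_uniq ?enum_uniq//; exact: val_inj.
  move=> i /mapP[j]; rewrite mem_enum => jS ->; rewrite mem_iota amin//=.
  by rewrite addnS subnKC// ltnS bmax.
apply: (@le_trans _ _ (b - a).+1%:R); first by rewrite ler_nat.
by rewrite -natr1 natrB// lerD2r hS.
Qed.

Lemma expRN2_le : 2 * expR (- 2) <= 8 / 25 :> R.
Proof.
rewrite expRN -[leRHS]invrK ler_pdivrMr ?expR_gt0//.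
have := @expR_ge_partial R 2 4 (ler0n _ _).
by rewrite !big_ord_recr big_ord0 /= !factE /=; lra.
Qed.

Definition window n A : bool := (2 * A%:R - n%:R) ^+ 2 <= 4 * n%:R :> R.

(* The lower bound on the class size is imposed, instead of deduced from the
   window, because the excluded classes carry little mass anyway. *)
Definition typical_class n A : bool :=
  window n A && ((4 : R) ^+ n <= 64 * n%:R * #|colour_class n A|%:R ^+ 2).

Lemma sum_class n (P : pred 'I_n.+1) (f : {ffun 'I_n -> bool} -> R) :
  \sum_(A | P A) \sum_(s in colour_class n A) f s =
  \sum_s f s * (P (inord #|zeros s|))%:R.
Proof.
have zn (s : {ffun 'I_n -> bool}) : (#|zeros s| < n.+1)%N.
  by rewrite ltnS -[leqRHS]card_ord max_card.
rewrite (exchange_big_dep xpredT)//=; apply: eq_bigr => s _.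
case: (boolP (P _)) => hP; last first.
  rewrite mulr0 big1// => A /andP[PA]; rewrite inE => /eqP sA; case/negP: hP.
  by rewrite sA inord_val.
rewrite mulr1 (big_pred1 (inord #|zeros s|))// => A /=; rewrite inE.
apply/andP/eqP => [[_ /eqP ->]|->]; first by rewrite inord_val.
by rewrite hP inordK.
Qed.

(** Relative to [2 ^+ n], colourings outside the window have mass at most
    [2 * expR (- 2) <= 8 / 25]. Inside it at most [3 * sqrt n] classes are too small, each of mass
    at most [1 / (8 * sqrt n)]. This leaves at least 1 - 8 / 25 - 3 / 8, which is above 1 / 4. *)
Lemma typical_mass n : (0 < n)%N ->
  4^-1 * 2 ^+ n <= \sum_(A < n.+1 | typical_class n A) #|colour_class n A|%:R :> R.
Proof.
move=> n0; have nR : 0 < n%:R :> R by rewrite ltr0n.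
pose y := Num.sqrt (n%:R : R).
have y2 : y ^+ 2 = n%:R by rewrite sqr_sqrtr// ltW.
have y1 : 1 <= y by rewrite -[leLHS]sqrtr1 ler_sqrt// ?ler1n// ltr0n.
have e2 : (2 : R) ^+ n = \sum_(s : {ffun 'I_n -> bool}) 1.
  by rewrite sumr_const -card_config.
have cls (P : pred 'I_n.+1) : \sum_(A | P A) #|colour_class n A|%:R =
    \sum_(A | P A) \sum_(s in colour_class n A) 1 :> R.
  by apply: eq_bigr => A _; rewrite sumr_const.
pose rare (A : 'I_n.+1) := window n A && ~~ typical_class n A.
have mass_split : (2 : R) ^+ n <= 2 ^+ n * (2 * expR (- (4%:R / 2))) +
    \sum_(A | rare A) #|colour_class n A|%:R +
    \sum_(A < n.+1 | typical_class n A) #|colour_class n A|%:R.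
  rewrite (cls rare) (cls (fun A => typical_class n A)) !sum_class {1}e2.
  apply: le_trans (lerD (lerD (mag_tail R n 4) (lexx _)) (lexx _)).
  rewrite -!big_split /=; apply: ler_sum => s _.
  have zn : (#|zeros s| < n.+1)%N by rewrite ltnS -[leqRHS]card_ord max_card.
  rewrite /rare !inordK// !mul1r.
  case: (boolP (window n #|zeros s|)) => w; last first.
    have -> : (4%:R <= mag R s ^+ 2 / n%:R)%R.
      by rewrite ler_pdivlMr// mag_zeros; move: w; rewrite /window -ltNge => /ltW.
    by rewrite -addrA lerDl addr_ge0 ?ler0n.
  case: (typical_class n _); rewrite /= ?addr0 ?lerDr ?addr_ge0 ?ler0n//.
have rare_mass : \sum_(A | rare A) #|colour_class n A|%:R <= 3 / 8 * 2 ^+ n :> R.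
  apply: (@le_trans _ _ (\sum_(A | rare A) (2 ^+ n / (8 * y)))).
    apply: ler_sum => A /andP[w]; rewrite /typical_class w /= -ltNge => h.
    rewrite -(@ler_pXn2r _ 2) ?nnegrE ?divr_ge0 ?exprn_ge0 ?mulr_ge0//; [|lra].
    rewrite expr_div_n exprMn y2 ler_pdivlMr ?mulr_gt0 ?exprn_gt0//.
    rewrite -exprM mulnC exprM (_ : 2 ^+ 2 = 4 :> R); last by rewrite -natrX.
    by apply: le_trans (ltW h); lra.
  rewrite sumr_const -[_ *+ #|_|]mulr_natl.
  have : #|rare|%:R <= 2 * y + 1.
    rewrite -(cardsE rare); apply: card_ord_interval; last lra.
    move=> a b; rewrite !inE => /andP[wa _] /andP[wb _].
    have root (x : R) : x ^+ 2 <= 4 * n%:R -> x <= 2 * y.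
      move=> hx; case: (leP x (2 * y)) => // xy.
      have d1 : 0 < (x - 2 * y) * (x + 2 * y) by rewrite mulr_gt0//; lra.
      lra.
    have := root _ wb; have := root (- (2 * a%:R - n%:R)); rewrite sqrrN => /(_ wa); lra.
  move=> h.
  have c0 : 0 <= 2 ^+ n / (8 * y) by rewrite divr_ge0 ?exprn_ge0// mulr_ge0//; lra.
  apply: (le_trans (ler_wpM2r c0 h)).
  apply: (@le_trans _ _ (3 * y * (2 ^+ n / (8 * y)))); first by rewrite ler_wpM2r//; lra.
  by rewrite le_eqVlt; apply/orP; left; apply/eqP; field; lra.
have := expRN2_le; rewrite (_ : 4%:R / 2 = 2) in mass_split; last by field.
move=> h; have P0 := exprn_ge0 n (ler0n R 2).
by have := ler_wpM2l P0 h; lra.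
Qed.

Definition nall n k (h : seq {ffun 'I_k -> 'I_n}) : R :=
  \sum_s (all (bichro s) h)%:R.

Lemma pow_shift_ge (x : R) m : 0 <= x -> x <= 2^-1 -> expR (- (m%:R * (2 * x))) <= (1 - x) ^+ m.
Proof.
move=> x0 x1; rewrite -mulrN expRM_natl lerXn2r ?nnegrE ?expR_ge0//; first by lra.
rewrite expRN -[leRHS]invrK lef_pV2 ?posrE ?expR_gt0 ?invr_gt0//; last by lra.
apply: le_trans (expR_ge1Dx _); rewrite -[leLHS]mul1r ler_pdivrMr; last by lra.
have : 0 <= x * (1 - 2 * x) by rewrite mulr_ge0//; lra.
lra.
Qed.

(** The expected total size [J] of the typical classes with low ratio is at most [eps / 2] times the
    typical mass [W]; by Markov's inequality [J] is at most [W / 2] up to probability [eps].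
    Replacing the survival probability of a class by the balanced one costs the constant factor
    [eta]. *)
Lemma nall_tail k (r : R) : (3 <= k)%N -> 0 <= r -> rate_bound k r ->
  forall eps : R, 0 < eps -> exists d : R, 0 < d /\ exists N : nat,
  forall n m : nat, (N <= n)%N -> m%:R <= r * n%:R + 1 ->
    expect m (fun h : seq {ffun 'I_k -> 'I_n} =>
      (nall h < d * ((1 - (2 ^+ k.-1)^-1) ^+ m * 2 ^+ n))%R%:R) <= eps.
Proof.
move=> k3 r0 rb eps eps0.
have [|d [d0 [N hN]]] := class_ratio_tail k3 r0 rb (_ : 0 < eps / 2); first by rewrite divr_gt0.
pose K2 : R := k%:R ^+ 2.
pose eta := expR (- ((r + 1) * (4 * K2))).
have eta0 : 0 < eta by exact: expR_gt0.
(* 1 / 8 is half of the typical mass 1 / 4. *)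
exists (d * eta / 8); split; first by rewrite divr_gt0// mulr_gt0.
exists (maxn N (Num.truncn (4 * K2)).+1) => n m; rewrite geq_max => /andP[nN nK] hm.
have nK4 : 4 * K2 < n%:R.
  by apply: lt_le_trans (truncnS_gt _) _; rewrite ler_nat.
have K20 : 0 <= K2 by exact: sqr_ge0.
have nR : 0 < n%:R :> R by lra.
have n0 : (0 < n)%N by rewrite -(ltr0n R).
have n_ge1 : 1 <= n%:R :> R by rewrite ler1n.
have n_large : k%:R ^+ 2 / n%:R <= 4^-1 :> R by rewrite -/K2 ler_pdivrMr//; lra.
have K4 := exp2_pred_ge4 R k3; set q0 : R := 1 - (2 ^+ k.-1)^-1.
have q034 : 3 / 4 <= q0.
  have : (2 ^+ k.-1)^-1 <= 4^-1 :> R by rewrite lef_pV2 ?posrE ?exprn_gt0.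
  by rewrite /q0; lra.
have mn : m%:R / n%:R <= r + 1 by rewrite ler_pdivrMr//; nra.
pose T := typical_class n.
pose cl A : {set {ffun 'I_n -> bool}} := colour_class n A.
pose low A (h : seq {ffun 'I_k -> 'I_n}) : bool :=
  ratio (cl A) (@bichro n k) (class_rate R k n A) h < d.
pose W : R := \sum_(A < n.+1 | T A) #|cl A|%:R.
pose J h : R := \sum_(A < n.+1 | T A) #|cl A|%:R * (low A h)%:R.
have hW : 4^-1 * 2 ^+ n <= W by exact: typical_mass.
have W0 : 0 < W by apply: lt_le_trans hW; rewrite mulr_gt0 ?exprn_gt0.
have EJ : expect m J <= eps / 2 * W.
  rewrite /J expect_sum /W mulr_sumr; apply: ler_sum => A /andP[wA hA].
  by rewrite expectZ mulrC ler_wpM2r ?ler0n// hN.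
have qm A : T A -> q0 ^+ m * eta <= class_rate R k n A ^+ m /\ 0 < class_rate R k n A.
  move=> /andP[wA hA].
  have B0 : (0 < #|cl A|)%N.
    rewrite lt0n; apply/eqP => b0; move: hA; rewrite -/(cl A) b0 expr0n mulr0 leNgt.
    by rewrite exprn_gt0.
  have [q1 /andP[q2 _]] := class_rate_bounds k3 n0 wA n_large B0.
  split; last by lra.
  rewrite -/q0 -/K2 in q2 n_large.
  pose x := K2 / n%:R / q0.
  have q00 : 0 < q0 by lra.
  have x0 : 0 <= x by rewrite !divr_ge0// ltW.
  have x1 : x <= 2^-1 by rewrite ler_pdivrMr//; lra.
  apply: (@le_trans _ _ (q0 ^+ m * (1 - x) ^+ m)).
    rewrite ler_wpM2l ?exprn_ge0 ?(ltW q00)//.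
    apply: le_trans (pow_shift_ge m x0 x1); rewrite ler_expR lerN2.
    have -> : m%:R * (2 * x) = m%:R / n%:R * (2 / q0 * K2) by rewrite /x; field; rewrite !gt_eqF.
    rewrite ler_pM ?mulr_ge0 ?invr_ge0 ?divr_ge0 ?(ltW q00)//.
    by rewrite ler_wpM2r// ler_pdivrMr//; lra.
  rewrite -exprMn lerXn2r ?nnegrE//; [|lra|].
    by rewrite mulr_ge0 ?(ltW q00)//; lra.
  by rewrite mulrBr mulr1 /x mulrC divfK ?gt_eqF// (le_trans _ q2).
have nall_ge h : size h = m -> d * eta * q0 ^+ m * (W - J h) <= nall h.
  move=> hs; rewrite /W /J -sumrB mulr_sumr.
  apply: (@le_trans _ _ (\sum_(A < n.+1 | T A) \sum_(s in cl A) (all (bichro s) h)%:R)); last first.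
    rewrite sum_class; apply: ler_sum => s _.
    by case: (T _); rewrite ?mulr1// mulr0 ler0n.
  apply: ler_sum => A TA; have [q1 q2] := qm A TA.
  case: (boolP (low A h)) => hl; rewrite ?mulr1 ?mulr0 ?subrr ?subr0.
    by rewrite mulr0 sumr_ge0.
  move: hl; rewrite /low -leNgt /ratio hs.
  have [B0|B0] := posnP #|cl A|; first by rewrite B0 mulr0 => _; rewrite sumr_ge0.
  have BR : 0 < #|cl A|%:R :> R by rewrite ltr0n.
  rewrite ler_pdivlMr ?mulr_gt0 ?exprn_gt0// => h1; apply: le_trans h1.
  have := ler_wpM2l (ltW (mulr_gt0 d0 BR)) q1; lra.
have pt h : size h = m ->
    (nall h < d * eta / 8 * (q0 ^+ m * 2 ^+ n))%R%:R <= 2 / W * J h.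
  move=> hs; have J0 : 0 <= J h by apply: sumr_ge0 => A _; rewrite mulr_ge0.
  case: (ltP (nall h) _) => hl /=; last by rewrite mulr_ge0// divr_ge0// ltW.
  rewrite mulrAC ler_pdivlMr// mul1r.
  have := nall_ge h hs => h2.
  have Q0 : 0 < d * eta * q0 ^+ m by rewrite !mulr_gt0 ?exprn_gt0//; lra.
  have h3 : d * eta * q0 ^+ m * (W - J h) < d * eta * q0 ^+ m * (2 ^+ n / 8).
    by apply: le_lt_trans h2 _; apply: (lt_le_trans hl); lra.
  by rewrite ltr_pM2l// in h3; lra.
apply: (le_trans (expect_le pt)).
rewrite expectZ; apply: (le_trans (ler_wpM2l _ EJ)); first by rewrite divr_ge0// ltW.
by rewrite le_eqVlt; apply/orP; left; apply/eqP; field; rewrite gt_eqF.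
Qed.

End AllTail.

(** * From tuples to hypergraphs *)

Section Transfer.
Variable R : realType.

Definition uniform_sets (n k : nat) : {set {set 'I_n}} := [set X : {set 'I_n} | #|X| == k].

Lemma card_uniform_sets n k : #|uniform_sets n k| = 'C(n, k).
Proof. by rewrite card_draws card_ord. Qed.

Lemma in_hypergraphs k n m (H : hypergraph n) :
  (H \in hypergraphs k n m) = (H \subset uniform_sets n k) && (#|H| == m).
Proof.
rewrite inE; congr (_ && _); apply/forall_inP/fintype.subsetP => h e eH.
  by rewrite inE h.
by have := h e eH; rewrite inE.
Qed.

Lemma card_hypergraphs k n m : #|hypergraphs k n m| = 'C('C(n, k), m).
Proof.
rewrite -(card_uniform_sets n k) -cards_draws; apply: eq_card => H.
by rewrite in_hypergraphs inE.
Qed.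

Definition edges_of n k (h : seq {ffun 'I_k -> 'I_n}) : hypergraph n :=
  foldr (fun (e : {ffun 'I_k -> 'I_n}) H => (e @: 'I_k) |: H) finset.set0 h.

Lemma sum_add_edge n k m (f : hypergraph n -> R) :
  m.+1%:R * \sum_(H in hypergraphs k n m.+1) f H =
  \sum_(H in hypergraphs k n m) \sum_(X in uniform_sets n k | X \notin H) f (X |: H).
Proof.
transitivity (\sum_(p : hypergraph n * {set 'I_n} |
    (p.1 \in hypergraphs k n m.+1) && (p.2 \in p.1)) f p.1).
  rewrite -(pair_big_dep (fun H : hypergraph n => H \in hypergraphs k n m.+1)
    (fun (H : hypergraph n) (X : {set 'I_n}) => X \in H) (fun H X => f H)) mulr_sumr.
  apply: eq_bigr => H; rewrite in_hypergraphs => /andP[_ /eqP <-].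
  by rewrite sumr_const mulr_natl.
rewrite (pair_big_dep (fun H : hypergraph n => H \in hypergraphs k n m)
    (fun (H : hypergraph n) X => (X \in uniform_sets n k) && (X \notin H))
    (fun H X => f (X |: H))) /=.
pose h (p : hypergraph n * {set 'I_n}) : hypergraph n * {set 'I_n} := (p.2 |: p.1, p.2).
pose h' (p : hypergraph n * {set 'I_n}) : hypergraph n * {set 'I_n} := (p.1 :\ p.2, p.2).
rewrite (reindex_onto h h'); last first.
  by move=> [H X] /= /andP[_ XH]; rewrite /h /h' /= finset.setD1K.
apply: eq_bigl => -[H X]; rewrite /h /h' /= !in_hypergraphs finset.setU11 andbT.
rewrite xpair_eqE eqxx andbT finset.subUset finset.sub1set.
case: (boolP (X \in H)) => XH.
  rewrite !andbF; apply/negP => /andP[_ /eqP e]; have := XH.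
  by rewrite -e !inE eqxx.
rewrite finset.setU1K// eqxx andbT cardsU1 XH add1n eqSS /=.
by case: (X \in _); case: (H \subset _); case: (_ == m).
Qed.

(** Every [k]-set is the image of [k!] injective tuples; nonnegativity allows the non-injective ones
    to be discarded. *)
Lemma sum_uniform_sets n k (g : {set 'I_n} -> R) : (forall X, 0 <= g X) ->
  k`!%:R * \sum_(X in uniform_sets n k) g X <=
  \sum_(e : {ffun 'I_k -> 'I_n}) g (e @: 'I_k).
Proof.
move=> g0.
rewrite [leRHS](partition_big (fun e : {ffun 'I_k -> 'I_n} => e @: 'I_k) xpredT)//=.
rewrite mulr_sumr big_mkcond; apply: ler_sum => X _; case: ifP => XE; last first.
  by apply: sumr_ge0 => e _.
rewrite (eq_bigr (fun=> g X)); last by move=> e /eqP ->.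
rewrite sumr_const -[leRHS]mulr_natl ler_wpM2r// ler_nat.
move: XE; rewrite inE => /eqP cX.
have <- : #|[set e : {ffun 'I_k -> 'I_n} in ffun_on (mem X) | injectiveb e]| = k`!.
  by rewrite card_inj_ffuns_on card_ord cX ffactnn.
apply: subset_leq_card; apply/fintype.subsetP => e; rewrite !inE => /andP[/ffun_onP eX /injectiveP einj].
change (e @: 'I_k == X); rewrite eqEcard card_imset// card_ord cX leqnn andbT.
by apply/fintype.subsetP => v /imsetP[i _ ->]; exact: eX.
Qed.

(** A new edge is uniform among at least [N - M] absent sets, while a random tuple hits each of them
    with probability [k! / n ^ k]; the quotient is the cost per edge. The common bound [M] lets the
    induction on [m] run with one cost. *)
Lemma hypergraph_sum_le n k M m (f : hypergraph n -> R) (N := 'C(n, k)) :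
  (0 < n)%N -> (M < N)%N -> (m <= M)%N -> (forall H, 0 <= f H) ->
  \sum_(H in hypergraphs k n m) f H <=
  #|hypergraphs k n m|%:R * (n%:R ^+ k / (k`!%:R * (N - M)%:R)) ^+ m *
  expect m (fun h => f (@edges_of n k h)).
Proof.
move=> n0 MN; elim: m f => [|m IH] f mM f0.
  rewrite card_hypergraphs bin0 expr0 !mul1r /= (big_pred1 finset.set0)// => H /=.
  by rewrite in_hypergraphs cards_eq0; case: eqP => [->|]; rewrite ?finset.sub0set ?andbF.
set rho := n%:R ^+ k / _ in IH *.
have NM0 : 0 < (N - M)%:R :> R by rewrite ltr0n subn_gt0.
have kf0 : 0 < k`!%:R :> R by rewrite ltr0n fact_gt0.
have nk0 : 0 < n%:R ^+ k :> R by rewrite exprn_gt0// ltr0n.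
have rho0 : 0 < rho by rewrite divr_gt0// mulr_gt0.
pose f' H : R := avg (fun e : {ffun 'I_k -> 'I_n} => f ((e @: 'I_k) |: H)).
have f'0 H : 0 <= f' H by apply: avg_ge0.
have step : m.+1%:R * \sum_(H in hypergraphs k n m.+1) f H <=
    n%:R ^+ k / k`!%:R * \sum_(H in hypergraphs k n m) f' H.
  rewrite sum_add_edge mulr_sumr; apply: ler_sum => H _.
  apply: (@le_trans _ _ (\sum_(X in uniform_sets n k) f (X |: H))).
    by rewrite [leRHS]big_mkcond [leLHS]big_mkcond; apply: ler_sum => X _; case: (X \in uniform_sets n k); case: (X \in H).
  have := sum_uniform_sets k (fun X => f0 (X |: H)).
  rewrite /f' /avg card_tedge -ler_pdivlMl// => h; apply: (le_trans h).
  by rewrite le_eqVlt; apply/orP; left; apply/eqP; field; rewrite !gt_eqF.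
have hIH := IH f' (ltnW mM) f'0.
have eE : expect m.+1 (fun h => f (@edges_of n k h)) = expect m (fun h => f' (@edges_of n k h)) by [].
rewrite eE; set EE := expect m _ in hIH *.
have EE0 : 0 <= EE.
  rewrite -(@expect_cst R {ffun 'I_k -> 'I_n} m 0); last by rewrite card_ffun !card_ord expn_gt0 n0.
  by apply: expect_le => h _; exact: f'0.
have m0 : 0 < m.+1%:R :> R by [].
rewrite -(ler_pM2l m0); apply: (le_trans step).
apply: (le_trans (ler_wpM2l _ hIH)); first by rewrite divr_ge0 ?ltW.
have cE : m.+1%:R * #|hypergraphs k n m.+1|%:R = (N - m)%:R * #|hypergraphs k n m|%:R :> R.
  by rewrite !card_hypergraphs -!natrM mul_bin_left.
rewrite mulrA mulrA [leRHS]mulrA; apply: ler_wpM2r => //.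
rewrite [leRHS]mulrA cE exprS -/N.
have -> : (N - m)%:R * #|hypergraphs k n m|%:R * (rho * rho ^+ m) =
  n%:R ^+ k / k`!%:R * ((N - m)%:R / (N - M)%:R) * (#|hypergraphs k n m|%:R * rho ^+ m).
  by rewrite {1}/rho; field; rewrite !gt_eqF.
rewrite -[leLHS]mulrA ler_wpM2r ?mulr_ge0 ?exprn_ge0 ?(ltW rho0)//.
rewrite ler_peMr ?divr_ge0 ?(ltW nk0)// ler_pdivlMr// mul1r ler_nat leq_sub2l//.
exact: ltnW.
Qed.

End Transfer.

(** * The transfer for linearly many edges *)

Section Hypergraphs.
Variable R : realType.

Lemma leq_exp_ffact n j : ((n - j) ^ j <= n ^_ j)%N.
Proof.
suff h i : (i <= j -> (n - j) ^ i <= n ^_ i)%N by exact: h.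
elim: i => // i IH ij; have ij' := ltnW ij.
by rewrite expnSr ffactnSr leq_mul ?IH ?leq_sub2l.
Qed.

Lemma bernoulli (x : R) m : 0 <= x -> x <= 1 -> 1 - m%:R * x <= (1 - x) ^+ m.
Proof.
move=> x0 x1; elim: m => [|m IH]; first by rewrite mul0r subr0 expr0.
rewrite exprS; have h : 0 <= 1 - x by lra.
apply: le_trans (ler_wpM2l h IH); rewrite -(natr1 m).
have : 0 <= m%:R * x ^+ 2 by rewrite mulr_ge0 ?sqr_ge0.
lra.
Qed.

(** The cost per edge is 1 plus a term of order [1 / n]: [K2] comes from repeated vertices in a
    tuple, [kf * (r + 1)] from edges already present. Its power to a linear [m] is therefore
    bounded. *)
Lemma hypergraph_sum_rate k (r : R) : (3 <= k)%N -> 0 <= r ->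
  exists T : R, 0 < T /\ exists N : nat, forall n m : nat, (N <= n)%N -> m%:R <= r * n%:R + 1 ->
   (m < 'C(n, k))%N /\ (n%:R ^+ k / (k`!%:R * ('C(n, k) - m)%:R)) ^+ m <= T.
Proof.
move=> k3 r0; pose K2 : R := k%:R ^+ 2; pose kf : R := k`!%:R.
have kf0 : 0 < kf by rewrite ltr0n fact_gt0.
have K20 : 0 <= K2 by exact: sqr_ge0.
have rk : 0 < kf * (r + 1) by rewrite mulr_gt0//; lra.
pose c1 := K2 + kf * (r + 1).
have c10 : 0 < c1 by rewrite /c1; lra.
exists (expR ((r + 1) * (2 * c1))); split; first exact: expR_gt0.
exists (maxn k (Num.truncn (2 * c1)).+1) => n m; rewrite geq_max => /andP[nk nc] hm.
have nc1 : 2 * c1 < n%:R.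
  by apply: lt_le_trans (truncnS_gt _) _; rewrite ler_nat.
have nR : 0 < n%:R :> R by lra.
have n1 : 1 <= n%:R :> R by rewrite ler1n -(ltr0n R).
have mn : m%:R <= (r + 1) * n%:R by nra.
pose x := c1 / n%:R.
have x0 : 0 <= x by rewrite divr_ge0// ltW.
have x1 : x <= 2^-1 by rewrite ler_pdivrMr//; lra.
have nkR : 0 < n%:R ^+ k :> R by rewrite exprn_gt0.
have big : n%:R ^+ k * (1 - x) <= kf * ('C(n, k)%:R - m%:R).
  have h1 : n%:R ^+ k * (1 - K2 / n%:R) <= kf * 'C(n, k)%:R.
    have -> : kf * 'C(n, k)%:R = (n ^_ k)%:R by rewrite /kf -natrM mulnC bin_ffact.
    apply: (@le_trans _ _ ((n - k) ^ k)%:R); last by rewrite ler_nat leq_exp_ffact.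
    rewrite natrX natrB//.
    have -> : n%:R - k%:R = n%:R * (1 - k%:R / n%:R) :> R by field; rewrite gt_eqF.
    rewrite exprMn ler_pM2l//.
    have -> : K2 / n%:R = k%:R * (k%:R / n%:R) by rewrite /K2; ring.
    by apply: bernoulli; rewrite ?divr_ge0// ler_pdivrMr// mul1r ler_nat.
  have h2 : kf * m%:R <= n%:R ^+ k * (kf * (r + 1) / n%:R).
    have e : (n%:R : R) ^+ k = n%:R * n%:R * n%:R ^+ k.-2.
      have ke : k = k.-2.+2 by move: k3; clear; case: k => [|[|]].
      by rewrite [in LHS]ke !exprS mulrA.
    have p1 : 1 <= (n%:R : R) ^+ k.-2 by rewrite exprn_ege1.
    rewrite e (_ : _ * (kf * (r + 1) / n%:R) = kf * ((r + 1) * n%:R) * n%:R ^+ k.-2); last first.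
      by field; rewrite gt_eqF.
    apply: (@le_trans _ _ (kf * ((r + 1) * n%:R))); first by rewrite ler_pM2l.
    by rewrite ler_peMr// mulr_ge0 ?(ltW kf0)// mulr_ge0 ?(ltW nR)//; lra.
  have -> : n%:R ^+ k * (1 - x) = n%:R ^+ k * (1 - K2 / n%:R) - n%:R ^+ k * (kf * (r + 1) / n%:R).
    by rewrite -mulrBr; congr (_ * _); rewrite /x /c1; ring.
  lra.
have bpos : 0 < n%:R ^+ k * (1 - x) by rewrite mulr_gt0//; lra.
have mC : (m < 'C(n, k))%N.
  rewrite -(ltr_nat R) -subr_gt0 -(pmulr_rgt0 _ kf0); exact: lt_le_trans big.
split=> //; rewrite natrB 1?ltnW//.
apply: (@le_trans _ _ ((1 - x)^-1 ^+ m)).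
  have d0 : 0 < kf * ('C(n, k)%:R - m%:R) by exact: lt_le_trans big.
  rewrite lerXn2r ?nnegrE ?divr_ge0 ?invr_ge0 ?(ltW d0) ?(ltW nkR)//; first lra.
  rewrite ler_pdivrMr// mulrC -ler_pdivrMr ?invr_gt0 ?invrK//; lra.
rewrite exprVn -[leRHS]invrK lef_pV2 ?posrE ?invr_gt0 ?expR_gt0 ?exprn_gt0//; last by lra.
rewrite -expRN; apply: le_trans (pow_shift_ge m x0 x1).
rewrite ler_expR lerN2.
have -> : m%:R * (2 * x) = m%:R / n%:R * (2 * c1) by rewrite /x; ring.
by rewrite ler_wpM2r ?mulr_ge0 ?(ltW c10)// ler_pdivrMr.
Qed.

Lemma monochromatic_image n k (s : colouring n) (e : {ffun 'I_k -> 'I_n}) : (0 < k)%N ->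
  monochromatic s (e @: 'I_k) = mono s e.
Proof.
move=> k0; pose i0 := Ordinal k0; rewrite /monochromatic.
apply/cards1P/idP => [[b hb]|/forallP h].
  have im i : s (e i) = b.
    by apply/set1P; rewrite -hb; apply: imset_f; exact: imset_f.
  by apply/forallP => i; apply/forallP => j; rewrite !im.
exists (s (e i0)); apply/setP => b; rewrite inE; apply/imsetP/eqP => [[v /imsetP[i _ ->] ->]|->].
  by have /forallP/(_ i0)/eqP := h i.
by exists (e i0) => //; exact: imset_f.
Qed.

Lemma two_colouring_edges n k (s : colouring n) h : (0 < k)%N ->
  two_colouring (@edges_of n k h) s = all (bichro s) h.
Proof.
move=> k0; rewrite /two_colouring; elim: h => [|e h IH] /=.
  by apply/forall_inP => X; rewrite inE.
rewrite -IH /bichro -(monochromatic_image s e k0).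
apply/forall_inP/andP => [H|[H1 /forall_inP H2] X].
  split; first by apply: H; rewrite !inE eqxx.
  by apply/forall_inP => X Xh; apply: H; rewrite !inE Xh orbT.
by rewrite !inE => /orP[/eqP ->//|]; exact: H2.
Qed.

Lemma Z_edges n k (h : seq {ffun 'I_k -> 'I_n}) : (0 < k)%N ->
  (Z (edges_of h))%:R = nall R h.
Proof.
move=> k0; rewrite /Z /two_colourings -sum1_card natr_sum big_mkcond /=.
by apply: eq_bigr => s _; rewrite inE two_colouring_edges//; case: (all _ _).
Qed.

(** The monochromatic [k]-sets of either colour and the edges of [H] form disjoint families. Hence
    every pair in [Lambda] has positive planted mass. *)
Lemma monochromatic_count_le k n m (H : hypergraph n) (s : colouring n) : (0 < k)%N ->
  H \in hypergraphs k n m -> two_colouring H s -> (F k s + m <= 'C(n, k))%N.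
Proof.
move=> k0; rewrite in_hypergraphs => /andP[/fintype.subsetP HE /eqP <-] /forall_inP Hs.
pose D b : {set {set 'I_n}} := [set X : {set 'I_n} | X \subset s @^-1: pred1 b & #|X| == k].
have monoD b X : X \in D b -> monochromatic s X.
  rewrite inE => /andP[/fintype.subsetP XD /eqP cX]; apply/cards1P; exists b.
  have /card_gt0P[x xX] : (0 < #|X|)%N by rewrite cX.
  apply/setP => c; rewrite inE; apply/imsetP/eqP => [[v vX ->]|->].
    by have := XD v vX; rewrite !inE => /eqP.
  by exists x => //; have := XD x xX; rewrite !inE => /eqP.
have dHD b : [disjoint D b & H].
  rewrite disjoint_subset; apply/fintype.subsetP => X XD; rewrite inE.
  by apply: contraL (monoD _ _ XD) => /Hs.
have dDD : [disjoint D false & D true].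
  rewrite disjoint_subset; apply/fintype.subsetP => X; rewrite !inE => /andP[/fintype.subsetP X0 /eqP cX].
  rewrite negb_and; apply/orP; left; apply/negP => /fintype.subsetP X1.
  have /card_gt0P[x xX] : (0 < #|X|)%N by rewrite cX.
  by have := X0 x xX; have := X1 x xX; rewrite !inE => /eqP ->.
rewrite -(card_uniform_sets n k) /F -!cards_draws -/(D false) -/(D true).
have -> : (#|D false| + #|D true| + #|H| = #|D false :|: D true :|: H|)%N.
  rewrite !cardsU; have /eqP -> : #|D false :&: D true| == 0%N by rewrite cards_eq0 finset.setI_eq0.
  rewrite (_ : (D false :|: D true) :&: H = finset.set0) ?cards0 ?subn0//.
  by apply/eqP; rewrite finset.setIUl; apply/eqP; rewrite (disjoint_setI0 (dHD _)) (disjoint_setI0 (dHD _)) finset.setU0.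
apply: subset_leq_card; apply/fintype.subsetP => X; rewrite !finset.in_setU => /orP[/orP[]|/HE//]; by rewrite !inE => /andP[].
Qed.

Lemma edge_number_le k (d : R) n : (0 < k)%N -> 0 < d ->
  (edge_number k d n)%:R <= d / k%:R * n%:R + 1.
Proof.
move=> k0 d0; rewrite /edge_number natr_absz.
have x0 : 0 <= d * n%:R / k%:R by rewrite divr_ge0// mulr_ge0// ltW.
rewrite ger0_norm ?ceil_ge0; last by apply: lt_le_trans x0; rewrite ltrN10.
have := ceilB1_lt (d * n%:R / k%:R); rewrite intrB.
have -> : d / k%:R * n%:R = d * n%:R / k%:R by rewrite mulrAC.
lra.
Qed.

End Hypergraphs.

(** * Comparing the two models *)

Section Contiguity.
Variable R : realType.

Lemma uniform_pmf_ge0 (T : finType) (A : {set T}) x : 0 <= uniform_pmf R A x.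
Proof. by rewrite /uniform_pmf divr_ge0. Qed.

Lemma uniform_pmf_le (T : finType) (A : {set T}) x : uniform_pmf R A x <= #|A|%:R^-1.
Proof. by rewrite /uniform_pmf ler_piMl ?invr_ge0// lern1 leq_b1. Qed.

Lemma uniform_pmf_sum (T : finType) (A : {set T}) : \sum_x uniform_pmf R A x <= 1.
Proof.
rewrite /uniform_pmf -mulr_suml.
have -> : \sum_x (x \in A)%:R = #|A|%:R :> R.
  by rewrite -sum1_card natr_sum [RHS]big_mkcond; apply: eq_bigr => x _; case: (x \in A).
by have [->|A0] := posnP #|A|; rewrite ?mul0r// divff// pnatr_eq0 -lt0n.
Qed.

(** However unbalanced a colouring is, a random tuple is monochromatic with probability at least
    [2 ^- (k - 1)]. The bound limits the number of choices in the second stage of the planted model,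
    uniformly in the colouring. *)
Lemma card_two_coloured_le k n m (s : colouring n) (T : R) : (3 <= k)%N -> (0 < n)%N ->
  (m < 'C(n, k))%N -> (n%:R ^+ k / (k`!%:R * ('C(n, k) - m)%:R)) ^+ m <= T ->
  #|[set H in hypergraphs k n m | two_colouring H s]|%:R <=
  #|hypergraphs k n m|%:R * T * (1 - (2 ^+ k.-1)^-1) ^+ m :> R.
Proof.
move=> k3 n0 mC hT; have k0 : (0 < k)%N by exact: leq_trans k3.
have -> : #|[set H in hypergraphs k n m | two_colouring H s]|%:R =
    \sum_(H in hypergraphs k n m) (two_colouring H s)%:R :> R.
  rewrite -sum1_card natr_sum (eq_bigl (fun H => (H \in hypergraphs k n m) && two_colouring H s)).
    by rewrite big_mkcondr; apply: eq_bigr => H _; case: (two_colouring _ _).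
  by move=> H; rewrite [LHS]inE.
have f0 (H : hypergraph n) : 0 <= (two_colouring H s)%:R :> R by [].
apply: (le_trans (hypergraph_sum_le n0 mC (leqnn m) f0)).
have -> : expect m (fun h => (two_colouring (@edges_of n k h) s)%:R) =
    avg (fun e => (@bichro n k s e)%:R) ^+ m :> R.
  rewrite -expect_all; apply: expect_ext => h _; by rewrite two_colouring_edges.
have b0 : 0 <= avg (fun e => (@bichro n k s e)%:R) :> R by apply: avg_ge0.
have b1 : avg (fun e => (@bichro n k s e)%:R) <= 1 - (2 ^+ k.-1)^-1 :> R.
  rewrite avg_bichro// lerD2l lerN2 avg_mono//.
  have nR : 0 < n%:R :> R by rewrite ltr0n.
  have m1 : `|mag R s / n%:R| <= 1.
    by rewrite normrM normfV normr_nat ler_pdivrMr// mul1r mag_abs.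
  (* The imbalance is arbitrary here, so [x = 1]; the lower half of [mono_density_bounds] does not
     depend on [x]. *)
  have m2 : (mag R s / n%:R) ^+ 2 <= 4 * 1.
    by rewrite -(real_normK (num_real _)) mulr1 (le_trans (_ : _ <= 1))// ?expr_le1// ler1n.
  by have /andP[] := mono_density_bounds k3 m1 m2.
apply: ler_pM.
- by rewrite mulr_ge0// exprn_ge0// divr_ge0 ?exprn_ge0// mulr_ge0.
- exact: exprn_ge0.
- by rewrite ler_wpM2l.
- by rewrite lerXn2r// nnegrE (le_trans b0).
Qed.

(** A pair in [Lambda] has planted mass at least the inverse of [2 ^ n * c * T * q0 ^ m], and its
    mass in the random colouring model is the inverse of [#|Hp| * Z H]. Off [Bad] the quotient is at
    most [2 * T / d], and [Bad] itself carries mass at most [eps]. *)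
Lemma contiguity_bound k (r : R) : (3 <= k)%N -> 0 <= r -> rate_bound k r ->
  forall eps : R, 0 < eps -> exists C : R, 0 < C /\ exists N : nat,
  forall n m (E : {set hypergraph n * colouring n}), (N <= n)%N -> m%:R <= r * n%:R + 1 ->
    E \subset Lambda k n m ->
    prob (pi_rc R k n m) E <= eps + C * prob (pi_pl R k n m) E.
Proof.
move=> k3 r0 rb eps eps0; have k0 : (0 < k)%N by exact: leq_trans k3.
have [T [T0 [N1 hT]]] := hypergraph_sum_rate k3 r0.
(* Dividing by [T] offsets the cost of the transfer. The 1 / 2 keeps at least half of all
   hypergraphs 2-colourable, and [eps / 2] then bounds the conditional mass of [Bad] by [eps]. *)
pose e1 := Num.min 2^-1 (eps / 2) / T.
have e10 : 0 < e1 by rewrite divr_gt0// lt_min invr_gt0 ltr0n divr_gt0.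
have eT : T * e1 = Num.min 2^-1 (eps / 2) by rewrite /e1 mulrC divfK// gt_eqF.
have eT1 : T * e1 <= 2^-1 by rewrite eT ge_min lexx.
have eT2 : T * e1 <= eps / 2 by rewrite eT ge_min lexx orbT.
have [d [d0 [N2 hlow]]] := nall_tail k3 r0 rb e10.
exists (2 * T / d); split; first by rewrite divr_gt0// mulr_gt0.
exists (maxn (maxn N1 N2) 1) => n m E; rewrite !geq_max => /andP[/andP[n1 n2] n0] hm /fintype.subsetP EL.
have [mC hTm] := hT n m n1 hm.
have hlow' := hlow n m n2 hm.
set hyp := hypergraphs k n m.
pose c : R := #|hyp|%:R.
have c0 : 0 < c by rewrite ltr0n card_hypergraphs bin_gt0 ltnW.
have K4 := exp2_pred_ge4 R k3.
set q0 : R := 1 - (2 ^+ k.-1)^-1 in hlow'.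
have q00 : 0 < q0.
  have : (2 ^+ k.-1)^-1 <= 4^-1 :> R by rewrite lef_pV2 ?posrE ?exprn_gt0.
  by rewrite /q0; lra.
pose P : R := q0 ^+ m * 2 ^+ n.
have P0 : 0 < P by rewrite mulr_gt0 ?exprn_gt0.
have dP0 : 0 < d * P by exact: mulr_gt0.
pose Bad : {set hypergraph n} := [set H in hyp | ((Z H)%:R < d * P)%R].
pose Hp : {set hypergraph n} := [set H in hyp | (0 < Z H)%N].
have cBad : #|Bad|%:R <= c * (T * e1).
  have -> : #|Bad|%:R = \sum_(H in hyp) ((Z H)%:R < d * P)%R%:R :> R.
    rewrite -sum1_card natr_sum (eq_bigl (fun H => (H \in hyp) && ((Z H)%:R < d * P)%R)).
      by rewrite big_mkcondr; apply: eq_bigr => H _; case: (_ < _).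
    by move=> H; rewrite [LHS]inE.
  have f0 (H : hypergraph n) : 0 <= ((Z H)%:R < d * P)%R%:R :> R by [].
  apply: (le_trans (hypergraph_sum_le n0 mC (leqnn m) f0)).
  rewrite (@expect_ext _ _ _ _ (fun h => (nall R h < d * P)%R%:R)); last first.
    by move=> h _; rewrite Z_edges.
  have EE0 : 0 <= expect m (fun h : seq {ffun 'I_k -> 'I_n} => (nall R h < d * P)%R%:R) :> R.
    have t0 : (0 < #|{: {ffun 'I_k -> 'I_n}}|)%N by rewrite card_ffun !card_ord expn_gt0 n0.
    by rewrite -[leLHS](@expect_cst R _ m 0 t0); apply: expect_le => h _; exact: ler0n.
  rewrite -mulrA ler_wpM2l// ler_pM// ?exprn_ge0// divr_ge0 ?exprn_ge0// mulr_ge0//.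
have cHp : c / 2 <= #|Hp|%:R.
  have : c <= #|Bad|%:R + #|Hp|%:R.
    rewrite -natrD ler_nat; apply: leq_trans (leq_card_setU Bad Hp).
    apply: subset_leq_card; apply/fintype.subsetP => H HH; rewrite finset.in_setU.
    rewrite [H \in Bad]inE [H \in Hp]inE HH /=.
    by have [Z0|Z0] := posnP (Z H); rewrite ?orbT// Z0 dP0.
  have := ler_wpM2l (ltW c0) eT1; lra.
have Hp0 : 0 < #|Hp|%:R :> R by lra.
have pl0 p : 0 <= pi_pl R k n m p by rewrite mulr_ge0 ?uniform_pmf_ge0.
have rc0 p : 0 <= pi_rc R k n m p by rewrite mulr_ge0 ?uniform_pmf_ge0.
have pt p : p \in E -> pi_rc R k n m p <=
    (p.1 \in Bad)%:R * pi_rc R k n m p + 2 * T / d * pi_pl R k n m p.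
  move=> pE; case: (boolP (p.1 \in Bad)) => [_|pB].
    by rewrite mul1r lerDl mulr_ge0// divr_ge0 ?mulr_ge0// ltW.
  rewrite mul0r add0r; have := EL p pE; rewrite inE => /andP[pH pcol].
  have Zp : d * P <= (Z p.1)%:R.
    by move: pB; rewrite [_ \in Bad]inE pH /= -leNgt.
  have Zp0 : 0 < (Z p.1)%:R :> R by exact: lt_le_trans Zp.
  have up : pi_rc R k n m p <= 2 / c * (d * P)^-1.
    rewrite /pi_rc -/hyp -/Hp ler_pM ?uniform_pmf_ge0//.
      apply: (le_trans (uniform_pmf_le _ _)); rewrite -[leRHS]invrK lef_pV2 ?posrE ?invr_gt0 ?divr_gt0//.
      by rewrite invf_div.
    apply: (le_trans (uniform_pmf_le _ _)); rewrite -/(Z p.1) lef_pV2 ?posrE//.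
  apply: (le_trans up).
  have e : 2 / c * (d * P)^-1 = 2 * T / d * ((2 ^+ n)^-1 * (c * T * q0 ^+ m)^-1).
    by rewrite /P; field; rewrite !gt_eqF ?exprn_gt0.
  rewrite e ler_pM2l ?divr_gt0 ?mulr_gt0//.
  have sS : p.2 \in [set sigma : colouring n | (F k sigma + m <= 'C(n, k))%N].
    by rewrite inE (monochromatic_count_le k0 pH pcol).
  have pC : p.1 \in [set H in hyp | two_colouring H p.2] by rewrite inE; apply/andP; split.
  rewrite /pi_pl /uniform_pmf sS pC !mul1r ler_pM ?invr_ge0 ?exprn_ge0 ?mulr_ge0 ?exprn_ge0 ?(ltW c0) ?(ltW T0) ?(ltW q00)//.
    rewrite lef_pV2 ?posrE ?exprn_gt0// ?ltr0n; last by apply/card_gt0P; exists p.2.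
    by rewrite -(card_config R n) ler_nat max_card.
  rewrite lef_pV2 ?posrE ?mulr_gt0 ?exprn_gt0// ?ltr0n; last by apply/card_gt0P; exists p.1.
  exact: card_two_coloured_le.
have badsum : \sum_(p in E) (p.1 \in Bad)%:R * pi_rc R k n m p <= eps.
  apply: (@le_trans _ _ (\sum_p (p.1 \in Bad)%:R * pi_rc R k n m p)).
    by rewrite big_mkcond; apply: ler_sum => p _; case: ifP => // _; rewrite mulr_ge0.
  apply: (@le_trans _ _ (\sum_H (H \in Bad)%:R * #|Hp|%:R^-1)).
    rewrite -(pair_bigA _ (fun H s => (H \in Bad)%:R * pi_rc R k n m (H, s))) /=.
    apply: ler_sum => H _; rewrite -mulr_sumr ler_wpM2l//.
    rewrite /pi_rc /= -mulr_sumr -[leRHS]mulr1 ler_pM ?uniform_pmf_ge0 ?uniform_pmf_sum ?uniform_pmf_le//.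
    by apply: sumr_ge0 => s _; exact: uniform_pmf_ge0.
  rewrite -mulr_suml.
  have -> : \sum_H (H \in Bad)%:R = #|Bad|%:R :> R.
    by rewrite -sum1_card natr_sum [RHS]big_mkcond; apply: eq_bigr => H _; case: (H \in Bad).
  rewrite ler_pdivrMr//; apply: (le_trans cBad).
  have := ler_wpM2l (ltW c0) eT2; have := ler_wpM2l (ltW eps0) cHp; lra.
rewrite /prob; apply: (le_trans (ler_sum _ pt)).
by rewrite big_split /= -mulr_sumr lerD2r.
Qed.

End Contiguity.

Unset Implicit Arguments.

Theorem corollary1p4 (R : realType) (k : nat) (d' : R)
    (hk : (3 <= k)%N) (hd' : 0 < d')
    (hdk : d' / k%:R <= 2 ^+ (k - 1)%N * ln 2 - 2) :
  contiguous
    (fun n => Lambda k n (edge_number k d' n))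
    (fun n => pi_rc R k n (edge_number k d' n))
    (fun n => pi_pl R k n (edge_number k d' n)).
Proof.
move=> E EL hpl; have k0 : (0 < k)%N by exact: leq_trans hk.
have r0 : 0 <= d' / k%:R by rewrite divr_ge0// ltW.
rewrite subn1 in hdk; have rb := rate_bound_all hk r0 hdk.
apply/cvgr0Pnorm_lt => eps eps0.
have e20 : 0 < eps / 2 by rewrite divr_gt0.
have [C [C0 [N hN]]] := contiguity_bound hk r0 rb e20.
have d0 : 0 < eps / 2 / C by rewrite divr_gt0.
move/cvgr0Pnorm_lt: hpl => /(_ _ d0) hpl.
near=> n.
have h1 : `|prob (pi_pl R k n (edge_number k d' n)) (E n)| < eps / 2 / C.
  by near: n.
have nN : (N <= n)%N by near: n; exact: nbhs_infty_ge.
have := hN n (edge_number k d' n) (E n) nN (edge_number_le n k0 hd') (EL n).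
rewrite ger0_norm; last first.
  by apply: sumr_ge0 => p _; rewrite mulr_ge0 ?uniform_pmf_ge0.
move=> h2; apply: (le_lt_trans h2).
have h3 : prob (pi_pl R k n (edge_number k d' n)) (E n) < eps / 2 / C.
  by apply: le_lt_trans h1; exact: ler_norm.
rewrite ltr_pdivlMr// in h3; lra.
Unshelve. all: by end_near. Qed.
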